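(* Let $G$ be a linear semisimple Lie group, $\Gamma\le G$ a lattice, $X=G/\Gamma$, and $m$ the $G$-invariant probability measure on $X$. Let $H\le G$ be the horospherical subgroup of an $\mathbb{R}$-diagonalizable element of $G$, and assume that $H$ is abelian, $H=\{u_v:v\in\mathbb{R}^d\}\simeq\mathbb{R}^d$ with $d\ge2$. Let $x\in X$ satisfy $\overline{H.x}=X$ and suppose that $x$ has an effective equidistribution theorem of rate $\gamma>0$ with respect to $H$ and a Sobolev norm of order $K$. Then for every $\alpha>-1$ there exists $\gamma'>0$, depending on $\gamma$, such that for every smooth bounded function $f$ on $X$ with finite Sobolev norm of order $K$ and all sufficiently large $R$, $$\left|BR_{R,\alpha}f(x)-\int_Xf\,dm\right|\ll_f R^{-\gamma'} .$$
   Context: $G$ acts on $X$ by left translations; $\mathbb{R}^d$ carries the Euclidean norm. The horospherical subgroup of $a\in G$ is $\{g\in G: a^nga^{-n}\to e\text{ as }n\to-\infty\}$. Bochner–Riesz mean of order $\alpha>-1$ along $H$: $$BR_{R,\alpha}f(x)=\frac1{I^{\alpha}_1}\int_{\|v\|\le1}(1-\|v\|^2)_+^{\alpha}\,f(u_{Rv}.x)\,dv,\qquad I_1^{\alpha}=\int_{\|v\|\le1}(1-\|v\|^2)_+^{\alpha}\,dv .$$ Sobolev norm of order $K$: $\mathcal S_K(f)=\sum_{D}\|Df\|_{L^2(X,m)}$, the sum over monomials $D$ of degree at most $K$ in a fixed basis of $\mathrm{Lie}(G)$ acting as differential operators on $X$. Effective equidistribution: with $B_R^H=\{u_v:\|v\|\le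 R\}$ and $dh$, $\mathrm{vol}_H$ the Lebesgue measure transported to $H$, a point $x_0\in X$ has an effective equidistribution theorem of rate $\gamma>0$ with respect to $H$ and a Sobolev norm of order $K$ if there are $R_0=R_0(x_0)>0$ and $C>0$ such that for every smooth compactly supported $f:X\to\mathbb{C}$ with $\int_Xf\,dm=0$ and every $R>R_0$, $$\left|\frac1{\mathrm{vol}_H(B_R^H)}\int_{B_R^H}f(h.x_0)\,dh\right|\le C\,\mathcal S_K(f)\,R^{-\gamma}.$$ $\ll_f$ means inequality up to a multiplicative constant that may depend on $f$ (and on the fixed data) but not on $R$. *)

(* Defs.v *)
From HB Require Import structures.
From mathcomp Require Import all_boot all_order all_algebra.
From mathcomp Require Import generic_quotient complex.
From mathcomp Require Import all_classical all_reals all_analysis.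

Set Implicit Arguments.
Unset Strict Implicit.
Unset Printing Implicit Defensive.

Import Order.TTheory GRing.Theory Num.Theory.
Import numFieldNormedType.Exports.

Local Open Scope classical_set_scope.
Local Open Scope ring_scope.

(* Lebesgue measure on R^d, by recursion on d: the library has no
   d-dimensional Lebesgue measure, but it gives d.-tuple the product
   sigma-algebra, so leb d.+1 is the image of lebesgue_measure \x leb d under
   cons. *)
Section lebesgue_tuple.
Context {R : realType}.
Local Notation RR := (measurableTypeR R).

Definition tcons d (p : RR * d.-tuple RR) : d.+1.-tuple RR :=
  [the d.+1.-tuple RR of p.1 :: p.2].

Lemma measurable_tcons d : measurable_fun [set: RR * d.-tuple RR] (@tcons d).
Proof. exact: measurable_cons. Qed.

Section leb_step.
Variables (d : nat) (mu : {sigma_finite_measure set (d.-tuple RR) -> \bar R}).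

Definition leb_step : set (d.+1.-tuple RR) -> \bar R :=
  pushforward (@lebesgue_measure R \x mu)%E (@tcons d).

Let leb_step0 : leb_step set0 = 0%E.
Proof. by rewrite /leb_step /pushforward preimage_set0 measure0. Qed.

Let leb_step_ge0 A : (0 <= leb_step A)%E.
Proof. by rewrite /leb_step /pushforward; exact: measure_ge0. Qed.

Let leb_step_sigma_additive : semi_sigma_additive leb_step.
Proof.
move=> F mF tF mUF; rewrite /leb_step /pushforward preimage_bigcup.
have mp (A : set (d.+1.-tuple RR)) : measurable A -> measurable (@tcons d @^-1` A).
  by move=> mA; rewrite -[X in measurable X]setTI; exact: measurable_tcons.
apply: measure_semi_sigma_additive.
- by move=> n; exact: mp.
- apply/trivIsetP => /= i j _ _ ij; rewrite -preimage_setI.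
  by move/trivIsetP : tF => /(_ _ _ _ _ ij) ->//; rewrite preimage_set0.
- by rewrite -preimage_bigcup; exact: mp.
Qed.

HB.instance Definition _ := isMeasure.Build _ _ _ leb_step
  leb_step0 leb_step_ge0 leb_step_sigma_additive.

Let leb_step_sigma_finite : sigma_finite setT leb_step.
Proof.
have /sigma_finiteP[F [TF ndF Foo]] := sigma_finiteT (@lebesgue_measure R).
have /sigma_finiteP[G [TG ndG Goo]] := sigma_finiteT mu.
pose uncons (t : d.+1.-tuple RR) : RR * d.-tuple RR :=
  (thead t, [tuple of behead t]).
have tconsK : cancel (@tcons d) uncons.
  by move=> [a t]; congr (_, _); exact/val_inj.
have unconsK : cancel uncons (@tcons d).
  by move=> t; apply/val_inj; rewrite /= [in RHS](tuple_eta t).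
have muncons : measurable_fun [set: d.+1.-tuple RR] uncons.
  apply/measurable_fun_pairP; split; first exact: measurable_tnth.
  exact: measurable_behead.
exists (fun k => uncons @^-1` (F k `*` G k)).
  apply/seteqP; split=> // t _.
  have [k _ Fk] : (\bigcup_n F n) (uncons t).1 by rewrite -TF.
  have [l _ Gl] : (\bigcup_n G n) (uncons t).2 by rewrite -TG.
  exists (maxn k l) => //; split.
    by move: Fk; exact/subsetPset/ndF/leq_maxl.
  by move: Gl; exact/subsetPset/ndG/leq_maxr.
move=> k; have [mF Fk] := Foo k; have [mG Gk] := Goo k; split.
  by rewrite -[X in measurable X]setTI; apply: muncons => //; exact: measurableX.
rewrite /leb_step /pushforward -comp_preimage.
rewrite (_ : uncons \o _ = id) ?preimage_id.
  by rewrite product_measure1E// lte_mul_pinfty// ge0_fin_numE.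
by apply/funext => p; exact: tconsK.
Qed.

HB.instance Definition _ := Measure_isSigmaFinite.Build _ _ _ leb_step
  leb_step_sigma_finite.

End leb_step.

Fixpoint leb (d : nat) : {sigma_finite_measure set (d.-tuple RR) -> \bar R} :=
  match d with
  | 0 => dirac [tuple]
  | d'.+1 => leb_step (leb d')
  end.

End lebesgue_tuple.

Section euclidean.
Context {R : realType} {d : nat}.

Definition row_of_tuple (t : d.-tuple (measurableTypeR R)) : 'rV[R]_d :=
  \row_i tnth t i.

(* The library's norm on 'rV[R]_d is the sup norm. *)
Definition enorm (v : 'rV[R]_d) : R := Num.sqrt (\sum_i v 0 i ^+ 2).

Definition eball (r : R) : set (d.-tuple (measurableTypeR R)) :=
  [set t | enorm (row_of_tuple t) <= r].

End euclidean.
Arguments eball {R} d r.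

Definition Cintegral d (T : measurableType d) (R : realType)
    (mu : {measure set T -> \bar R}) (D : set T) (f : T -> R[i]) : R[i] :=
  Complex (\int[mu]_(x in D) complex.Re (f x)) (\int[mu]_(x in D) complex.Im (f x)).

Section linear_groups.
Context {R : realType} {n : nat}.
Local Notation M := 'M[R]_n.+1.

Record mxgroup := MxGroup {
  mxgroup_set :> set M;
  mxgroup_unit : forall g, mxgroup_set g -> g \is a GRing.unit;
  mxgroup1 : mxgroup_set 1;
  mxgroupM : forall g h, mxgroup_set g -> mxgroup_set h -> mxgroup_set (g * h);
  mxgroupV : forall g, mxgroup_set g -> mxgroup_set g^-1 }.

Definition closed_in_GL (G : set M) :=
  forall g, g \is a GRing.unit -> closure G g -> G g.

Definition expm (A : M) : M := limn (series (fun k => (k`!%:R)^-1 *: A ^+ k)).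

Definition lie (G : set M) : set M := [set A | forall t : R, G (expm (t *: A))].

Definition bracket (A B : M) : M := A * B - B * A.

Definition lie_ideal (G : set M) (I : {vspace M}) :=
  (forall A, A \in I -> lie G A) /\
  (forall A B, lie G A -> B \in I -> bracket A B \in I).

Definition derived (U : {vspace M}) : {vspace M} :=
  <<[seq bracket A B | A <- vbasis U, B <- vbasis U]>>%VS.

Definition lie_solvable (U : {vspace M}) := exists k, iter k derived U = 0%VS.

Definition semisimple (G : set M) :=
  forall I : {vspace M}, lie_ideal G I -> lie_solvable I -> I = 0%VS.

Definition lie_basis (G : set M) r (b : r.-tuple M) :=
  free b /\ forall A, lie G A <-> A \in <<b>>%VS.

(* The limit of a^n g a^-n as n -> -oo, written with n = - k. *)
Definition horospherical (G : set M) (a : M) : set M :=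
  [set g | G g /\ (a ^- k * g * a ^+ k) @[k --> \oo] --> (1 : M)].

Definition vector_group_iso d (u : 'rV[R]_d -> M) (H : set M) :=
  [/\ range u = H,
      forall v w, u (v + w) = u v * u w,
      continuous u &
      exists2 w : M -> 'rV[R]_d, cancel u w & {within H, continuous w}].

End linear_groups.
Arguments mxgroup : clear implicits.

Section homogeneous_space.
Context {R : realType} {n : nat}.
Local Notation M := 'M[R]_n.+1.

Definition mxg (G : mxgroup R n) : Type := set_type G.

HB.instance Definition _ G := Topological.copy (mxg G) (set_type G).

Definition mxg_one (G : mxgroup R n) : set_type G := exist _ 1 (mem_set (mxgroup1 G)).

HB.instance Definition _ G := isPointed.Build (mxg G) (mxg_one G).

Definition mxg_val (G : mxgroup R n) (g : mxg G) : M := \val (g : set_type G).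

(* Elements of G sent to themselves, other matrices to 1; act below is thus the
   left translation action when its first argument is in G. *)
Definition to_mxg (G : mxgroup R n) (g : M) : mxg G := insubd (mxg_one G) g.

Variables G Gam : mxgroup R n.

Definition coset_rel : rel (mxg G) :=
  fun g h => `[< mxgroup_set Gam ((mxg_val g)^-1 * mxg_val h) >].

Let mxg_unit (g : mxg G) : mxg_val g \is a GRing.unit.
Proof. by apply: (@mxgroup_unit _ _ G); exact: set_mem (valP (g : set_type G)). Qed.

Lemma coset_rel_refl : reflexive coset_rel.
Proof. by move=> g; apply/asboolP; rewrite mulVr//; exact: mxgroup1. Qed.

Lemma coset_rel_sym : symmetric coset_rel.
Proof.
have sym g h : coset_rel g h -> coset_rel h g.
  move=> /asboolP/mxgroupV; rewrite invrM ?unitrV// invrK => ?.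
  exact/asboolP.
by move=> g h; apply/idP/idP; exact: sym.
Qed.

Lemma coset_rel_trans : transitive coset_rel.
Proof.
move=> h g k /asboolP gh /asboolP hk; apply/asboolP.
by have := mxgroupM gh hk; rewrite mulrA mulrK.
Qed.

Canonical coset_equiv := EquivRel coset_rel coset_rel_refl coset_rel_sym coset_rel_trans.

(* G/Gam with the quotient topology and its Borel sigma-algebra. *)
Definition quo : Type := quotient_topology {eq_quot coset_equiv}%qT.

HB.instance Definition _ := PointedTopological.copy quo (quotient_topology {eq_quot coset_equiv}%qT).
HB.instance Definition _ := Quotient.copy quo (quotient_topology {eq_quot coset_equiv}%qT).
HB.instance Definition _ := Measurable.copy quo (g_sigma_algebraType (@open quo)).

Definition act (g : M) (x : quo) : quo :=
  \pi_quo%qT (to_mxg G (g * mxg_val (repr x))).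

End homogeneous_space.

Section functions_on_quotient.
Context {R : realType} {n : nat} {G Gam : mxgroup R n}.
Local Notation M := 'M[R]_n.+1.
Local Notation X := (quo G Gam).

Definition translation_invariant (mu : set X -> \bar R) :=
  forall (g : M) (A : set X),
    mxgroup_set G g -> measurable A -> mu (act g @^-1` A) = mu A.

Definition lie_deriv (A : M) (f : X -> R[i]) (x : X) : R[i] :=
  Complex (derive1 (fun t : R => complex.Re (f (act (expm (t *: A)) x))) 0)
          (derive1 (fun t : R => complex.Im (f (act (expm (t *: A)) x))) 0).

Definition Ccontinuous (f : X -> R[i]) :=
  continuous (fun x => complex.Re (f x)) /\
  continuous (fun x => complex.Im (f x)).

Definition lie_derivable (A : M) (f : X -> R[i]) := forall x : X,
  derivable (fun t : R => complex.Re (f (act (expm (t *: A)) x))) 0 1 /\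
  derivable (fun t : R => complex.Im (f (act (expm (t *: A)) x))) 0 1.

(* The fields x |-> d/dt exp(tA).x, A in Lie(G), span the tangent space of X at
   every point, so C^oo amounts to the existence and continuity of all the
   iterated derivatives along them. *)
Definition smooth (f : X -> R[i]) :=
  forall s : seq M, (forall A, A \in s -> lie G A) ->
    let Df := foldr lie_deriv f s in
    Ccontinuous Df /\ forall A, lie G A -> lie_derivable A Df.

Definition compactly_supported (f : X -> R[i]) :=
  compact (closure [set x | f x != 0]).

Definition bounded_fct (f : X -> R[i]) :=
  exists B : R, forall x, Normc.normc (f x) <= B.

(* Sum over the noncommutative monomials b_(w 0) ... b_(w (k-1)), k <= K. *)
Definition sobolev (m : {measure set X -> \bar R}) r (b : r.-tuple M) (K : nat)
    (f : X -> R[i]) : \bar R :=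
  (\sum_(k < K.+1) \sum_(w : k.-tuple 'I_r)
     Lnorm m 2%:E (fun x => (Normc.normc
       (foldr lie_deriv f [seq tnth b i | i <- w] x))%:E))%E.

Section orbits.
Variables (d : nat) (u : 'rV[R]_d -> M).

(* Haar measure on H is the image under u of Lebesgue measure on R^d. *)
Definition ball_mean (r : R) (f : X -> R[i]) (x : X) : R[i] :=
  ((fine (leb d (eball d r)))^-1)%:C%C *
  Cintegral (leb d) (eball d r) (fun t => f (act (u (row_of_tuple t)) x)).

Definition bochner_riesz_weight (alpha : R)
    (t : d.-tuple (measurableTypeR R)) : R :=
  Num.max 0 (1 - enorm (row_of_tuple t) ^+ 2) `^ alpha.

Definition bochner_riesz (alpha r : R) (f : X -> R[i]) (x : X) : R[i] :=
  ((\int[leb d]_(t in eball d 1) bochner_riesz_weight alpha t)^-1)%:C%C *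
  Cintegral (leb d) (eball d 1) (fun t =>
    (bochner_riesz_weight alpha t)%:C%C * f (act (u (r *: row_of_tuple t)) x)).

Definition effective_equidistribution (m : {measure set X -> \bar R})
    r (b : r.-tuple M) (K : nat) (gamma : R) (x0 : X) :=
  exists R0 C : R, [/\ 0 < R0, 0 < C &
    forall f : X -> R[i], smooth f -> compactly_supported f ->
      Cintegral m setT f = 0 ->
      forall rad : R, R0 < rad ->
        ((Normc.normc (ball_mean rad f x0))%:E <=
         C%:E * sobolev m b K f * (rad `^ (- gamma))%:E)%E].

End orbits.
End functions_on_quotient.

Definition is_lattice {R : realType} {n : nat} (G Gam : mxgroup R n) :=
  [/\ mxgroup_set Gam `<=` mxgroup_set G,
      \forall g \near (1 : 'M[R]_n.+1), mxgroup_set Gam g -> g = 1 &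
      exists mu : {measure set (quo G Gam) -> \bar R},
        [/\ (0 < mu setT)%E, (mu setT < +oo)%E & translation_invariant mu]].

(* Main.v *)
(** The hypothesis on [x] concerns compactly supported functions of mean zero,
whereas [f] is only bounded with finite Sobolev norm, so [f] is truncated.  For
discrete [Gam] the series E(g) = sum over c in Gam of N(g c)^(-s), where N(g) is
the sum of the squared entries of g and of g^-1, converges for s large and
defines a positive continuous function on G/Gam which tends to 0 at infinity.
All its Lie derivatives are O(E), because the relative variation of N under
g |-> exp(tA) g is bounded uniformly in g.  The cutoffs chi_j = omega(j E), omega
being a smooth step, are therefore compactly supported, tend to 1, and have Lie
derivatives of every order bounded uniformly in j.  Applying the hypothesis to
(f - c_j) chi_j, with c_j making the mean zero, and letting j tend to infinity
gives the decay of the means of f over the balls B_R, with the same rate.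

The superlevel sets of the Bochner-Riesz weight are balls when alpha >= 0, so a
layer-cake decomposition turns the decay over balls into the decay of the weighted
mean.  When alpha < 0 the weight is cut at 1 - |v|^2 = c, where it is at most
c^alpha, its integral over the remaining shell is O(c^(1 + alpha)), and c is
chosen as a negative power of R. *)

Require Import Defs.
From HB Require Import structures.
From mathcomp Require Import all_boot all_order all_algebra.
From mathcomp Require Import generic_quotient complex.
From mathcomp Require Import all_classical all_reals all_analysis.
From mathcomp Require Import measurable_realfun ring lra zify.

Set Implicit Arguments.
Unset Strict Implicit.
Unset Printing Implicit Defensive.

Import Order.TTheory GRing.Theory Num.Theory.
Import numFieldNormedType.Exports.

Local Open Scope classical_set_scope.
Local Open Scope ring_scope.

(** * First-order expansions uniform in a parameter *)

(** No series is ever differentiated under the sum. Left multiplication by a matrix near 1 acts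
    linearly on the entries of g and of g^-1, so quotients of quadratic monomials in these entries
    by N have first-order expansions whose error is uniform in g. Such an expansion can be summed
    over Gam at once: the total error is a multiple of E, and the first-order term is a series of
    the same kind, so that derivatives can be iterated. The entries of g^-1 in N serve twice: they
    make sublevel sets compact inside the group, and they bound (g h)^-1 in the identity h^-1 k = (g
    h)^-1 (g k) on which the count of lattice points rests. Differentiating omega(j E) brings out j,
    but in the form t omega'(t) times E'/E with t = j E, and t omega'(t) is bounded. The hypothesis
    is silent on radii up to R0. After rescaling these are balls of radius at most R0/R, which are
    estimated trivially by a multiple of 1/R; hence the rate is first lowered to min(gamma, 1). For
    alpha < 0 the superlevel sets of the weight are shells instead of balls, so inside the cut the
    layer-cake bound is applied to c^alpha minus the weight. *)

Section expansions.
Context {R : realFieldType} {U T : Type}.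
Variables (D : set U) (P : set T) (l w : T -> R).
Hypothesis w_ge0 : forall h, P h -> 0 <= w h.
Hypothesis w_le1 : forall h, P h -> w h <= 1.
Hypothesis sqr_l : forall h, P h -> l h ^+ 2 <= w h.

Definition bounded_on (F : U -> R) :=
  exists2 C, 0 <= C & forall g, D g -> `|F g| <= C.

(* Used twice: with [h] a real number, [l h = h] and [w h = h ^+ 2] it yields
   derivatives, with [h] a matrix near 1, [l = 0] and [w h = `|h - 1|] it yields
   continuity. *)
Definition expands (F : U -> T -> R) (F0 F1 : U -> R) :=
  [/\ bounded_on F0, bounded_on F1 &
    exists C c : R, [/\ 0 <= C, 0 < c & forall g h, D g -> P h -> w h <= c ->
      `|F g h - F0 g - l h * F1 g| <= C * w h]].

Lemma bounded_onD F G : bounded_on F -> bounded_on G ->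
  bounded_on (fun g => F g + G g).
Proof.
move=> [C C0 FC] [C' C'0 GC]; exists (C + C'); first exact: addr_ge0.
by move=> g Dg; apply: le_trans (ler_normD _ _) _; rewrite lerD ?FC ?GC.
Qed.

Lemma bounded_onM F G : bounded_on F -> bounded_on G ->
  bounded_on (fun g => F g * G g).
Proof.
move=> [C C0 FC] [C' C'0 GC]; exists (C * C'); first exact: mulr_ge0.
by move=> g Dg; rewrite normrM ler_pM ?FC ?GC.
Qed.

Lemma bounded_on_cst (a : R) : bounded_on (fun=> a).
Proof. by exists `|a|. Qed.

Lemma norm_l_le1 h : P h -> `|l h| <= 1.
Proof.
move=> Ph; rewrite -(@ler_pXn2r _ 2)// ?nnegrE// expr1n real_normK ?num_real//.
exact: le_trans (sqr_l Ph) (w_le1 Ph).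
Qed.

Lemma expands_cst (F0 : U -> R) : bounded_on F0 ->
  expands (fun g _ => F0 g) F0 (fun=> 0).
Proof.
move=> bF; split => //; first exact: bounded_on_cst.
exists 0, 1; split => // g h Dg Ph _.
by rewrite mulr0 subr0 subrr normr0 mul0r.
Qed.

Lemma expandsD F F0 F1 G G0 G1 : expands F F0 F1 -> expands G G0 G1 ->
  expands (fun g h => F g h + G g h) (fun g => F0 g + G0 g)
          (fun g => F1 g + G1 g).
Proof.
move=> [bF0 bF1 [C [c [C0 c0 FC]]]] [bG0 bG1 [C' [c' [C'0 c'0 GC]]]].
split; [exact: bounded_onD|exact: bounded_onD|].
exists (C + C'), (Num.min c c'); split; [exact: addr_ge0|by rewrite lt_min c0|].
move=> g h Dg Ph; rewrite le_min => /andP[wc wc'].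
rewrite mulrDl; apply: le_trans (lerD (FC g h Dg Ph wc) (GC g h Dg Ph wc')).
apply: le_trans (ler_normD _ _); rewrite [leLHS](_ : _ = `|F g h - F0 g - l h * F1 g + (G g h - G0 g - l h * G1 g)|)//.
by congr (`|_|); ring.
Qed.

(** The product creates the term [l h ^+ 2 * (F1 g * G1 g)], which [sqr_l] allows to count as an
    error of size [w h]. *)
Lemma expandsM F F0 F1 G G0 G1 : expands F F0 F1 -> expands G G0 G1 ->
  expands (fun g h => F g h * G g h) (fun g => F0 g * G0 g)
          (fun g => F0 g * G1 g + F1 g * G0 g).
Proof.
move=> [bF0 bF1 [C [c [C0 c0 FC]]]] [bG0 bG1 [C' [c' [C'0 c'0 GC]]]].
split; [exact: bounded_onM|by apply: bounded_onD; apply: bounded_onM|].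
have [A0 A0_ F0A] := bF0; have [A1 A1_ F1A] := bF1.
have [B0 B0_ G0B] := bG0; have [B1 B1_ G1B] := bG1.
(* The three summands are the error of [F] times a bound of [G], the first-order part of [F] times
   the error of [G], and the product of the two linear terms. *)
exists (C * (B0 + B1 + C') + (A0 + A1) * C' + A1 * B1), (Num.min c c').
split; [by rewrite !addr_ge0 ?mulr_ge0 ?addr_ge0|by rewrite lt_min c0|].
move=> g h Dg Ph; rewrite le_min => /andP[wc wc'].
have {FC}FC := FC g h Dg Ph wc; have {GC}GC := GC g h Dg Ph wc'.
have {F0A}F0A := F0A g Dg; have {F1A}F1A := F1A g Dg.
have {G0B}G0B := G0B g Dg; have {G1B}G1B := G1B g Dg.
have l1 := norm_l_le1 Ph; have l2 := sqr_l Ph.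
have w0 := w_ge0 Ph; have w1 := w_le1 Ph.
have GB : `|G g h| <= B0 + B1 + C'.
  have -> : G g h = G0 g + l h * G1 g + (G g h - G0 g - l h * G1 g) by ring.
  apply: le_trans (ler_normD _ _) _; apply: lerD; last first.
    by apply: le_trans GC _; rewrite ler_piMr.
  apply: le_trans (ler_normD _ _) _; apply: lerD => //.
  by rewrite normrM -[B1]mul1r ler_pM.
have -> : F g h * G g h - F0 g * G0 g - l h * (F0 g * G1 g + F1 g * G0 g) =
  (F g h - F0 g - l h * F1 g) * G g h +
  (F0 g + l h * F1 g) * (G g h - G0 g - l h * G1 g) + l h ^+ 2 * (F1 g * G1 g).
  by ring.
rewrite [leRHS]mulrDl [X in _ <= X + _]mulrDl.
apply: le_trans (ler_normD _ _) _; apply: lerD; last first.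
  rewrite normrM [leRHS]mulrC ler_pM// ?normrX ?exprn_ge0//; last first.
    by rewrite normrM ler_pM.
  by rewrite real_normK ?num_real.
apply: le_trans (ler_normD _ _) _; apply: lerD.
  by rewrite normrM mulrAC ler_pM.
rewrite normrM -mulrA ler_pM//; apply: le_trans (ler_normD _ _) _.
by apply: lerD => //; rewrite normrM -[A1]mul1r ler_pM.
Qed.

(** Zero-order term 1 is the only case to be inverted: [F] will be a ratio of values of [sqnorm]. *)
Lemma expandsV F F1 : expands F (fun=> 1) F1 ->
  expands (fun g h => (F g h)^-1) (fun=> 1) (fun g => - F1 g).
Proof.
move=> [b1 bF1 [C [c [C0 c0 FC]]]]; have [B B0 F1B] := bF1; split => //.
  by exists B => // g Dg; rewrite normrN F1B.
(* With [w h <= k ^+ 2] both [l h] and [w h] are at most [k] in absolute value, so [F g h] differs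
   from 1 by at most [k * (B + C)], which is below 1/2; the inverse is then at most 2. *)
pose k := (2 * (B + C) + 1)^-1.
have k0 : 0 < k by rewrite invr_gt0 ltr_wpDl// mulr_ge0// addr_ge0.
have k1 : k <= 1 by rewrite invf_le1 ?ltr_wpDl ?lerDr// mulr_ge0// addr_ge0.
exists (2 * (C + B * (B + C))), (Num.min c (k ^+ 2)); split.
- by rewrite mulr_ge0// addr_ge0// mulr_ge0// addr_ge0.
- by rewrite lt_min c0 exprn_gt0.
move=> g h Dg Ph; rewrite le_min => /andP[wc wk].
have {FC}FC := FC g h Dg Ph wc; have {F1B}F1B := F1B g Dg.
have l1 := norm_l_le1 Ph; have l2 := sqr_l Ph.
have w0 := w_ge0 Ph; have w1 := w_le1 Ph.
have lk : `|l h| <= k.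
  rewrite -(@ler_pXn2r _ 2)// ?nnegrE//; last exact: ltW.
  rewrite real_normK ?num_real//.
  exact: le_trans l2 wk.
have wk' : w h <= k by apply: le_trans wk _; rewrite expr2 ler_piMr// ltW.
have F1le : `|F g h - 1| <= `|l h| * B + C * w h.
  have -> : F g h - 1 = l h * F1 g + (F g h - 1 - l h * F1 g) by ring.
  apply: le_trans (ler_normD _ _) _; apply: lerD => //.
  by rewrite normrM ler_pM.
have Fhalf : `|F g h - 1| <= 2^-1.
  apply: le_trans F1le _; apply: (@le_trans _ _ (k * (B + C))).
    rewrite mulrDr; apply: lerD; first by rewrite ler_pM.
    by rewrite mulrC ler_pM.
  rewrite /k ler_pdivrMl ?ltr_wpDl ?mulr_ge0 ?addr_ge0//.
  by have := addr_ge0 B0 C0; nra.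
have Fge : 2^-1 <= F g h.
  by have := le_trans (ler_norm _) (le_trans (_ : `|1 - F g h| <= _) Fhalf);
    rewrite distrC lexx => /(_ isT); lra.
have F0 : F g h != 0 by rewrite gt_eqF//; lra.
have -> : (F g h)^-1 - 1 - l h * - F1 g =
  (- (F g h - 1 - l h * F1 g) + l h * F1 g * (F g h - 1)) / F g h by field.
rewrite normrM [leLHS]mulrC -[leRHS]mulrA ler_pM//.
  rewrite normfV invf_ple ?posrE ?normr_gt0//.
  exact: le_trans Fge (ler_norm _).
apply: le_trans (ler_normD _ _) _; rewrite normrN mulrDl; apply: lerD => //.
rewrite !normrM; apply: (@le_trans _ _ (B * (`|l h| * (`|l h| * B + C * w h)))).
  by rewrite [leRHS]mulrCA [leRHS]mulrA ler_pM// ?mulr_ge0// ler_pM.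
rewrite -[leRHS]mulrA ler_wpM2l// mulrDr [leRHS]mulrDl; apply: lerD.
  by rewrite mulrA -expr2 real_normK ?num_real// mulrC ler_wpM2l.
by rewrite -[leRHS]mul1r ler_pM// mulr_ge0.
Qed.

Lemma eq_expands F F0 F1 G G0 G1 : expands F F0 F1 ->
  (forall g h, D g -> P h -> F g h = G g h) ->
  (forall g, D g -> F0 g = G0 g) -> (forall g, D g -> F1 g = G1 g) ->
  expands G G0 G1.
Proof.
move=> [[A A0 FA] [B B0 FB] [C [c [C0 c0 FC]]]] FG FG0 FG1; split.
- by exists A => // g Dg; rewrite -FG0// FA.
- by exists B => // g Dg; rewrite -FG1// FB.
exists C, c; split => // g h Dg Ph wc.
by rewrite -FG// -FG0// -FG1// FC.
Qed.

Lemma expands_sum (I : Type) (r : seq I) (F : I -> U -> T -> R)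
  (F0 F1 : I -> U -> R) : (forall i, expands (F i) (F0 i) (F1 i)) ->
  expands (fun g h => \sum_(i <- r) F i g h) (fun g => \sum_(i <- r) F0 i g)
          (fun g => \sum_(i <- r) F1 i g).
Proof.
move=> H; elim: r => [|i r IH].
  apply: eq_expands (expands_cst (bounded_on_cst 0)) _ _ _ => * /=;
    by rewrite big_nil.
by apply: eq_expands (expandsD (H i) IH) _ _ _ => * /=; rewrite big_cons.
Qed.

Lemma expandsX F F1 k : expands F (fun=> 1) F1 ->
  expands (fun g h => F g h ^+ k) (fun=> 1) (fun g => k%:R * F1 g).
Proof.
move=> HF; elim: k => [|k IH].
  apply: eq_expands (expands_cst (bounded_on_cst 1)) _ _ _ => //.
  by move=> g _; rewrite mul0r.
apply: eq_expands (expandsM HF IH) _ _ _ => //= g *.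
- by rewrite exprS.
- by rewrite mulr1.
- by rewrite -natr1; ring.
Qed.

End expansions.

(** * Coordinates of a matrix and of its inverse, and the functions of degree zero in them *)

Section coordinates.
Context {R : realType} {n : nat}.
Local Notation M := 'M[R]_n.+1.

(* The entries of [g] are the coordinates [(true, (i, j))], those of [g^-1] the
   coordinates [(false, (i, j))]. *)
Definition coord_index : finType := (bool * ('I_n.+1 * 'I_n.+1))%type.

Definition coord (g : M) (a : coord_index) : R :=
  if a.1 then g a.2.1 a.2.2 else g^-1 a.2.1 a.2.2.

(** This is N of the overview. *)
Definition sqnorm (g : M) : R := \sum_a coord g a ^+ 2.

(** Quadratic monomials, because the relative variation of [sqnorm] under left multiplication is a
    combination of these quotients. *)
Definition zcoord (a b : coord_index) (g : M) : R :=
  coord g a * coord g b / sqnorm g.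

(* The algebra generated by the bounded functions [zcoord a b] is stable under the
   derivations [g |-> expm (t *: A) * g], which act linearly on the coordinates. *)
Inductive tame : (M -> R) -> Prop :=
| tame_z a b : tame (zcoord a b)
| tame_cst c : tame (fun=> c)
| tameD P Q : tame P -> tame Q -> tame (fun g => P g + Q g)
| tameM P Q : tame P -> tame Q -> tame (fun g => P g * Q g).

Lemma tame_sum (I : Type) (r : seq I) (P : I -> M -> R) :
  (forall i, tame (P i)) -> tame (fun g => \sum_(i <- r) P i g).
Proof.
move=> H; elim: r => [|i r IH].
  by under eq_fun do rewrite big_nil; exact: tame_cst.
by under eq_fun do rewrite big_cons; exact: tameD.
Qed.

Lemma sqnorm_ge0 g : 0 <= sqnorm g.
Proof. by apply: sumr_ge0 => a _; exact: sqr_ge0. Qed.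

Lemma coord_le_sqnorm g a : coord g a ^+ 2 <= sqnorm g.
Proof.
rewrite /sqnorm (bigD1 a)//= lerDl; apply: sumr_ge0 => b _; exact: sqr_ge0.
Qed.

(** The corner entry of g g^-1 = 1 is a sum of products x y, each at most x^2 + y^2, of coordinates
    that are pairwise distinct. *)
Lemma sqnorm_ge1 g : g \is a GRing.unit -> 1 <= sqnorm g.
Proof.
move=> gu.
suff : 1 = \sum_(k : 'I_n.+1) coord g (true, (ord0, k)) * coord g (false, (k, ord0)).
  move=> ->.
  apply: (@le_trans _ _ (\sum_(k : 'I_n.+1) (coord g (true, (ord0, k)) ^+ 2 + coord g (false, (k, ord0)) ^+ 2))).
    apply: ler_sum => k _; set x := coord _ _; set y := coord _ _.
    by have := sqr_ge0 (x - y); nra.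
  rewrite /sqnorm (eq_bigr (fun a => coord g (a.1, (a.2.1, a.2.2)) ^+ 2)); last by move=> [? []].
  rewrite -(pair_bigA _ (fun b c => coord g (b, (c.1, c.2)) ^+ 2))/=.
  rewrite big_bool/= big_split/=; apply: lerD.
  - rewrite -(pair_bigA _ (fun i j => coord g (true, (i, j)) ^+ 2))/=.
    rewrite [leRHS](bigD1 ord0)//= lerDl; apply: sumr_ge0 => i _.
    by apply: sumr_ge0 => j _; exact: sqr_ge0.
  - rewrite -(pair_bigA _ (fun i j => coord g (false, (i, j)) ^+ 2))/=.
    rewrite [leRHS]exchange_big/= [leRHS](bigD1 ord0)//= lerDl; apply: sumr_ge0 => i _.
    by apply: sumr_ge0 => j _; exact: sqr_ge0.
by have := congr1 (fun A : M => A ord0 ord0) (mulrV gu); rewrite !mxE eqxx.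
Qed.

Lemma sqnorm_gt0 g : g \is a GRing.unit -> 0 < sqnorm g.
Proof. by move/sqnorm_ge1; exact: lt_le_trans. Qed.

Lemma norm_zcoord_le1 a b g : g \is a GRing.unit -> `|zcoord a b g| <= 1.
Proof.
move=> gu; have N0 := sqnorm_gt0 gu.
rewrite /zcoord normrM normfV (gtr0_norm N0) ler_pdivrMr// mul1r.
have := coord_le_sqnorm g a; have := coord_le_sqnorm g b.
rewrite normrM -[coord g a ^+ 2]real_normK ?num_real//.
rewrite -[coord g b ^+ 2]real_normK ?num_real//.
by have := sqr_ge0 (`|coord g a| - `|coord g b|); nra.
Qed.

Definition invertible : set M := [set g | g \is a GRing.unit].

Lemma tame_bounded P : tame P -> bounded_on invertible P.
Proof.
elim=> [a b|c|Q Q' _ IH _ IH'|Q Q' _ IH _ IH'].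
- by exists 1 => // g; exact: norm_zcoord_le1.
- exact: bounded_on_cst.
- exact: bounded_onD.
- exact: bounded_onM.
Qed.

(** Left multiplication by [e] combines the entries of one column of [g]; on the inverse it is right
    multiplication by [e^-1], which combines the entries of one row. *)
Definition coord_shift (a : coord_index) (k : 'I_n.+1) : coord_index :=
  if a.1 then (true, (k, a.2.2)) else (false, (a.2.1, k)).

Definition coord_coef (e e' : M) (a : coord_index) (k : 'I_n.+1) : R :=
  if a.1 then e a.2.1 k else e' k a.2.2.

Lemma coordM e g a : e \is a GRing.unit -> g \is a GRing.unit ->
  coord (e * g) a = \sum_k coord_coef e e^-1 a k * coord g (coord_shift a k).
Proof.
move=> eu gu; case: a => [[] [i j]]; rewrite /coord /coord_coef /coord_shift/=.
  by rewrite mxE.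
by rewrite invrM// mxE; apply: eq_bigr => k _; rewrite mulrC.
Qed.

Lemma coord1 g a : g \is a GRing.unit ->
  coord g a = \sum_k coord_coef 1 1 a k * coord g (coord_shift a k).
Proof. by move=> gu; rewrite -{1}(mul1r g) coordM ?unitr1// invr1. Qed.

Section perturbation.
Context {T : Type} (P : set T) (l w : T -> R) (e : T -> M) (A : M).
Hypothesis w_ge0 : forall h, P h -> 0 <= w h.
Hypothesis w_le1 : forall h, P h -> w h <= 1.
Hypothesis sqr_l : forall h, P h -> l h ^+ 2 <= w h.
Hypothesis e_unit : forall h, P h -> e h \is a GRing.unit.
Local Notation expands := (@expands R M T invertible P l w).
Hypothesis e_expands : forall i j,
  expands (fun _ h => e h i j) (fun=> (1 : M) i j) (fun=> A i j).
Hypothesis eV_expands : forall i j,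
  expands (fun _ h => (e h)^-1 i j) (fun=> (1 : M) i j) (fun=> - A i j).

Let coef_expands a k :
  expands (fun _ h => coord_coef (e h) (e h)^-1 a k) (fun=> coord_coef 1 1 a k)
          (fun=> coord_coef A (- A) a k).
Proof.
case: a => [[] [i j]]; rewrite /coord_coef/=; first exact: e_expands.
by under [X in expands _ _ X]eq_fun do rewrite mxE; exact: eV_expands.
Qed.

(** After expanding both coordinates by [coordM], each summand is a product of two coefficients
    independent of [g] and one bounded [zcoord]; this is where uniformity in [g] comes from. *)
Let pair_expands a b : exists2 Q, tame Q &
  expands (fun g h => coord (e h * g) a * coord (e h * g) b / sqnorm g)
          (zcoord a b) Q.
Proof.
have H k k' := expandsM w_ge0 w_le1 sqr_l (expandsM w_ge0 w_le1 sqr_l (coef_expands a k) (coef_expands b k'))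
  (expands_cst P l w (tame_bounded (tame_z (coord_shift a k) (coord_shift b k')))).
have H2 := expands_sum (index_enum _) (fun k => expands_sum (index_enum _) (H k)).
eexists; last first.
  apply: (eq_expands H2) => [g h gu Ph|g gu|g gu] /=; last by [].
    rewrite !coordM ?e_unit// mulr_suml mulr_suml.
    apply: eq_bigr => k _; rewrite mulr_sumr mulr_suml; apply: eq_bigr => k' _.
    by rewrite /zcoord; ring.
  rewrite /zcoord (coord1 a gu) (coord1 b gu) mulr_suml mulr_suml.
  apply: eq_bigr => k _; rewrite mulr_sumr mulr_suml; apply: eq_bigr => k' _.
  by rewrite /zcoord; ring.
apply: tame_sum => k; apply: tame_sum => k'.
by repeat first [exact: tame_cst|exact: tame_z|apply: tameM|apply: tameD].
Qed.

(** The functions [zcoord a a] add up to 1, so the sum of the expansions of [pair_expands] over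
    [a = b] starts with 1 and can be inverted. *)
Let ratio_expands : exists2 Q, tame Q &
  expands (fun g h => sqnorm g / sqnorm (e h * g)) (fun=> 1) Q.
Proof.
pose Q a := sval (cid2 (pair_expands a a)).
have tQ a : tame (Q a) by rewrite /Q; case: cid2.
have H a : expands (fun g h => coord (e h * g) a * coord (e h * g) a / sqnorm g)
  (zcoord a a) (Q a) by rewrite /Q; case: cid2.
have H2 := expands_sum (index_enum _) H.
have H3 : expands (fun g h => sqnorm (e h * g) / sqnorm g) (fun=> 1)
    (fun g => \sum_a Q a g).
  apply: (eq_expands H2) => //.
    by move=> g h gu Ph; rewrite /sqnorm mulr_suml; apply: eq_bigr => a _.
  move=> g gu; rewrite /zcoord -mulr_suml -/(sqnorm g) divff//.
  by rewrite gt_eqF// sqnorm_gt0.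
exists (fun g => (-1) * \sum_a Q a g).
  by apply: tameM; [exact: tame_cst|exact: tame_sum].
apply: (eq_expands (expandsV w_ge0 w_le1 sqr_l H3)) => //.
- by move=> g h gu Ph; rewrite invf_div.
- by move=> g gu; rewrite mulN1r.
Qed.

Let tame_expands Q : tame Q -> exists2 Q', tame Q' &
  expands (fun g h => Q (e h * g)) Q Q'.
Proof.
elim=> [a b|c|Q1 Q2 tQ1 [Q1' tQ1' H1] tQ2 [Q2' tQ2' H2]|
        Q1 Q2 tQ1 [Q1' tQ1' H1] tQ2 [Q2' tQ2' H2]].
(* A generator at [e h * g] is the quotient by the old norm, treated by [pair_expands], times the
   ratio of the old norm to the new one. *)
- have [Q1 tQ1 H1] := pair_expands a b; have [Q2 tQ2 H2] := ratio_expands.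
  exists (fun g => zcoord a b g * Q2 g + Q1 g * 1).
    apply: tameD; apply: tameM => //; [exact: tame_z|exact: tame_cst].
  apply: (eq_expands (expandsM w_ge0 w_le1 sqr_l H1 H2)) => //.
  + move=> g h gu Ph; rewrite /zcoord; field.
    by rewrite !gt_eqF ?sqnorm_gt0// unitrMr// e_unit.
  + by move=> g gu; rewrite mulr1.
- by exists (fun=> 0); [exact: tame_cst|apply: expands_cst; exact: bounded_on_cst].
- by exists (fun g => Q1' g + Q2' g); [exact: tameD|exact: expandsD].
- exists (fun g => Q1 g * Q2' g + Q1' g * Q2 g); last exact: expandsM.
  by apply: tameD; apply: tameM.
Qed.

(** The error is relative to the weight of the unperturbed [g]. With [g * c] in place of [g] it is
    therefore summable over the group, with constants independent of [c]. *)
Lemma tame_weighted_expands s Q : tame Q -> exists2 Q', tame Q' &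
  exists C c : R, [/\ 0 <= C, 0 < c & forall g h, g \is a GRing.unit -> P h ->
    w h <= c -> `|Q (e h * g) / sqnorm (e h * g) ^+ s - Q g / sqnorm g ^+ s -
      l h * (Q' g / sqnorm g ^+ s)| <= C * w h / sqnorm g ^+ s].
Proof.
move=> tQ; have [Q1 tQ1 H1] := tame_expands tQ.
have [Q2 tQ2 H2] := ratio_expands.
have [_ _ [C [c [C0 c0 H]]]] := expandsM w_ge0 w_le1 sqr_l H1
  (expandsX w_ge0 w_le1 sqr_l s H2).
exists (fun g => Q g * (s%:R * Q2 g) + Q1 g * 1).
  by repeat first [assumption|exact: tame_cst|apply: tameM|apply: tameD].
exists C, c; split => // g h gu Ph wc.
have N0 := sqnorm_gt0 gu; have Ns : 0 < sqnorm g ^+ s by exact: exprn_gt0.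
have N1 : sqnorm (e h * g) != 0.
  by rewrite gt_eqF// sqnorm_gt0// unitrMr// e_unit.
have {H} := H g h gu Ph wc; rewrite mulr1 => H.
rewrite ler_pdivlMr// -[X in _ * X](gtr0_norm Ns) -normrM.
apply: le_trans H; rewrite [leLHS](_ : _ = `|Q (e h * g) * (sqnorm g / sqnorm (e h * g)) ^+ s
   - Q g - l h * (Q g * (s%:R * Q2 g) + Q1 g * 1)|)//.
congr (`|_|); rewrite expr_div_n; field.
by rewrite !expf_neq0// gt_eqF.
Qed.

End perturbation.
End coordinates.

(** * Inverses and exponentials near the identity matrix *)

Section matrix_norm.
Context {R : realType} {n : nat}.
Local Notation M := 'M[R]_n.+1.
Implicit Types A B X e : M.

Lemma ler_mx_entry A i j : `|A i j| <= `|A|.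
Proof.
rewrite [leRHS]/Num.Def.normr/= mx_normrE; apply/bigmax_geP; right => /=.
by exists (i, j).
Qed.

Lemma ler_mx_norm A c : 0 <= c -> (forall i j, `|A i j| <= c) -> `|A| <= c.
Proof.
by move=> c0 H; rewrite /Num.Def.normr/= mx_normrE; apply/bigmax_leP; split.
Qed.

(** The norm is the largest absolute value of an entry, which is submultiplicative only up to the
    size of the matrices. *)
Lemma mx_normM A B : `|A * B| <= n.+1%:R * `|A| * `|B|.
Proof.
apply: ler_mx_norm; first by rewrite !mulr_ge0.
move=> i j; rewrite mxE; apply: le_trans (ler_norm_sum _ _ _) _.
apply: (@le_trans _ _ (\sum_(k < n.+1) `|A| * `|B|)).
  by apply: ler_sum => k _; rewrite normrM ler_pM ?ler_mx_entry.
by rewrite sumr_const card_ord -[leLHS]mulr_natl mulrA.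
Qed.

Lemma mx_norm1 : `|1 : M| <= 1.
Proof.
apply: ler_mx_norm => // i j; rewrite mxE.
by case: (i == j); rewrite /= ?mulr1n ?mulr0n ?normr1 ?normr0.
Qed.

Lemma mx_normX A k : `|A ^+ k| <= (n.+1%:R * `|A|) ^+ k.
Proof.
elim: k => [|k IH]; first by rewrite !expr0 mx_norm1.
rewrite !exprS; apply: le_trans (mx_normM _ _) _.
by rewrite ler_wpM2l// mulr_ge0.
Qed.

(** The identity e^-1 = 1 - (e - 1) e^-1 is used twice: to absorb half of the norm of e^-1, which
    gives the bound 2, and to write the second-order error as (e - 1)^2 e^-1. *)
Lemma invr_perturbation e : e \is a GRing.unit ->
  n.+1%:R * `|e - 1| <= 2^-1 ->
  `|e^-1| <= 2 /\ `|e^-1 - 1 + (e - 1)| <= 2 * (n.+1%:R * `|e - 1|) ^+ 2.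
Proof.
move=> eu small.
have E : e^-1 = 1 - (e - 1) * e^-1 by rewrite mulrBl divrr// mul1r opprB addrC subrK.
have n0 : 0 <= n.+1%:R * `|e - 1| by rewrite mulr_ge0.
have b2 : `|e^-1| <= 2.
  have : `|e^-1| <= 1 + 2^-1 * `|e^-1|.
    rewrite {1}E; apply: le_trans (ler_normB _ _) _; rewrite lerD ?mx_norm1//.
    by apply: le_trans (mx_normM _ _) _; rewrite ler_wpM2r.
  lra.
split => //.
have -> : e^-1 - 1 + (e - 1) = (e - 1) * ((e - 1) * e^-1).
  have E2 : (e - 1) * e^-1 = 1 - e^-1 by rewrite mulrBl divrr// mul1r.
  by rewrite E2 mulrBr mulr1 E2 opprB addrC.
apply: le_trans (mx_normM _ _) _; rewrite expr2 mulrCA ler_wpM2l//.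
apply: le_trans (mx_normM _ _) _; rewrite mulrC ler_wpM2r//.
Qed.

Section expansion.
Context {T : Type} (P : set T) (l w : T -> R) (e : T -> M) (A : M) (K : R).
Hypothesis w_ge0 : forall h, P h -> 0 <= w h.
Hypothesis w_le1 : forall h, P h -> w h <= 1.
Hypothesis sqr_l : forall h, P h -> l h ^+ 2 <= w h.
Hypothesis e_unit : forall h, P h -> e h \is a GRing.unit.
Hypothesis e_near : forall h, P h -> `|e h - 1 - l h *: A| <= K * w h.
Hypothesis K_ge0 : 0 <= K.
Local Notation expands := (@expands R M T invertible P l w).

Lemma entry_expands i j :
  expands (fun _ h => e h i j) (fun=> (1 : M) i j) (fun=> A i j).
Proof.
split; [exact: bounded_on_cst|exact: bounded_on_cst|].
exists K, 1; split => // g h _ Ph _.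
by have := le_trans (ler_mx_entry _ i j) (e_near Ph); rewrite !mxE.
Qed.

Lemma inv_entry_expands i j :
  expands (fun _ h => (e h)^-1 i j) (fun=> (1 : M) i j) (fun=> - A i j).
Proof.
split; [exact: bounded_on_cst|exact: bounded_on_cst|].
(* The threshold [k ^+ 2] on [w h] brings [e h] close enough to 1 for [invr_perturbation]. *)
pose k := (2 * n.+1%:R * (`|A| + K) + 1)^-1.
have AK : 0 <= `|A| + K by rewrite addr_ge0.
have k0 : 0 < k by rewrite invr_gt0 ltr_wpDl// !mulr_ge0.
have k1 : k <= 1 by rewrite invf_le1 ?ltr_wpDl ?lerDr// !mulr_ge0.
exists (2 * (n.+1%:R * (`|A| + K)) ^+ 2 + K), (k ^+ 2); split.
- by rewrite addr_ge0// mulr_ge0// exprn_ge0// mulr_ge0.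
- by rewrite exprn_gt0.
move=> g h _ Ph wk.
have l2 := sqr_l Ph; have w0 := w_ge0 Ph; have w1 := w_le1 Ph.
have lk : `|l h| <= k.
  rewrite -(@ler_pXn2r _ 2)// ?nnegrE//; last exact: ltW.
  by rewrite real_normK ?num_real//; exact: le_trans l2 wk.
(* The square root of [w h] bounds both [l h] and, as [w h <= 1], [w h] itself; so [e h - 1] is of
   order [m], and its square is of order [w h]. *)
have [m m0 [lm wm mw mk]] : exists2 m, 0 <= m & [/\ `|l h| <= m, w h <= m, m ^+ 2 <= w h & m <= k].
  exists (Num.sqrt (w h)); first exact: sqrtr_ge0.
  rewrite sqr_sqrtr//; split => //.
  - by rewrite -sqrtr_sqr ler_wsqrtr.
  - rewrite -{1}(sqr_sqrtr w0) expr2 ler_piMl ?sqrtr_ge0//.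
    by rewrite -sqrtr1 ler_wsqrtr.
  - by rewrite -(ger0_norm (ltW k0)) -sqrtr_sqr ler_wsqrtr.
have Xm : `|e h - 1| <= (`|A| + K) * m.
  have -> : e h - 1 = l h *: A + (e h - 1 - l h *: A) by rewrite [RHS]addrC subrK.
  apply: le_trans (ler_normD _ _) _; rewrite mulrDl; apply: lerD.
    by rewrite normrZ mulrC ler_wpM2l.
  by apply: le_trans (e_near Ph) _; rewrite ler_wpM2l.
have small : n.+1%:R * `|e h - 1| <= 2^-1.
  apply: (@le_trans _ _ (n.+1%:R * ((`|A| + K) * k))).
    by rewrite ler_wpM2l//; apply: le_trans Xm _; rewrite ler_wpM2l.
  rewrite mulrA /k ler_pdivrMr ?ltr_wpDl ?mulr_ge0//.
  by rewrite [leRHS]mulrDr mulr1 !mulrA mulVf// mul1r lerDl.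
have [_ H] := invr_perturbation (e_unit Ph) small.
have := le_trans (ler_mx_entry _ i j) (_ : `|(e h)^-1 - 1 + l h *: A| <= (2 * (n.+1%:R * (`|A| + K)) ^+ 2 + K) * w h).
rewrite !mxE mulrN opprK; apply.
have -> : (e h)^-1 - 1 + l h *: A =
   ((e h)^-1 - 1 + (e h - 1)) - (e h - 1 - l h *: A).
  by rewrite opprB addrCA addrK addrC.
apply: le_trans (ler_normB _ _) _; rewrite mulrDl; apply: lerD; last exact: e_near.
apply: le_trans H _; rewrite -mulrA ler_wpM2l// exprMn [in leRHS]exprMn -[leRHS]mulrA.
rewrite ler_wpM2l ?exprn_ge0//; apply: (@le_trans _ _ (((`|A| + K) * m) ^+ 2)).
  by rewrite lerXn2r ?nnegrE ?mulr_ge0.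
by rewrite exprMn ler_wpM2l// exprn_ge0.
Qed.

End expansion.

(** From degree 2 on, a power of [t] is at most [t ^+ 2] in absolute value, and the rest of the term
    is dominated by the scalar exponential series at [n.+1%:R] times the norm of [A]. *)
Lemma expm_perturbation A : exists2 K, 0 <= K &
  forall t : R, `|t| <= 1 -> `|expm (t *: A) - 1 - t *: A| <= K * t ^+ 2.
Proof.
pose a := n.+1%:R * `|A|.
have a0 : 0 <= a by rewrite mulr_ge0.
have expa N : series (exp_coeff a) N <= expR a.
  apply: (@nondecreasing_cvgn_le _ (series (exp_coeff a))).
  - by apply/nondecreasing_seqP => k; rewrite seriesSr lerDl exp_coeff_ge0.
  - exact: is_cvg_series_exp_coeff.
exists (expR a); first exact: expR_ge0.
move=> t t1.
pose f k : M := (k`!%:R)^-1 *: (t *: A) ^+ k.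
have fE k : `|f k| <= `|t| ^+ k * exp_coeff a k.
  rewrite /f normrZ normfV (@ger0_norm _ (k`!%:R))// mulrC.
  rewrite /exp_coeff/= mulrA ler_wpM2r ?invr_ge0// -exprMn.
  apply: le_trans (mx_normX _ _) _; rewrite lerXn2r ?nnegrE ?mulr_ge0//.
  by rewrite normrZ mulrCA.
(* [expm] is a [limn], which carries information only once the series converges. *)
have cf : cvgn (series f).
  have : cvgn [normed series f].
    apply: (series_le_cvg _ _ _ (is_cvg_series_exp_coeff a)) => k //=.
      exact: exp_coeff_ge0.
    apply: le_trans (fE k) _; rewrite ler_piMl ?exp_coeff_ge0//.
    by rewrite exprn_ile1.
  move=> /cauchy_cvgP/cauchy_seriesP u_ncvg.
  apply/cauchy_cvgP/cauchy_seriesP => e0 /u_ncvg.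
  apply: filterS => k /=; rewrite ger0_norm ?sumr_ge0//.
  by apply: le_lt_trans; exact: ler_norm_sum.
have S2 : forall N, (2 <= N)%N -> `|series f N - 1 - t *: A| <= expR a * t ^+ 2.
  move=> N N2.
  have -> : series f N - 1 - t *: A = \sum_(2 <= k < N) f k.
    rewrite /series/= (@big_cat_nat _ _ _ 2)//= big_nat_recr//= big_nat1.
    rewrite /f expr0 expr1 !factE /= !invr1 !scale1r.
    by apply/eqP; rewrite !subr_eq addrC [1 + _]addrC addrA.
  apply: le_trans (ler_norm_sum _ _ _) _.
  rewrite mulrC; apply: le_trans (ler_wpM2l (sqr_ge0 t) (expa N)).
  rewrite /series/= [in leRHS](@big_cat_nat _ _ _ 2)//= mulrDr.
  apply: ler_wpDl; first by rewrite mulr_ge0 ?sqr_ge0// sumr_ge0// => k _; exact: exp_coeff_ge0.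
  rewrite mulr_sumr big_nat [leRHS]big_nat; apply: ler_sum => k /andP[k2 _].
  apply: le_trans (fE k) _; rewrite ler_wpM2r ?exp_coeff_ge0//.
  rewrite -[t ^+ 2]real_normK ?num_real//.
  by apply: ler_wiXn2l.
have cN : (fun N => `|series f N - 1 - t *: A|) @ \oo --> `|expm (t *: A) - 1 - t *: A|.
  apply: cvg_norm; apply: cvgB; last exact: cvg_cst.
  by apply: cvgB; [exact: cf|exact: cvg_cst].
rewrite -(cvg_lim _ cN)//; apply: limr_le; first by apply/cvg_ex; eexists; exact: cN.
by exists 2.
Qed.

End matrix_norm.

(** * Counting points of a discrete group *)

Section geometric_cover.
Context d (T : measurableType d) (R : realType).
Variable mu : {measure set T -> \bar R}.

Lemma sum_geometric_le (r : R) N : 0 <= r -> r < 1 ->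
  \sum_(k < N) r ^+ k <= (1 - r)^-1.
Proof.
move=> r0 r1; have r10 : 0 < 1 - r by rewrite subr_gt0.
rewrite -(ler_pM2l r10) divff ?gt_eqF// -opprB mulNr -subrX1 opprB.
by rewrite lerBlDr lerDl exprn_ge0.
Qed.

(** The sum of the [a k] times the indicators of the [A k] dominates [f]; the sets may overlap. It
    serves dyadic decompositions of the lattice series (counting measure) and of the weight near the
    unit sphere. *)
Lemma integral_le_geometric (D : set T) (f : T -> R) (A : nat -> set T)
    (a : nat -> R) (c r : R) :
  measurable D -> measurable_fun D f -> (forall x, D x -> 0 <= f x) ->
  (forall k, measurable (A k)) -> (forall k, 0 <= a k) ->
  (forall x, D x -> exists2 k, A k x & f x <= a k) ->
  (forall k, ((a k)%:E * mu (A k) <= (c * r ^+ k)%:E)%E) ->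
  0 <= c -> 0 <= r -> r < 1 ->
  (\int[mu]_(x in D) (f x)%:E <= (c / (1 - r))%:E)%E.
Proof.
move=> mD mf f0 mA a0 cov H c0 r0 r1.
have t0 k x : (0 <= (a k * \1_(A k) x)%:E)%E.
  by rewrite lee_fin mulr_ge0// indicE.
pose u k x : \bar R := (a k * \1_(A k) x)%:E.
have mt k : measurable_fun D (u k).
  apply/measurable_EFinP; apply: measurable_funM; first exact: measurable_cst.
  exact: measurable_indic.
apply: (@le_trans _ _ (\int[mu]_(x in D) (\sum_(0 <= k <oo) u k x))%E).
  apply: ge0_le_integral => //.
  - by apply/measurable_EFinP.
  - by apply: ge0_emeasurable_sum => k *; [exact: t0|exact: mt].
  move=> x Dx; have [k Akx fx] := cov x Dx.
  apply: (@le_trans _ _ (u k x)).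
    by rewrite /u indicE mem_set// mulr1.
  apply: le_trans (nneseries_lim_ge k.+1 (fun i _ _ => t0 i x)).
  by rewrite big_nat_recr//= leeDr// sume_ge0.
rewrite integral_nneseries//; last by move=> k x _; exact: t0.
apply: lime_le; first by apply: is_cvg_nneseries => k _ _; apply: integral_ge0 => x _; exact: t0.
apply: nearW => N /=; rewrite big_mkord.
apply: (@le_trans _ _ (\sum_(k < N) (c * r ^+ k)%:E)%E).
  apply: lee_sum => k _; apply: le_trans (H k).
  rewrite /u (@integralZl_indic _ _ _ mu _ mD (fun=> A k) (a k))//; last by move=> /lt_geF; rewrite a0.
  rewrite integral_indic//; apply: lee_wpmul2l; first by rewrite lee_fin.
  by apply: le_measure; rewrite ?inE//; exact: measurableI.
rewrite sumEFin lee_fin -mulr_sumr ler_wpM2l//; exact: sum_geometric_le.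
Qed.

End geometric_cover.

Section counting_bound.
Context d (T : measurableType d) (R : realType).

Lemma counting_le (A : set T) N (f : T -> nat) :
  (forall x, A x -> (f x < N)%N) -> {in A &, injective f} ->
  (counting A <= N%:R%:E :> \bar R)%E.
Proof.
move=> fN finj; have AN : (A #<= `I_N)%card.
  have /card_eqPle[_ H] := inj_card_eq finj.
  apply: card_le_trans H _; apply: subset_card_le => _ [x Ax <-] /=; exact: fN.
rewrite /counting asboolT; last by apply: card_le_finite AN _; exact: finite_II.
by rewrite lee_fin ler_nat; exact: geq_card_fset_set.
Qed.

End counting_bound.

Section discrete_subgroup.
Context {R : realType} {n : nat} (Gam : mxgroup R n).
Local Notation M := 'M[R]_n.+1.
Hypothesis Gam_discrete : \forall g \near (1 : M), mxgroup_set Gam g -> g = 1.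

(* All sets are measurable, so that sums over the countable group are integrals
   against the counting measure, without any side condition. *)
Definition all_measurable : Type := g_sigma_algebraType [set: set M].
HB.instance Definition _ := Measurable.copy all_measurable
  (g_sigma_algebraType [set: set M]).

Lemma measurable_all (A : set all_measurable) : measurable A.
Proof. exact: sub_gen_smallest. Qed.

Lemma measurable_fun_all d (T : measurableType d) (D : set all_measurable)
  (f : all_measurable -> T) : measurable_fun D f.
Proof. by move=> _ B _; exact: measurable_all. Qed.

Definition gcount : {measure set all_measurable -> \bar R} :=
  [the measure _ _ of @counting all_measurable R].

(** Each of the [n.+1 * n.+1] entries ranges over an interval of length 2 T, cut into pieces of
    length of order 1/T, hence into about T^2 pieces. *)
Definition growth : nat := (2 * (n.+1 * n.+1))%N.

Lemma norm_coord_le (g : M) a T : 1 <= T -> sqnorm g <= T -> `|coord g a| <= T.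
Proof.
move=> T1 gT; rewrite -(@ler_pXn2r _ 2)// ?nnegrE//; last lra.
rewrite real_normK ?num_real//; apply: le_trans (coord_le_sqnorm g a) _.
by apply: le_trans gT _; rewrite expr2; nra.
Qed.

(** Pigeonhole principle: if g h and g k lie in the same cell of a fine grid, then h^-1 k = (g h)^-1
    (g k) is close to 1, hence equal to 1 by discreteness. As (g h)^-1 may have entries of size T,
    the mesh has to be of order 1/T. *)
Lemma count_le_growth : exists2 C : R, 0 <= C & forall (g : M) T,
  g \is a GRing.unit -> 1 <= T ->
  (gcount [set c : all_measurable | mxgroup_set Gam c /\ (sqnorm (g * (c : M)) <= T)%R]
    <= (C * T ^+ growth)%:E)%E.
Proof.
have [dl /= dl0 Hdl] : exists2 e : R, 0 < e &
    forall h : M, `|h - 1| < e -> mxgroup_set Gam h -> h = 1.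
  have /nbhs_normP[e /= e0 He] := Gam_discrete; exists e => // h h1.
  by apply: He; rewrite /= distrC.
(* Chosen so that [c * T ^+ 2] equals 2 T / [eta], the length of [-T, T] measured in cells. *)
pose c := 4 * n.+1%:R / dl.
have c0 : 0 <= c by rewrite divr_ge0// ?mulr_ge0// ltW.
exists ((c + 1) ^+ (n.+1 * n.+1)); first by rewrite exprn_ge0// addr_ge0.
move=> g T gu T1; have T0 : 0 < T by apply: lt_le_trans T1.
pose L := Num.truncn (c * T ^+ 2).
have LT : (L.+1)%:R <= (c + 1) * T ^+ 2.
  rewrite -natr1 mulrDl mul1r; apply: lerD.
    by rewrite truncn_le// mulr_ge0// sqr_ge0.
  by rewrite expr2; nra.
(* Then [n.+1%:R * T * eta] is [dl / 2], which places h^-1 k inside the neighbourhood of 1 that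
   contains no other group element. *)
pose eta := dl / (2 * n.+1%:R * T).
have eta0 : 0 < eta by rewrite divr_gt0// !mulr_gt0.
pose idx (h : all_measurable) (i : 'I_n.+1 * 'I_n.+1) :=
  Num.truncn (((g * (h : M)) i.1 i.2 + T) / eta).
have Hent h i j : sqnorm (g * h) <= T -> `|(g * h) i j| <= T.
  exact: (@norm_coord_le (g * h) (true, (i, j))).
have idx_ub h i : sqnorm (g * (h : M)) <= T -> (idx h i <= L)%N.
  move=> hT; apply: le_truncn; have := Hent h i.1 i.2 hT.
  rewrite ler_norml => /andP[_ hi]; rewrite ler_pdivrMr//.
  apply: (@le_trans _ _ (2 * T)); first by lra.
  rewrite /c /eta le_eqVlt; apply/orP; left; apply/eqP; field.
  by rewrite !gt_eqF.
pose f (h : all_measurable) : nat :=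
  enum_rank [ffun i => inord (idx h i) : 'I_L.+1].
pose N := #|{ffun 'I_n.+1 * 'I_n.+1 -> 'I_L.+1}|.
apply: (@le_trans _ _ N%:R%:E).
  apply: (@counting_le _ _ _ _ N f) => [h _|h k]; first exact: ltn_ord.
  rewrite !inE => -[Gh hT] [Gk kT] /ord_inj/enum_rank_inj/ffunP E.
  have ui (q : M) : mxgroup_set Gam q -> q \is a GRing.unit.
    exact: mxgroup_unit.
  have uh := ui h Gh; have uk := ui k Gk.
  have gh : g * h \is a GRing.unit by rewrite unitrMr.
  have gk : g * k \is a GRing.unit by rewrite unitrMr.
  have close i j : `|(g * k) i j - (g * h) i j| <= eta.
    have := congr1 val (E (i, j)); rewrite !ffunE /= !inordK ?ltnS ?idx_ub// => Eij.
    have pos q : sqnorm (g * q) <= T -> 0 <= ((g * q) i j + T) / eta.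
      move=> qT; rewrite divr_ge0 ?(ltW eta0)//; have := Hent q i j qT.
      by rewrite ler_norml; lra.
    have /andP[h1 h2] := truncn_itv (pos h hT).
    have /andP[k1 k2] := truncn_itv (pos k kT).
    rewrite /idx/= in Eij; rewrite Eij in h1 h2.
    rewrite -(ler_pM2r (_ : 0 < eta^-1)) ?invr_gt0// divff ?gt_eqF//.
    rewrite -[X in _ * X](@gtr0_norm _ eta^-1) ?invr_gt0// -normrM.
    rewrite -natr1 in h2 k2.
    by rewrite ler_norml; apply/andP; split; move: h1 h2 k1 k2; rewrite !mulrDl mulNr; lra.
  have H1 : (g * h)^-1 * (g * k) = h^-1 * k.
    by rewrite invrM// -mulrA (mulrA g^-1) mulVr// mul1r.
  have H2 : h^-1 * k = 1.
    apply: Hdl; last by apply: mxgroupM => //; exact: mxgroupV.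
    rewrite -H1 -(mulVr gh) -mulrBr; apply: le_lt_trans (mx_normM _ _) _.
    apply: (@le_lt_trans _ _ (n.+1%:R * T * eta)).
      rewrite -!mulrA ler_wpM2l//; apply: ler_pM => //.
        apply: ler_mx_norm => [|i j]; first exact: ltW.
        exact: (@norm_coord_le (g * h) (false, (i, j))).
      apply: ler_mx_norm => [|i j]; first exact: ltW.
      by have := close i j; rewrite !mxE.
    rewrite (_ : _ * eta = dl / 2); first by lra.
    by rewrite /eta; field; rewrite !gt_eqF.
  by rewrite -[LHS]mulr1 -H2 mulrA divrr// mul1r.
rewrite lee_fin /N card_ffun card_ord card_prod card_ord natrX /growth [T ^+ _]exprM -exprMn.
have cT0 : 0 <= (c + 1) * T ^+ 2 by rewrite mulr_ge0 ?sqr_ge0 ?addr_ge0.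
by rewrite lerXn2r ?nnegrE.
Qed.

End discrete_subgroup.

(** * Series over the discrete group *)

Section weighted_sums.
Context {R : realType} {n : nat} (Gam : mxgroup R n).
Local Notation M := 'M[R]_n.+1.
Local Notation T := (@all_measurable R n).
Local Notation cnt := (@gcount R n).
Local Notation s := ((@growth n).+1).
Hypothesis Gam_discrete : \forall g \near (1 : M), mxgroup_set Gam g -> g = 1.

Definition Gam_set : set T := fun c => mxgroup_set Gam c.

Definition orbit_term (Q : M -> R) (g : M) (c : T) : R :=
  Q (g * (c : M)) / sqnorm (g * (c : M)) ^+ s.

(* The series is right [Gam]-invariant and converges because the exponent exceeds
   [growth]. *)
Definition theta (Q : M -> R) (g : M) : R :=
  \int[cnt]_(c in Gam_set) orbit_term Q g c.

Lemma Gam_set_unit (c : T) : Gam_set c -> (c : M) \is a GRing.unit.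
Proof. exact: mxgroup_unit. Qed.

Lemma orbit_unit (g : M) (c : T) : g \is a GRing.unit -> Gam_set c ->
  g * (c : M) \is a GRing.unit.
Proof. by move=> gu /Gam_set_unit cu; rewrite unitrMr. Qed.

Lemma dyadic_interval (x : R) k0 : 2 ^+ k0 <= x ->
  exists k, 2 ^+ (k0 + k) <= x /\ x <= 2 ^+ (k0 + k).+1.
Proof.
move=> kx.
have ex : exists k, x < 2 ^+ (k0 + k).+1.
  have x0 : 0 <= x by apply: le_trans kx; rewrite exprn_ge0.
  exists (Num.truncn x); have /andP[_ /lt_le_trans] := truncn_itv x0; apply.
  rewrite -natrX ler_nat; apply: leq_trans (ltn_expl _ (isT : (1 < 2)%N)) _.
  by rewrite leq_exp2l// leqW// leq_addl.
exists (ex_minn ex); case: ex_minnP => k kP kmin; split; last exact: ltW.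
case: k kP kmin => [|k] kP kmin; first by rewrite addn0.
by rewrite leNgt addnS; apply/negP => /kmin; rewrite ltnn.
Qed.

(** On the shell where [sqnorm] is about 2^j there are O(2^(j growth)) terms of size 2^(-j (growth +
    1)), in total O(2^-j), and only j >= [k0] occurs. The gain 1 / 2^k0 is what makes the series
    vanish at infinity. *)
Lemma weight_integral_le : exists2 C : R, 0 <= C & forall (g : M) k0,
  g \is a GRing.unit ->
  (forall c, Gam_set c -> 2 ^+ k0 <= sqnorm (g * (c : M))) ->
  (\int[cnt]_(c in Gam_set) (orbit_term (fun=> 1%R) g c)%:E <= (C / 2 ^+ k0)%:E)%E.
Proof.
have [C C0 HC] := count_le_growth Gam_discrete.
exists (C * 2 ^+ (@growth n) / (1 - 2^-1)).
  by rewrite !mulr_ge0 ?exprn_ge0 ?invr_ge0//; lra.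
move=> g k0 gu gk.
rewrite [X in (_ <= X%:E)%E](_ : _ = C * 2 ^+ (@growth n) / 2 ^+ k0 / (1 - 2^-1)); last first.
  by rewrite mulrAC.
pose A k : set T := [set c : T | mxgroup_set Gam c /\
  (sqnorm (g * (c : M)) <= 2 ^+ (k0 + k).+1)%R].
apply: (@integral_le_geometric _ _ _ cnt Gam_set (orbit_term (fun=> 1%R) g) A
  (fun k => ((2 ^+ (k0 + k)) ^+ s)^-1)).
- exact: measurable_all.
- exact: measurable_fun_all.
- by move=> c _; rewrite /orbit_term mul1r invr_ge0 exprn_ge0// sqnorm_ge0.
- by move=> k; exact: measurable_all.
- by move=> k; rewrite invr_ge0 !exprn_ge0.
- move=> c Gc; have [k [k1 k2]] := dyadic_interval (gk c Gc).
  exists k => //; rewrite /orbit_term mul1r lef_pV2 ?posrE ?exprn_gt0//.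
    by rewrite lerXn2r// nnegrE ?exprn_ge0// sqnorm_ge0.
  exact/sqnorm_gt0/orbit_unit.
- move=> k; have k1 : (1 : R) <= 2 ^+ (k0 + k).+1 by rewrite exprn_ege1// ler1n.
  apply: (@le_trans _ _ (((2 ^+ (k0 + k)) ^+ s)^-1%:E *
    (C * (2 ^+ (k0 + k).+1) ^+ (@growth n))%:E)%E).
    apply: lee_wpmul2l; first by rewrite lee_fin invr_ge0 !exprn_ge0.
    exact: HC.
  rewrite -EFinM lee_fin exprVn le_eqVlt; apply/orP; left; apply/eqP.
  rewrite [2 ^+ (k0 + k).+1]exprS exprMn exprS exprD; field.
  by rewrite !expf_neq0// mulf_neq0// expf_neq0.
- by rewrite divr_ge0 ?exprn_ge0 ?mulr_ge0 ?exprn_ge0.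
- by [].
- by lra.
Qed.

Lemma weight_integral_lty (g : M) : g \is a GRing.unit ->
  (\int[cnt]_(c in Gam_set) (orbit_term (fun=> 1%R) g c)%:E < +oo)%E.
Proof.
move=> gu; have [C C0 HC] := weight_integral_le.
apply: (@le_lt_trans _ _ (C / 2 ^+ 0)%:E); last exact: ltry.
apply: HC => // c Gc; rewrite expr0; exact/sqnorm_ge1/orbit_unit.
Qed.

Lemma term1_gt0 (g : M) c : g \is a GRing.unit -> Gam_set c ->
  0 < orbit_term (fun=> 1) g c.
Proof.
by move=> gu Gc; rewrite /orbit_term mul1r invr_gt0 exprn_gt0// sqnorm_gt0// orbit_unit.
Qed.

Lemma normr_term_le Q B (g : M) (c : T) : g \is a GRing.unit -> Gam_set c ->
  (forall h, h \is a GRing.unit -> `|Q h| <= B) ->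
  `|orbit_term Q g c| <= B * orbit_term (fun=> 1) g c.
Proof.
move=> gu Gc QB; have := term1_gt0 gu Gc; rewrite /orbit_term mul1r => t0.
by rewrite normrM (gtr0_norm t0); apply: ler_wpM2r; [exact: ltW|exact/QB/orbit_unit].
Qed.

Lemma integrable_term1 (g : M) : g \is a GRing.unit ->
  cnt.-integrable Gam_set (EFin \o orbit_term (fun=> 1) g).
Proof.
move=> gu; apply/integrableP; split; first exact: measurable_fun_all.
apply: le_lt_trans (weight_integral_lty gu).
rewrite le_eqVlt; apply/orP; left; apply/eqP; apply: eq_integral => c.
by rewrite inE => Gc; rewrite gee0_abs// lee_fin ltW// term1_gt0.
Qed.

Lemma integrable_dominated (g : M) (f : T -> R) B : g \is a GRing.unit ->
  (forall c, Gam_set c -> `|f c| <= B * orbit_term (fun=> 1) g c) ->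
  cnt.-integrable Gam_set (EFin \o f).
Proof.
move=> gu fB; have := integrable_term1 gu => /(integrableZl (measurable_all _) B).
apply: le_integrable; [exact: measurable_all|exact: measurable_fun_all|].
move=> c Gc /=; rewrite lee_fin; apply: le_trans (fB c Gc) _.
by rewrite ler_norm.
Qed.

Lemma Rintegral_dominated (g : M) (f : T -> R) B : g \is a GRing.unit ->
  (forall c, Gam_set c -> `|f c| <= B * orbit_term (fun=> 1) g c) ->
  `|\int[cnt]_(c in Gam_set) f c| <= B * theta (fun=> 1) g.
Proof.
move=> gu fB; have fi := integrable_dominated gu fB.
apply: le_trans (le_normr_Rintegral (measurable_all _) fi) _.
rewrite -RintegralZl//; [|exact: measurable_all|exact: integrable_term1].
apply: le_Rintegral => //; first exact: measurable_all.
  by have := integrable_abse fi.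
exact: (@integrableZl _ _ _ cnt _ (measurable_all _) B _ (integrable_term1 gu)).
Qed.

Lemma integrable_term Q (g : M) : tame Q -> g \is a GRing.unit ->
  cnt.-integrable Gam_set (EFin \o orbit_term Q g).
Proof.
move=> tQ gu; have [B B0 QB] := tame_bounded tQ.
by apply: (@integrable_dominated g _ B gu) => c Gc; exact: (normr_term_le gu Gc QB).
Qed.

Lemma normr_theta_le Q B (g : M) : g \is a GRing.unit ->
  (forall h, h \is a GRing.unit -> `|Q h| <= B) ->
  `|theta Q g| <= B * theta (fun=> 1) g.
Proof.
by move=> gu QB; apply: (Rintegral_dominated gu) => c Gc; exact: (normr_term_le gu Gc QB).
Qed.

(** All terms are positive, and the one of the identity already gives a lower bound. *)
Lemma theta1_gt0 (g : M) : g \is a GRing.unit -> 0 < theta (fun=> 1) g.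
Proof.
move=> gu; have G1 : Gam_set (1 : M) by exact: mxgroup1.
apply: (@lt_le_trans _ _ (orbit_term (fun=> 1) g (1 : M))); first exact: term1_gt0.
rewrite -lee_fin /theta /Rintegral fineK; last first.
  by apply: integrable_fin_num; [exact: measurable_all|exact: integrable_term1].
pose one : T := (1 : M).
have -> : ((orbit_term (fun=> 1) g one)%:E =
    \int[cnt]_(c in [set one]) (orbit_term (fun=> 1) g c)%:E)%E.
  rewrite (eq_integral (cst (orbit_term (fun=> 1%R) g one)%:E)); last first.
    by move=> c; rewrite inE => ->.
  rewrite integral_cst; last exact: measurable_all.
  rewrite /= /counting asboolT ?fset_set1// ?finset_set1 ?finmap.cardfs1.
  by rewrite mule1.
apply: ge0_subset_integral => //; [exact: measurable_all..| | |].
- exact: measurable_fun_all.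
- by move=> c Gc; rewrite lee_fin ltW// term1_gt0.
- by move=> c ->.
Qed.

Lemma theta1_small : exists2 C : R, 0 <= C & forall (g : M) k0,
  g \is a GRing.unit ->
  (forall c, Gam_set c -> 2 ^+ k0 <= sqnorm (g * (c : M))) ->
  theta (fun=> 1) g <= C / 2 ^+ k0.
Proof.
have [C C0 HC] := weight_integral_le; exists C => // g k0 gu gk.
rewrite -lee_fin /theta /Rintegral fineK; first exact: HC.
by apply: integrable_fin_num; [exact: measurable_all|exact: integrable_term1].
Qed.

(** Left multiplication by [h] permutes the group, and counting measure is preserved by the
    bijection [phi]. *)
Lemma theta_invariant Q (g h : M) : tame Q -> g \is a GRing.unit ->
  mxgroup_set Gam h -> theta Q (g * h) = theta Q g.
Proof.
move=> tQ gu Gh; have hu : h \is a GRing.unit by exact: mxgroup_unit Gh.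
pose phi (c : T) : T := h * (c : M).
have mphi : measurable_fun [set: T] phi by exact: measurable_fun_all.
have phiG : phi @^-1` Gam_set = Gam_set.
  apply/seteqP; split => c; rewrite /phi /Gam_set /= => Gc; last exact: mxgroupM.
  by rewrite -(mulKr hu c); apply: mxgroupM => //; exact: mxgroupV.
have E : (\int[cnt]_(c in Gam_set) (orbit_term Q g c)%:E =
    \int[pushforward cnt phi]_(c in Gam_set) (orbit_term Q g c)%:E)%E.
  apply: eq_measure_integral => A _ _; rewrite /= /pushforward /counting.
  have cA : (phi @^-1` A #= A)%card.
    have -> : phi @^-1` A = (fun c : T => (h^-1 * (c : M) : T)) @` A.
      apply/seteqP; split => [c /= Ac|c /= [b Ab <-]].
        by exists (phi c) => //; rewrite /phi mulKr.
      by rewrite /phi mulVKr.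
    apply: inj_card_eq => b c _ _ /(congr1 (fun b => h * b)).
    by rewrite !mulVKr.
  have /card_eqPle[le1 le2] := cA.
  case: (pselect (finite_set A)) => fA; last first.
    rewrite !asboolF// => fin; apply: fA; exact: card_le_finite le2 fin.
  have fA' : finite_set (phi @^-1` A) by exact: card_le_finite le1 fA.
  by rewrite !asboolT//; have /fcard_eq := cA => /(_ fA' fA) ->.
have ghu : g * h \is a GRing.unit by rewrite unitrMr.
have tE : (EFin \o orbit_term Q g) \o phi = EFin \o orbit_term Q (g * h).
  by apply/funext => c; rewrite /= /orbit_term /phi mulrA.
have ip : cnt.-integrable (phi @^-1` Gam_set) ((EFin \o orbit_term Q g) \o phi).
  by rewrite phiG tE; exact: integrable_term.
have mf : measurable_fun [set: T] (EFin \o orbit_term Q g) by exact: measurable_fun_all.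
have := integral_pushforward mphi mf ip (measurable_all _).
rewrite phiG tE => E2; rewrite /theta /Rintegral; congr fine.
by rewrite E; exact/esym/E2.
Qed.

Section perturbation.
Context {H : Type} (P : set H) (l w : H -> R) (e : H -> M) (A : M) (K : R).
Hypothesis w_ge0 : forall h, P h -> 0 <= w h.
Hypothesis w_le1 : forall h, P h -> w h <= 1.
Hypothesis sqr_l : forall h, P h -> l h ^+ 2 <= w h.
Hypothesis e_unit : forall h, P h -> e h \is a GRing.unit.
Hypothesis e_near : forall h, P h -> `|e h - 1 - l h *: A| <= K * w h.
Hypothesis K_ge0 : 0 <= K.

(** The constants of [tame_weighted_expands] are the same at every point [g * c] of the orbit, and
    its errors add up to a multiple of [theta (fun=> 1) g]. *)
Lemma theta_perturbation Q : tame Q -> exists2 Q', tame Q' &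
  exists C c : R, [/\ 0 <= C, 0 < c & forall (g : M) h, g \is a GRing.unit ->
    P h -> w h <= c -> `|theta Q (e h * g) - theta Q g - l h * theta Q' g| <=
      C * w h * theta (fun=> 1) g].
Proof.
move=> tQ; have [Q' tQ' [C [c [C0 c0 HC]]]] :=
  tame_weighted_expands w_ge0 w_le1 sqr_l e_unit
    (entry_expands (P := P) e_near K_ge0)
    (inv_entry_expands w_ge0 w_le1 sqr_l e_unit e_near K_ge0) s tQ.
exists Q' => //; exists C, c; split => // g h gu Ph wc.
have egu : e h * g \is a GRing.unit by rewrite unitrMr// e_unit.
have i1 := integrable_term tQ egu; have i2 := integrable_term tQ gu.
have i3 := integrable_term tQ' gu.
have mG : measurable Gam_set := measurable_all _.
have i3' : cnt.-integrable Gam_set (EFin \o (fun c => l h * orbit_term Q' g c)).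
  exact: (@integrableZl _ _ _ cnt _ mG (l h) _ i3).
have i12 : cnt.-integrable Gam_set (EFin \o (fun c => orbit_term Q (e h * g) c - orbit_term Q g c)).
  by have := integrableB mG i1 i2.
rewrite /theta -(RintegralZl (l h) mG i3) -(RintegralB mG i1 i2).
rewrite -(RintegralB mG i12 i3').
apply: (Rintegral_dominated gu) => k Gk.
have := HC (g * (k : M)) h (orbit_unit gu Gk) Ph wc.
by rewrite /orbit_term mul1r !mulrA.
Qed.

End perturbation.
End weighted_sums.

(** * Functions on the quotient *)

Section matrix_topology.
Context {R : realType} {n : nat}.
Local Notation M := 'M[R]_n.+1.

Lemma mx_cvgP (T : Type) (F : set_system T) (FF : Filter F) (f : T -> M) (A : M) :
  (forall i j, f x i j @[x --> F] --> A i j) -> f @ F --> A.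
Proof.
move=> H; apply/cvgrPdist_le => e e0.
have : \forall x \near F, forall i j, `|A i j - f x i j| <= e.
  by apply: filter_forall => i; apply: filter_forall => j;
    move/cvgrPdist_le: (H i j); exact.
apply: filterS => x Hx; apply: ler_mx_norm; first exact: ltW.
by move=> i j; rewrite !mxE.
Qed.

Lemma mx_mul_cvg (T : Type) (F : set_system T) (FF : Filter F) (f g : T -> M)
  (A B : M) : f @ F --> A -> g @ F --> B -> f x * g x @[x --> F] --> A * B.
Proof.
move=> fA gB; apply: mx_cvgP => i j; rewrite mxE.
under eq_fun do rewrite mxE.
apply: cvg_big => [|k _]; first exact: add_continuous.
apply: cvgM.
  exact: (continuous_cvg _ (@coord_continuous R _ _ i k A) fA).
exact: (continuous_cvg _ (@coord_continuous R _ _ k j B) gB).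
Qed.

Lemma compact_mx_box (L : R) : compact [set A : M | forall i j, `|A i j| <= L].
Proof.
have := @rV_compact R (n.+1 * n.+1) (fun=> `[(- L), L]%classic)
  (fun=> @segment_compact _ _ _).
move=> cK; have cv : continuous (vec_mx : 'rV[R]_(n.+1 * n.+1) -> M).
  move=> v; apply: (mx_cvgP (nbhs_filter v)) => i j; rewrite mxE.
  under eq_fun do rewrite mxE.
  exact: coord_continuous.
have := continuous_compact (continuous_subspaceT cv) cK.
rewrite (_ : _ @` _ = [set A : M | forall i j, `|A i j| <= L])//.
apply/seteqP; split=> [_ [v vL <-] i j|A AL] /=.
  by rewrite mxE; have := vL (mxvec_index i j); rewrite /= in_itv/= ler_norml.
exists (mxvec A); last exact: mxvecK.
move=> k /=; case/mxvec_indexP: k => i j; rewrite mxvecE in_itv/= -ler_norml.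
exact: AL.
Qed.

End matrix_topology.

Section quadratic_derivative.
Context {R : realType}.

Lemma is_derive_quadratic (f : R -> R) (x a c C : R) : 0 < c ->
  (forall t, `|t| <= c -> `|f (t + x) - f x - t * a| <= C * t ^+ 2) ->
  is_derive x 1 f a.
Proof.
move=> c0 H.
have near0 (r : R) : 0 < r -> \forall t \near (0 : R), `|t| <= r.
  move=> r0; have : (t @[t --> (0 : R)]) --> (0 : R) by exact: cvg_id.
  by move/cvgr0Pnorm_le => /(_ r r0).
have cv : (fun h : R => h^-1 *: ((f \o shift x) (h *: (1 : R)) - f x)) @ 0^' --> a.
  apply/cvgrPdist_le => e e0; pose K := `|C| + 1.
  have K0 : 0 < K by rewrite ltr_wpDl.
  near=> t.
  have t0 : t != 0 by near: t; exact: nbhs_dnbhs_neq.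
  have tc : `|t| <= c.
    by near: t; apply: nbhs_dnbhs; exact: near0.
  have te : `|t| <= e / K.
    by near: t; apply: nbhs_dnbhs; apply: near0; exact: divr_gt0.
  rewrite /= [t *: 1]mulr1 distrC.
  have -> : t^-1 *: (f (t + x) - f x) - a = t^-1 * (f (t + x) - f x - t * a).
    by rewrite /GRing.scale/=; field.
  rewrite normrM normfV ler_pdivrMl ?normr_gt0//.
  apply: le_trans (H t tc) _; rewrite -[t ^+ 2]real_normK ?num_real// expr2 mulrCA.
  rewrite ler_wpM2l//; apply: (@le_trans _ _ (K * `|t|)).
    by rewrite ler_wpM2r// /K; have := ler_norm C; lra.
  by rewrite mulrC -ler_pdivlMr.
split; first by apply/cvg_ex; exists a.
exact: cvg_lim cv.
Unshelve. all: by end_near. Qed.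

End quadratic_derivative.

Section quotient.
Context {R : realType} {n : nat} (G Gam : mxgroup R n).
Local Notation M := 'M[R]_n.+1.
Local Notation X := (quo G Gam).
Hypothesis G_closed : closed_in_GL G.
Hypothesis Gam_sub : mxgroup_set Gam `<=` mxgroup_set G.
Hypothesis Gam_discrete : \forall g \near (1 : M), mxgroup_set Gam g -> g = 1.

Lemma mxg_valP (g : mxg G) : mxgroup_set G (mxg_val g).
Proof. exact: set_mem (valP (g : set_type G)). Qed.

Lemma mxg_val_unit (g : mxg G) : mxg_val g \is a GRing.unit.
Proof. exact: mxgroup_unit (mxg_valP g). Qed.

Lemma to_mxgK (g : M) : mxgroup_set G g -> mxg_val (to_mxg G g) = g.
Proof. by move=> Gg; rewrite /mxg_val /to_mxg val_insubd mem_set. Qed.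

Lemma mxg_val_continuous : continuous (@mxg_val R n G).
Proof. exact: initial_continuous. Qed.

Definition coset_rep (x : X) : M := mxg_val (repr x).

Lemma coset_rep_unit (x : X) : coset_rep x \is a GRing.unit.
Proof. exact: mxg_val_unit. Qed.

Lemma coset_rep_mem (x : X) : mxgroup_set G (coset_rep x).
Proof. exact: mxg_valP. Qed.

Lemma coset_rep_pi (g : mxg G) : exists2 c, mxgroup_set Gam c &
  coset_rep (\pi_X%qT g) = mxg_val g * c.
Proof.
have : coset_rel Gam g (repr (\pi_X%qT g)).
  have /eqmodP : (g = repr (\pi_X g) %[mod X])%qT.
    by rewrite reprK.
  by [].
move=> /asboolP Gc; exists ((mxg_val g)^-1 * mxg_val (repr (\pi_X%qT g))) => //.
by rewrite mulrA divrr ?mxg_val_unit// mul1r.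
Qed.

Definition Theta (Q : M -> R) (x : X) : R := theta Gam Q (coset_rep x).

Lemma Theta_pi Q (g : mxg G) : tame Q ->
  Theta Q (\pi_X%qT g) = theta Gam Q (mxg_val g).
Proof.
move=> tQ; rewrite /Theta; have [c Gc ->] := coset_rep_pi g.
by rewrite theta_invariant// mxg_val_unit.
Qed.

Lemma Theta_act Q (g : M) (x : X) : tame Q -> mxgroup_set G g ->
  Theta Q (act g x) = theta Gam Q (g * coset_rep x).
Proof.
move=> tQ Gg; rewrite /act Theta_pi// to_mxgK//.
by apply: mxgroupM => //; exact: mxg_valP.
Qed.

Lemma Theta_bounded Q B x : (forall h, h \is a GRing.unit -> `|Q h| <= B) ->
  `|Theta Q x| <= B * Theta (fun=> 1) x.
Proof. by apply: normr_theta_le => //; exact: coset_rep_unit. Qed.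

Lemma Theta1_gt0 x : 0 < Theta (fun=> 1) x.
Proof. by apply: theta1_gt0 => //; exact: coset_rep_unit. Qed.

(** A matrix [g] near [g0] is written as [g * g0^-1] times [g0], and the base point of the expansion
    is the fixed matrix [g0]. The linear term is absent, so [A] is 0 and [K] is 1. *)
Lemma theta_continuous Q (g0 : M) : tame Q -> g0 \is a GRing.unit ->
  theta Gam Q g @[g --> within invertible (nbhs g0)] --> theta Gam Q g0.
Proof.
move=> tQ gu.
pose P : set M := [set e : M | e \is a GRing.unit /\ `|e - 1| <= 1].
have [Q' tQ' [C [c [C0 c0 HC]]]] : exists2 Q', tame Q' &
  exists C c : R, [/\ 0 <= C, 0 < c & forall (g h : M), g \is a GRing.unit ->
    P h -> `|h - 1| <= c -> `|theta Gam Q (h * g) - theta Gam Q g -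
      0 * theta Gam Q' g| <= C * `|h - 1| * theta Gam (fun=> 1) g].
  apply: (@theta_perturbation _ _ _ Gam_discrete M P (fun=> 0)
    (fun e => `|e - 1|) id 0 1) => //.
  - by move=> e [].
  - by move=> e _; rewrite expr0n/= normr_ge0.
  - by move=> e [].
  - by move=> e _; rewrite scale0r subr0 mul1r.
pose D := C * theta Gam (fun=> 1) g0 + 1.
have t0 := theta1_gt0 Gam_discrete gu.
have D0 : 0 < D by rewrite ltr_wpDl// mulr_ge0// ltW.
apply/cvgrPdist_le => e e0.
pose r := Num.min (Num.min 1 c) (e / D).
have r0 : 0 < r by rewrite !lt_min ltr01 c0 divr_gt0.
pose N := n.+1%:R * `|g0^-1| + 1.
have N0 : 0 < N by rewrite ltr_wpDl// mulr_ge0.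
have H0 : \forall g \near g0, `|g0 - g| <= r / N.
  have : (g @[g --> g0]) --> g0 by exact: cvg_id.
  by move/cvgrPdist_le; apply; exact: divr_gt0.
near=> g.
have ug : invertible g by near: g; exact: withinT.
have small : `|g * g0^-1 - 1| <= r.
  rewrite -(divrr gu) -mulrBl; apply: le_trans (mx_normM _ _) _.
  rewrite mulrAC; apply: (@le_trans _ _ (N * `|g - g0|)).
    by rewrite ler_wpM2r// lerDl.
  rewrite mulrC -ler_pdivlMr// distrC.
  by near: g; apply: filterS H0 => g.
have [r1 rc re] : [/\ r <= 1, r <= c & r <= e / D].
  by rewrite /r !ge_min !lexx !orbT.
have Pg : P (g * g0^-1).
  by split; [rewrite unitrMr ?unitrV|exact: le_trans r1].
have := HC g0 (g * g0^-1) gu Pg (le_trans small rc).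
rewrite mul0r subr0 -mulrA mulVr// mulr1 distrC => /le_trans; apply.
rewrite mulrAC; apply: (@le_trans _ _ (D * (e / D))).
  by apply: ler_pM => //; rewrite ?mulr_ge0 ?(ltW t0)// ?lerDl//; exact: le_trans re.
by rewrite mulrCA divff ?mulr1// gt_eqF.
Unshelve. all: by end_near. Qed.

Lemma Theta_continuous Q : tame Q -> continuous (Theta Q).
Proof.
move=> tQ; apply/quotient_continuous => g.
have E : Theta Q \o \pi_X%qT = theta Gam Q \o @mxg_val R n G.
  by apply/funext => h /=; exact: Theta_pi.
rewrite E; apply: cvg_comp (theta_continuous tQ (mxg_val_unit g)).
move=> A; rewrite /within/= => nA.
have nA' : nbhs g (@mxg_val R n G @^-1` _) := mxg_val_continuous nA.
change (nbhs g (@mxg_val R n G @^-1` A)); apply: filterS nA' => h /=.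
by apply; exact: mxg_val_unit.
Qed.

(** The derivative is again some [Theta Q'] with [Q'] independent of [x], which lets the argument be
    iterated to all orders. *)
Lemma Theta_derive Q A : tame Q -> lie G A -> exists2 Q', tame Q' &
  forall x : X, is_derive (0 : R) 1 (fun t => Theta Q (act (expm (t *: A)) x))
    (Theta Q' x).
Proof.
move=> tQ lA; have [K K0 HK] := expm_perturbation A.
pose P : set R := [set t | `|t| <= 1].
have w1 (t : R) : P t -> t ^+ 2 <= 1.
  by move=> t1; rewrite -real_normK ?num_real// expr_le1.
have eu (t : R) : P t -> expm (t *: A) \is a GRing.unit.
  by move=> _; apply: mxgroup_unit (lA t).
have [Q' tQ' [C [c [C0 c0 HC]]]] := @theta_perturbation _ _ _ Gam_discrete R P
  id (fun t => t ^+ 2) (fun t => expm (t *: A)) A K (fun t _ => sqr_ge0 t) w1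
  (fun t _ => lexx _) eu HK K0 _ tQ.
exists Q' => // x.
have E0 : expm (0 *: A) = 1.
  have := HK 0; rewrite normr0 ler01 expr0n mulr0 scale0r subr0 => /(_ isT).
  by rewrite normr_le0 subr_eq0 => /eqP.
pose k := Num.min 1 c.
have k0 : 0 < k by rewrite lt_min ltr01.
apply: (is_derive_quadratic (c := k) (C := C * theta Gam (fun=> 1) (coset_rep x)) k0).
move=> t; rewrite addr0 le_min => /andP[t1 tc].
have G0 : mxgroup_set G (expm (0 *: A)) by exact: lA.
rewrite !Theta_act// ?E0 ?mul1r//.
apply: le_trans (HC (coset_rep x) t (coset_rep_unit x) t1 _) _; last by rewrite mulrAC.
apply: le_trans tc; rewrite -real_normK ?num_real// expr2.
by rewrite ler_piMl.
Qed.

(** By [theta1_small], a point of this set has a representative with bounded [sqnorm], so the set is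
    a closed part of the image of a compact subset of G. *)
Lemma compact_Theta_ge (dl : R) : 0 < dl ->
  compact [set x | dl <= Theta (fun=> 1) x].
Proof.
move=> dl0; have [C C0 HC] := theta1_small Gam_discrete.
have [k0 kP] : exists k : nat, C / 2 ^+ k < dl.
  exists (Num.truncn (C / dl)); rewrite ltr_pdivrMr ?exprn_gt0// mulrC -ltr_pdivrMr//.
  have := truncn_itv (divr_ge0 C0 (ltW dl0)) => /andP[_] /lt_le_trans; apply.
  by rewrite -natrX ler_nat ltn_expl.
pose L : R := 2 ^+ k0.
have L1 : 1 <= L by rewrite exprn_ege1// ler1n.
pose box : set M := [set A | forall i j, `|A i j| <= L].
(* G is closed only among invertible matrices. Keeping the inverse as a second component makes
   invertibility a closed condition, and bounds on both components then give compactness. *)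
pose K2 : set (M * M) := [set p | closure G p.1] `&` [set p | p.1 * p.2 = 1].
have cfst : continuous (fst : M * M -> M).
  move=> [a b] A nA; exists (A, setT) => [|[? ?] [] //].
  by split => //; exact: filterT.
have csnd : continuous (snd : M * M -> M).
  move=> [a b] A nA; exists (setT, A) => [|[? ?] [] //].
  by split => //; exact: filterT.
have cK2 : closed K2.
  apply: closedI.
    by apply: (@preimage_closed _ _ fst _ (in1W cfst)); exact: closed_closure.
  rewrite (_ : mkset _ = (fun p : M * M => p.1 * p.2) @^-1` [set 1])//.
  apply: preimage_closed; last first.
    by apply: compact_closed; [exact: norm_hausdorff|exact: compact_set1].
  by apply: in1W => p; apply: mx_mul_cvg; [exact: cfst|exact: csnd].
have cK : compact (fst @` ((box `*` box) `&` K2)).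
  apply: continuous_compact; first exact: continuous_subspaceT.
  have c1 : compact box by exact: compact_mx_box.
  have c2 : compact (box `*` box) by exact: compact_setX.
  exact: compact_closedI.
(* Compactness among all matrices passes to the induced topology of G because the cluster point [p]
   is invertible and adherent to G, hence in G. *)
have cK' : compact ((@mxg_val R n G) @^-1` (fst @` ((box `*` box) `&` K2))).
  move=> F PF FK.
  have [|p [Kp clp]] := cK (@mxg_val R n G @ F) _; first exact: FK.
  have Gp : mxgroup_set G p.
    case: Kp => -[a b] /= [_ [cla ab]] <-; apply: G_closed => //.
    by apply/unitrP; exists b; split => //; exact: mulmx1C.
  exists (to_mxg G p); split; first by rewrite /= to_mxgK.
  move=> A B FA /=; rewrite nbhsE => -[_ [[W oW <-] Wp] WB].
  have : nbhs p W.
    by have : W (mxg_val (to_mxg G p)) := Wp; rewrite to_mxgK// => Wp1; exact: open_nbhs_nbhs.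
  have FA' : F (@mxg_val R n G @^-1` (@mxg_val R n G @` A)).
    by apply: filterS FA => a Aa; exists a.
  move=> /(clp _ _ FA') [_ [ [a Aa <-] Wa]].
  by exists a; split => //; exact: WB.
apply: subclosed_compact (continuous_compact (continuous_subspaceT (@pi_continuous _ (quo G Gam))) cK') _.
  apply: (@preimage_closed _ _ (Theta (fun=> 1)) [set t | dl <= t]).
    by apply: in1W; apply: Theta_continuous; exact: tame_cst.
  exact: closed_ge.
move=> x /= dx.
have [c Gc cL] : exists2 c, mxgroup_set Gam c & sqnorm (coset_rep x * c) <= L.
  apply: contrapT => H; have : Theta (fun=> 1) x <= C / 2 ^+ k0.
    apply: HC => [|c Gc]; first exact: coset_rep_unit.
    by rewrite leNgt; apply/negP => /ltW cL; apply: H; exists c.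
  by move=> /(le_trans dx) /(lt_le_trans kP); rewrite ltxx.
have Gxc : mxgroup_set G (coset_rep x * c) by apply: mxgroupM; [exact: coset_rep_mem|exact: Gam_sub].
exists (to_mxg G (coset_rep x * c)).
  rewrite /= to_mxgK//; exists (coset_rep x * c, (coset_rep x * c)^-1) => //.
  have uxc : coset_rep x * c \is a GRing.unit by exact: mxgroup_unit Gxc.
  split; last by split => /=; [exact: subset_closure|rewrite divrr].
  split => i j /=.
    exact: (norm_coord_le (true, (i, j)) L1 cL).
  exact: (norm_coord_le (false, (i, j)) L1 cL).
rewrite -[RHS]reprK; apply/eqmodP; rewrite /= /coset_rel; apply/asboolP.
rewrite to_mxgK// invrM ?coset_rep_unit//; last exact: mxgroup_unit Gc.
by rewrite -mulrA mulVr ?coset_rep_unit// mulr1; exact: mxgroupV.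
Qed.

Lemma act_continuous (T : topologicalType) (u : T -> M) (x : X) :
  continuous u -> (forall t, mxgroup_set G (u t)) ->
  continuous (fun t => act (u t) x).
Proof.
move=> cu Gu t.
have cf : continuous (fun t => to_mxg G (u t * coset_rep x)).
  apply: continuous_comp_initial => s.
  rewrite (_ : _ \o _ = fun s => u s * coset_rep x); last first.
    apply/funext => r; apply: to_mxgK; apply: mxgroupM => //; exact: coset_rep_mem.
  by apply: mx_mul_cvg; [exact: cu|exact: cvg_cst].
apply: (continuous_comp (cf t)); exact: pi_continuous.
Qed.

End quotient.

(** * Cutoff functions *)

Section bump.
Context {R : realType}.
Implicit Types (p : {poly R}) (t y : R).

(** [bump 1] is the step omega of the overview: 0 up to 1, then increasing to the limit 1 at
    infinity. Polynomials in 1 / (t - 1) are included to have a family stable under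
    differentiation. *)
Definition bump p t : R :=
  if 1 < t then p.[(t - 1)^-1] * expR (- (t - 1)^-1) else 0.

Lemma expX_expRN_bounded k : exists2 B : R, 0 <= B &
  forall y, 0 <= y -> y ^+ k * expR (- y) <= B.
Proof.
case: k => [|k].
  by exists 1 => // y y0; rewrite mul1r expR_le1 oppr_le0.
exists (k.+1)`!%:R => // y y0.
rewrite expRN ler_pdivrMr ?expR_gt0// mulrC -ler_pdivrMr ?ltr0n ?fact_gt0//.
by apply: le_trans (expR_ge1Dxn k y0); rewrite lerDr.
Qed.

Lemma poly_expRN_bounded p : exists2 B : R, 0 <= B &
  forall y, 0 <= y -> `|p.[y] * expR (- y)| <= B.
Proof.
(* The extra power of [y] carries the induction, since [poly_ind] splits off a factor X. *)
suff H k : exists2 B : R, 0 <= B &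
    forall y, 0 <= y -> `|y ^+ k * p.[y] * expR (- y)| <= B.
  by have [B B0 HB] := H 0%N; exists B => // y /HB; rewrite expr0 mul1r.
elim/poly_ind: p k => [|p c IH] k.
  by exists 0 => // y _; rewrite horner0 mulr0 mul0r normr0.
have [B B0 HB] := IH k.+1; have [B' B'0 HB'] := expX_expRN_bounded k.
exists (B + `|c| * B'); first by rewrite addr_ge0// mulr_ge0.
move=> y y0; rewrite hornerMXaddC.
have -> : y ^+ k * (p.[y] * y + c) * expR (- y) =
  y ^+ k.+1 * p.[y] * expR (- y) + c * (y ^+ k * expR (- y)).
  by rewrite exprS; ring.
apply: le_trans (ler_normD _ _) _; rewrite lerD ?HB// normrM ler_wpM2l//.
by rewrite ger0_norm ?HB'// mulr_ge0 ?exprn_ge0 ?expR_ge0.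
Qed.

Lemma bump_bounded p : exists2 B : R, 0 <= B & forall t, `|bump p t| <= B.
Proof.
have [B B0 HB] := poly_expRN_bounded p; exists B => // t.
rewrite /bump; case: ifPn => [t1|_]; last by rewrite normr0.
by apply: HB; rewrite invr_ge0; lra.
Qed.

(** With y = 1 / (t - 1) one has dy/dt = - y^2 and d/dy (p e^-y) = (p' - p) e^-y, which gives y^2 (p
    - p') e^-y. *)
Lemma is_derive_bump p t :
  is_derive t 1 (bump p) (bump ('X^2 * (p - p^`())) t).
Proof.
have [t1|t1|<-] := ltgtP 1 t.
- have E : is_derive t 1 (fun s => p.[(s - 1)^-1] * expR (- (s - 1)^-1))
      (bump ('X^2 * (p - p^`())) t).
    have t10 : t - 1 != 0 by rewrite subr_eq0 gt_eqF.
    have dy : is_derive t 1 (fun s : R => (s - 1)^-1) (- (t - 1) ^- 2).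
      have dB : is_derive t (1 : R) (fun s : R => s - 1) (1 - 0).
        exact: is_deriveB.
      split; first by apply: derivableV => //; exact: ex_derive.
      by rewrite deriveV// derive_val subr0 /GRing.scale/= mulr1.
    have dp (y : R) : is_derive y 1 (horner p) p^`().[y].
      apply: DeriveDef; first exact: derivable_horner.
      by rewrite derivE derive1E.
    have dN (y : R) : is_derive y (1 : R) (fun y => expR (- y)) (expR (- y) * (- 1)).
      exact: is_derive1_comp.
    pose inv1 (s : R) := (s - 1)^-1.
    have d1 := @is_derive1_comp _ _ inv1 t _ _ (dp (inv1 t)) dy.
    have d2 := @is_derive1_comp _ _ inv1 t _ _ (dN (inv1 t)) dy.
    have dM := is_deriveM d1 d2.
    apply: (is_derive_eq (f := (horner p \o inv1) * ((fun y => expR (- y)) \o inv1)) dM).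
    rewrite /bump t1 !hornerE /GRing.scale/= /inv1; set y := (t - 1)^-1.
    by rewrite -exprVn -/y; ring.
  apply: near_eq_is_derive E.
  near=> s; rewrite /bump ifT//; near: s; exact: lt_nbhsr.
- rewrite {2}/bump ltNge (ltW t1)/=.
  apply: near_eq_is_derive (is_derive_cst 0 t 1).
  near=> s; rewrite /bump ifF//; apply/negbTE; rewrite -leNgt ltW//.
  by near: s; exact: lt_nbhsl.
(* At the junction t = 1, boundedness of y^2 p(y) e^-y with y = 1/h says that [bump p] is O(h^2)
   there, so its derivative is 0. *)
- have [B B0 HB] := bump_bounded ('X^2 * p).
  have b1 q : bump q 1 = 0 by rewrite /bump ltxx.
  rewrite b1.
  apply: (is_derive_quadratic (c := 1) (C := B)) => // h _.
  rewrite mulr0 subr0 b1 subr0.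
  have := HB (h + 1); rewrite /bump ltrDr; case: ifPn => [h0|_ _].
    rewrite addrK hornerM hornerXn -mulrA normrM ger0_norm; last first.
      by rewrite exprn_ge0// invr_ge0 ltW.
    by rewrite exprVn mulrC -ler_pdivlMr ?invr_gt0 ?exprn_gt0// invrK.
  by rewrite normr0 mulr_ge0 ?sqr_ge0.
Unshelve. all: by end_near. Qed.

Lemma bump_continuous p : continuous (bump p).
Proof.
move=> t; apply: differentiable_continuous; apply/derivable1_diffP.
by have [] := is_derive_bump p t.
Qed.

(* Absorbs the factor [t] which the chain rule brings out when [bump p] is composed
   with a multiple of [height]. *)
Lemma mul_bump p t : t * bump ('X^2 * p) t = bump (('X^2 + 'X) * p) t.
Proof.
rewrite /bump; case: ifPn => t1; last by rewrite mulr0.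
by rewrite !(hornerM, hornerD, hornerXn, hornerX); field; rewrite subr_eq0 gt_eqF.
Qed.

Lemma bump1_ge0 t : 0 <= bump 1 t.
Proof. by rewrite /bump; case: ifP => // _; rewrite hornerE mul1r expR_ge0. Qed.

Lemma bump1_le1 t : bump 1 t <= 1.
Proof.
rewrite /bump; case: ifPn => // t1; rewrite hornerE mul1r expR_le1 oppr_le0.
by rewrite invr_ge0; lra.
Qed.

Lemma bump1_cvg1 (a : R) : 0 < a ->
  (fun j => bump 1 (a * j.+1%:R)) @ \oo --> (1 : R).
Proof.
move=> a0; apply/cvgrPdist_le => e e0.
exists (Num.truncn ((1 + e^-1) / a)) => // j /= jt.
have t1 : 1 + e^-1 < a * j.+1%:R.
  rewrite mulrC -ltr_pdivrMr//.
  have /truncn_itv/andP[_] : 0 <= (1 + e^-1) / a.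
    by rewrite divr_ge0 ?addr_ge0 ?invr_ge0// ltW.
  by move=> /lt_le_trans; apply; rewrite ler_nat.
have ei : 0 < e^-1 by rewrite invr_gt0.
have y0 : 0 < a * j.+1%:R - 1 by lra.
rewrite ger0_norm ?subr_ge0 ?bump1_le1// /bump ifT; last by lra.
rewrite hornerE mul1r; have := expR_ge1Dx (- (a * j.+1%:R - 1)^-1).
have : (a * j.+1%:R - 1)^-1 <= e.
  by rewrite invf_ple ?posrE//; lra.
lra.
Qed.

End bump.

Section continuous_arith.
Context {R : realType} {T : topologicalType}.
Implicit Types f g : T -> R.

Lemma continuous_addr f g : continuous f -> continuous g ->
  continuous (fun x => f x + g x).
Proof. by move=> cf cg x; apply: cvgD; [exact: cf|exact: cg]. Qed.

Lemma continuous_mulr f g : continuous f -> continuous g ->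
  continuous (fun x => f x * g x).
Proof. by move=> cf cg x; apply: cvgM; [exact: cf|exact: cg]. Qed.

Lemma continuous_cst (c : R) : continuous (fun _ : T => c).
Proof. by move=> x; exact: cvg_cst. Qed.

Lemma continuous_divr f g : continuous f -> continuous g ->
  (forall x, g x != 0) -> continuous (fun x => f x / g x).
Proof.
move=> cf cg g0 x; apply: cvgM; first exact: cf.
by apply: cvgV; [exact: g0|exact: cg].
Qed.

End continuous_arith.

(** * Derivatives of real functions along one-parameter subgroups *)

Section real_derivations.
Context {R : realType} {n : nat} {G Gam : mxgroup R n}.
Local Notation M := 'M[R]_n.+1.
Local Notation X := (quo G Gam).
Implicit Types (f g : X -> R) (A : M) (x : X).

Definition along A f x (t : R) : R := f (act (expm (t *: A)) x).

Definition rderiv A f x : R := derive1 (along A f x) 0.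

Definition rsmooth f :=
  forall s : seq M, (forall A, A \in s -> lie G A) ->
    continuous (foldr rderiv f s) /\
    forall A, lie G A -> forall x, derivable (along A (foldr rderiv f s) x) 0 1.

Lemma expm0 A : expm (0 *: A) = 1.
Proof.
have [K K0 /(_ 0)] := expm_perturbation A.
rewrite normr0 ler01 expr0n mulr0 scale0r subr0 => /(_ isT).
by rewrite normr_le0 subr_eq0 => /eqP.
Qed.

Lemma act1 x : act 1 x = x.
Proof.
rewrite /act mul1r -[RHS]reprK; congr (\pi_X%qT _).
by apply: val_inj; exact: (to_mxgK (mxg_valP (repr x))).
Qed.

Lemma along0 A f x : along A f x 0 = f x.
Proof. by rewrite /along expm0 act1. Qed.

Lemma is_derive_rderiv A f x l : is_derive (0 : R) 1 (along A f x) l ->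
  rderiv A f x = l.
Proof. by move=> [_ <-]; rewrite /rderiv derive1E. Qed.

Lemma rderiv_is_derive A f x : derivable (along A f x) 0 1 ->
  is_derive (0 : R) 1 (along A f x) (rderiv A f x).
Proof. by move=> d; apply: (DeriveDef d); rewrite -derive1E. Qed.

Lemma is_derive_alongM A f g x lf lg :
  is_derive (0 : R) 1 (along A f x) lf -> is_derive (0 : R) 1 (along A g x) lg ->
  is_derive (0 : R) 1 (along A (fun y => f y * g y) x) (lf * g x + f x * lg).
Proof.
move=> df dg; have dM := is_deriveM df dg.
apply: (is_derive_eq (f := along A f x * along A g x) dM).
by rewrite !along0 /GRing.scale/= addrC [g x * _]mulrC.
Qed.

Lemma is_derive_alongD A f g x lf lg :
  is_derive (0 : R) 1 (along A f x) lf -> is_derive (0 : R) 1 (along A g x) lg ->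
  is_derive (0 : R) 1 (along A (fun y => f y + g y) x) (lf + lg).
Proof. by move=> df dg; exact: (is_deriveD df dg). Qed.

(** The difference quotients coincide, so no differentiability has to be assumed. *)
Lemma rderiv_subc A f (c : R) : rderiv A (fun y => f y - c) = rderiv A f.
Proof.
apply/funext => x; rewrite /rderiv /derive1.
have -> : (fun h : R => h^-1 *: (along A (fun y => f y - c) x (h + 0) -
    along A (fun y => f y - c) x 0)) =
  (fun h : R => h^-1 *: (along A f x (h + 0) - along A f x 0)); last by [].
by apply/funext => h; rewrite /along opprB addrA subrK.
Qed.

Lemma foldr_rderiv_subc f (c : R) s : foldr rderiv (fun y => f y - c) s =
  if s is [::] then fun y => f y - c else foldr rderiv f s.
Proof.
elim: s => // A s /= ->; case: s => [|B s] //; exact: rderiv_subc.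
Qed.

Lemma rsmooth_subc f (c : R) : rsmooth f -> rsmooth (fun y => f y - c).
Proof.
move=> sf s ls; rewrite foldr_rderiv_subc; case: s ls => [|A s] ls.
  have [cf df] := sf [::] ls; split => [|A lA x].
    by apply: continuous_addr; [exact: cf|exact: continuous_cst].
  have := @derivableB R R R _ _ 0 1 (df A lA x) (@derivable_cst R R R c 0 1); exact.
exact: sf.
Qed.

Lemma rsmooth_sub f s : rsmooth f -> (forall A, A \in s -> lie G A) ->
  continuous (foldr rderiv f s).
Proof. by move=> sf /sf []. Qed.

End real_derivations.

Section cutoffs.
Context {R : realType} {n : nat} {G Gam : mxgroup R n}.
Local Notation M := 'M[R]_n.+1.
Local Notation X := (quo G Gam).
Hypothesis G_closed : closed_in_GL G.
Hypothesis Gam_sub : mxgroup_set Gam `<=` mxgroup_set G.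
Hypothesis Gam_discrete : \forall g \near (1 : M), mxgroup_set Gam g -> g = 1.

(** E of the overview, with exponent s equal to [growth] plus 1. *)
Definition height (x : X) : R := Theta (fun=> 1) x.

(* Stable under Lie derivatives, and all its members are bounded uniformly in
   [j]. *)
Inductive cutoff_class : (nat -> X -> R) -> Prop :=
| cutoff_cst c : cutoff_class (fun _ _ => c)
| cutoff_ratio Q : tame Q -> cutoff_class (fun _ x => Theta Q x / height x)
| cutoff_bump p : cutoff_class (fun j x => bump p (height x * j.+1%:R))
| cutoffD F H : cutoff_class F -> cutoff_class H ->
    cutoff_class (fun j x => F j x + H j x)
| cutoffM F H : cutoff_class F -> cutoff_class H ->
    cutoff_class (fun j x => F j x * H j x).

Lemma height_gt0 x : 0 < height x.
Proof. exact: Theta1_gt0. Qed.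

Lemma height_continuous : continuous height.
Proof. by apply: Theta_continuous => //; exact: tame_cst. Qed.

Lemma cutoff_bounded F : cutoff_class F ->
  exists2 B : R, 0 <= B & forall j x, `|F j x| <= B.
Proof.
elim=> [c|Q tQ|p|F1 F2 _ [B B0 H] _ [B' B'0 H']|F1 F2 _ [B B0 H] _ [B' B'0 H']].
- by exists `|c|.
- have [B B0 HB] := tame_bounded tQ; exists B => // _ x.
  have h0 := height_gt0 x.
  rewrite normrM normfV (gtr0_norm h0) ler_pdivrMr//.
  exact: Theta_bounded.
- by have [B B0 HB] := bump_bounded p; exists B.
- exists (B + B'); first exact: addr_ge0.
  by move=> j x; apply: le_trans (ler_normD _ _) _; rewrite lerD.
- exists (B * B'); first exact: mulr_ge0.
  by move=> j x; rewrite normrM ler_pM.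
Qed.

Lemma cutoff_continuous F j : cutoff_class F -> continuous (F j).
Proof.
elim=> [c|Q tQ|p|F1 F2 _ H1 _ H2|F1 F2 _ H1 _ H2].
- exact: continuous_cst.
- apply: continuous_divr; [exact: Theta_continuous|exact: height_continuous|].
  by move=> x; rewrite gt_eqF// height_gt0.
- have ch : continuous (fun y => height y * j.+1%:R).
    by apply: continuous_mulr; [exact: height_continuous|exact: continuous_cst].
  by move=> x; apply: (continuous_comp (ch x)); exact: bump_continuous.
- exact: continuous_addr.
- exact: continuous_mulr.
Qed.

(** The numerators [Theta Q'] and [Theta Q1] that appear are always accompanied by a division by
    [height], so only bounded ratios arise. *)
Lemma cutoff_derive F A : cutoff_class F -> lie G A -> exists2 F', cutoff_class F' &
  forall j x, is_derive (0 : R) 1 (along A (F j) x) (F' j x).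
Proof.
move=> cF lA.
have [Q1 tQ1 dQ1] := Theta_derive Gam_discrete (tame_cst 1) lA.
elim: cF => [c|Q tQ|p|F1 F2 _ [F1' c1 d1] _ [F2' c2 d2]|
   F1 F2 cF1 [F1' c1 d1] cF2 [F2' c2 d2]].
- by exists (fun _ _ => 0); [exact: cutoff_cst|move=> j x; exact: is_derive_cst].
- have [Q' tQ' dQ'] := Theta_derive Gam_discrete tQ lA.
  exists (fun _ x => Theta Q' x / height x +
     (-1) * ((Theta Q x / height x) * (Theta Q1 x / height x))).
    apply: cutoffD; first exact: cutoff_ratio.
    apply: cutoffM; first exact: cutoff_cst.
    by apply: cutoffM; exact: cutoff_ratio.
  move=> _ x; have h0 : height x != 0 by rewrite gt_eqF// height_gt0.
  have dV : is_derive (0 : R) 1 (along A (fun y => (height y)^-1) x)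
      (- (height x) ^- 2 * Theta Q1 x).
    have h0' : along A height x 0 != 0 by rewrite along0.
    have [dh vh] : is_derive (0 : R) 1 (along A height x) (Theta Q1 x) := dQ1 x.
    split; first exact: (derivableV h0' dh).
    by have := deriveV h0' dh; rewrite along0 vh.
  have := is_derive_alongM (dQ' x : is_derive _ _ (along A (Theta Q) x) _) dV.
  move/is_derive_eq; apply; field; exact: h0.
(* The inner derivative [Theta Q1 x * j.+1%:R] is t times [Theta Q1 x / height x], with t the
   argument of the bump; [mul_bump] takes up t, so nothing grows with [j]. *)
- exists (fun j x => bump (('X^2 + 'X) * (p - p^`())) (height x * j.+1%:R) *
     (Theta Q1 x / height x)).
    by apply: cutoffM; [exact: cutoff_bump|exact: cutoff_ratio].
  move=> j x; have h0 : height x != 0 by rewrite gt_eqF// height_gt0.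
  have dh : is_derive (0 : R) 1 (along A (fun y => height y * j.+1%:R) x)
     (Theta Q1 x * j.+1%:R + height x * 0).
    have dh0 : is_derive (0 : R) 1 (along A height x) (Theta Q1 x) := dQ1 x.
    have dc : is_derive (0 : R) 1 (along A (fun=> j.+1%:R : R) x) 0.
      exact: is_derive_cst.
    exact: is_derive_alongM dh0 dc.
  have := @is_derive1_comp _ (bump p) _ _ _ _ (is_derive_bump p _) dh.
  move/is_derive_eq; apply; rewrite along0 -mul_bump; field; exact: h0.
- by exists (fun j x => F1' j x + F2' j x);
    [exact: cutoffD|move=> j x; exact: is_derive_alongD].
- exists (fun j x => F1' j x * F2 j x + F1 j x * F2' j x).
    by apply: cutoffD; apply: cutoffM.
  by move=> j x; exact: is_derive_alongM.
Qed.

(** The Leibniz rule leaves on [g] a subword of [s], in the same order since derivations need not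
    commute. The members take [g] and [j] as arguments, so that one formula, hence one bound, serves
    all of them. *)
Inductive leibniz_sum (s : seq M) : ((X -> R) -> nat -> X -> R) -> Prop :=
| leibniz_term w F : subseq w s -> cutoff_class F ->
    leibniz_sum s (fun g j x => foldr rderiv g w x * F j x)
| leibnizD L1 L2 : leibniz_sum s L1 -> leibniz_sum s L2 ->
    leibniz_sum s (fun g j x => L1 g j x + L2 g j x).

Let lie_subseq w s : subseq w s -> (forall A, A \in s -> lie G A) ->
  forall A, A \in w -> lie G A.
Proof. by move=> ws ls A Aw; apply: ls; exact: (mem_subseq ws). Qed.

Lemma leibniz_continuous s L g j : leibniz_sum s L ->
  (forall A, A \in s -> lie G A) -> rsmooth g -> continuous (L g j).
Proof.
move=> cL ls sg; elim: cL => [w F ws cF|L1 L2 _ H1 _ H2].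
  apply: continuous_mulr; last exact: cutoff_continuous.
  exact: (rsmooth_sub sg (lie_subseq ws ls)).
exact: continuous_addr.
Qed.

Lemma leibniz_derive s L A : leibniz_sum s L ->
  (forall A, A \in s -> lie G A) -> lie G A ->
  exists2 L', leibniz_sum (A :: s) L' & forall g, rsmooth g ->
    forall j x, is_derive (0 : R) 1 (along A (L g j) x) (L' g j x).
Proof.
move=> cL ls lA; elim: cL => [w F ws cF|L1 L2 _ [L1' c1 H1] _ [L2' c2 H2]].
  have [F' cF' dF] := cutoff_derive cF lA.
  exists (fun g j x => foldr rderiv g (A :: w) x * F j x + foldr rderiv g w x * F' j x).
    apply: leibnizD; apply: leibniz_term => //.
      by rewrite /= eqxx.
    exact: subseq_trans ws (subseq_cons _ _).
  move=> g sg j x; have [_ dw] := sg w (lie_subseq ws ls).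
  exact: is_derive_alongM (rderiv_is_derive (dw A lA x)) (dF j x).
exists (fun g j x => L1' g j x + L2' g j x); first exact: leibnizD.
by move=> g sg j x; exact: is_derive_alongD (H1 g sg j x) (H2 g sg j x).
Qed.

Lemma foldr_leibniz s F : cutoff_class F -> (forall A, A \in s -> lie G A) ->
  exists2 L, leibniz_sum s L & forall g j, rsmooth g ->
    foldr rderiv (fun x => g x * F j x) s = L g j.
Proof.
move=> cF; elim: s => [|A s IH] ls.
  by eexists; first exact: (leibniz_term (w := [::]) _ cF).
have ls' B : B \in s -> lie G B by move=> Bs; apply: ls; rewrite inE Bs orbT.
have lA : lie G A by apply: ls; rewrite mem_head.
have [L cL HL] := IH ls'; have [L' cL' HL'] := leibniz_derive cL ls' lA.
exists L' => // g j sg /=; rewrite HL//.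
by apply/funext => x; apply: is_derive_rderiv; exact: HL'.
Qed.

Lemma rsmoothM_cutoff F g j : cutoff_class F -> rsmooth g ->
  rsmooth (fun x => g x * F j x).
Proof.
move=> cF sg s ls; have [L cL HL] := foldr_leibniz cF ls.
rewrite HL//; split; first exact: (leibniz_continuous cL).
move=> A lA x; have [L' _ HL'] := leibniz_derive cL ls lA.
by have [] := HL' g sg j x.
Qed.

Lemma leibniz_bound s L : leibniz_sum s L -> exists W (C : R),
  [/\ 0 <= C, forall w, w \in W -> subseq w s & forall g j x,
    `|L g j x| <= C * \sum_(w <- W) `|foldr rderiv g w x|].
Proof.
elim=> [w F ws cF|L1 L2 _ [W1 [C1 [C10 s1 H1]]] _ [W2 [C2 [C20 s2 H2]]]].
  have [B B0 HB] := cutoff_bounded cF; exists [:: w], B; split => //.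
    by move=> w'; rewrite inE => /eqP ->.
  by move=> g j x; rewrite big_seq1 normrM mulrC ler_wpM2r.
exists (W1 ++ W2), (C1 + C2); split; first exact: addr_ge0.
  by move=> w; rewrite mem_cat => /orP[/s1|/s2].
move=> g j x; apply: le_trans (ler_normD _ _) _; rewrite big_cat/=.
apply: le_trans (lerD (H1 g j x) (H2 g j x)) _.
set a := \sum_(_ <- W1) _; set b := \sum_(_ <- W2) _.
have a0 : 0 <= a by exact: sumr_ge0.
have b0 : 0 <= b by exact: sumr_ge0.
by rewrite mulrDl lerD// ler_wpM2l// ?lerDl ?lerDr.
Qed.

Definition cutoff (j : nat) (x : X) : R := bump 1 (height x * j.+1%:R).

Lemma cutoffP : cutoff_class cutoff.
Proof. exact: cutoff_bump. Qed.

(** Where the cutoff is nonzero, [height x] exceeds 1 / (j + 1), and superlevel sets of [height] are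
    closed and compact. *)
Lemma cutoff_support j : compact (closure [set x | cutoff j x != 0]).
Proof.
have d0 : (0 : R) < j.+1%:R^-1 by rewrite invr_gt0.
apply: subclosed_compact (compact_Theta_ge G_closed Gam_sub Gam_discrete d0) _.
  exact: closed_closure.
have cl : closed [set x | j.+1%:R^-1 <= height x].
  apply: (@preimage_closed _ _ height [set t | j.+1%:R^-1 <= t]).
    by apply: in1W; exact: height_continuous.
  exact: closed_ge.
apply: (@subset_trans _ (closure [set x | j.+1%:R^-1 <= height x])); last first.
  by rewrite -((closure_id _).1 cl).
apply: closure_subset => x /=; rewrite /cutoff /bump; case: ifPn => [h1 _|].
  by rewrite -div1r ler_pdivrMr// ltW.
by rewrite eqxx.
Qed.

Lemma cutoff_cvg x : cutoff j x @[j --> \oo] --> (1 : R).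
Proof. by apply: bump1_cvg1; exact: height_gt0. Qed.

Lemma cutoff_ge0 j x : 0 <= cutoff j x.
Proof. exact: bump1_ge0. Qed.

Lemma cutoff_le1 j x : cutoff j x <= 1.
Proof. exact: bump1_le1. Qed.

End cutoffs.

(** * Euclidean balls in Lebesgue measure *)

Section leb_scaling.
Context {R : realType}.
Local Notation RR := (measurableTypeR R).
Local Notation lambda := (@lebesgue_measure R).

Definition mul1 (c : R) (x : RR) : RR := c * x.

Lemma measurable_mul1 c : measurable_fun [set: RR] (mul1 c).
Proof. by apply: measurable_funM; [exact: measurable_cst|exact: measurable_id]. Qed.

Local Notation pushforward_measure :=
  measure_function_pushforward__canonical__measure_function_Measure.

Lemma lebesgue_measure_scale (c : R) (A : set RR) : 0 < c -> measurable A ->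
  lambda (mul1 c @^-1` A) = (c^-1%:E * lambda A)%E.
Proof.
move=> c0 mA; pose k : {nonneg R} := NngNum (ltW c0).
have -> : lambda A = mscale k (pushforward_measure lambda (measurable_mul1 c)) A.
  apply: lebesgue_measure_unique => // _ [[a b] _ <-] /=.
  rewrite /mscale/= /pushforward.
  have -> : mul1 c @^-1` `]a, b] = `]c^-1 * a, c^-1 * b]%classic.
    apply/seteqP; split => x; rewrite /mul1 /= !in_itv/= => /andP[h1 h2]; apply/andP; split.
    - by rewrite ltr_pdivrMl.
    - by rewrite ler_pdivlMl.
    - by rewrite -ltr_pdivrMl.
    - by rewrite -ler_pdivlMl.
  rewrite !lebesgue_measure_itv/= !lte_fin ltr_pM2l ?invr_gt0//.
  case: ifPn => _; last by rewrite mule0.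
  by rewrite -!EFinB -EFinM -mulrBr mulrA divff ?mul1r// gt_eqF.
rewrite /mscale/= /pushforward muleA -EFinM mulVf ?gt_eqF// mul1e//.
Qed.

Definition tscale d (c : R) (t : d.-tuple RR) : d.-tuple RR :=
  map_tuple (mul1 c) t.

Lemma measurable_tscale d c : measurable_fun [set: d.-tuple RR] (tscale (d := d) c).
Proof.
apply/measurable_fun_tnthP => i.
rewrite (_ : _ \o _ = mul1 c \o (fun t => tnth t i)); last first.
  by apply/funext => t /=; rewrite tnth_map.
by apply: measurableT_comp; [exact: measurable_mul1|exact: measurable_tnth].
Qed.

Lemma lebS d (A : set (d.+1.-tuple RR)) :
  leb d.+1 A = (\int[lambda]_x leb d (xsection (@tcons R d @^-1` A) x))%E.
Proof. by []. Qed.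

Lemma measurable_tcons_preimage d (A : set (d.+1.-tuple RR)) : measurable A ->
  measurable (@tcons R d @^-1` A).
Proof.
by move=> mA; rewrite -[X in measurable X]setTI; exact: measurable_tcons.
Qed.

(** Induction on the dimension: the section at [x] of the preimage is the preimage of the section at
    [c * x], and the one-dimensional case changes variables in [x]. *)
Lemma leb_scale d (c : R) (A : set (d.-tuple RR)) : 0 < c -> measurable A ->
  leb d (tscale c @^-1` A) = ((c^-1 ^+ d)%:E * leb d A)%E.
Proof.
move=> c0; have ci0 : 0 <= c^-1 by rewrite invr_ge0 ltW.
elim: d A => [|d IH] A mA.
  by rewrite expr0 mul1e (_ : tscale c @^-1` A = A)//;
    apply/seteqP; split => t /=; rewrite (tuple0 (tscale c t)) (tuple0 t).
have mA' := measurable_tcons_preimage mA.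
pose g x := leb d (xsection (@tcons R d @^-1` A) x).
have mg : measurable_fun [set: RR] g by exact: measurable_fun_xsection.
have g0 x : (0 <= g x)%E by exact: measure_ge0.
rewrite !lebS -/g.
under eq_integral => x _.
  rewrite (_ : xsection _ x = tscale c @^-1` xsection (@tcons R d @^-1` A) (mul1 c x)); last first.
    apply/seteqP; split => t; rewrite /xsection /= !inE/= /tscale;
      by rewrite (_ : map_tuple (mul1 c) (tcons (x, t)) = tcons (mul1 c x, map_tuple (mul1 c) t))//; exact: val_inj.
  rewrite IH; last exact: measurable_xsection.
  over.
rewrite /= ge0_integralZl//; last 2 first.
- exact: (measurableT_comp mg (measurable_mul1 c)).
- by rewrite lee_fin exprn_ge0.
have -> : (\int[lambda]_x g (mul1 c x) = \int[pushforward lambda (mul1 c)]_x g x)%E.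
  by rewrite ge0_integral_pushforward//; exact: measurable_mul1.
pose k : {nonneg R} := NngNum ci0.
have -> : (\int[pushforward lambda (mul1 c)]_x g x = \int[mscale k lambda]_x g x)%E.
  apply: (@eq_measure_integral _ _ _ _ (mscale k lambda)
    (pushforward_measure lambda (measurable_mul1 c))) => B mB _.
  by rewrite /mscale /= /pushforward lebesgue_measure_scale.
by rewrite ge0_integral_mscale// /= muleA -EFinM -exprSr.
Qed.

Lemma row_of_tscale d c (t : d.-tuple RR) :
  row_of_tuple (tscale c t) = c *: row_of_tuple t.
Proof. by apply/rowP => i; rewrite !mxE tnth_map. Qed.

Lemma enormZ d c (v : 'rV[R]_d) : 0 <= c -> enorm (c *: v) = c * enorm v.
Proof.
move=> c0; rewrite /enorm; under eq_bigr do rewrite mxE exprMn.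
by rewrite -mulr_sumr sqrtrM ?sqr_ge0// sqrtr_sqr ger0_norm.
Qed.

Lemma enorm_ge0 d (v : 'rV[R]_d) : 0 <= enorm v.
Proof. exact: sqrtr_ge0. Qed.

Lemma measurable_enorm d :
  measurable_fun [set: d.-tuple RR] (fun t => enorm (row_of_tuple t)).
Proof.
apply: (@measurableT_comp _ _ _ _ _ _ (@Num.sqrt R)).
  by apply: continuous_measurable_fun; exact: sqrt_continuous.
under eq_fun do under eq_bigr do rewrite mxE.
apply: measurable_sum => i; apply: measurable_funX; exact: measurable_tnth.
Qed.

Lemma measurable_eball d s : measurable (eball d s : set (d.-tuple RR)).
Proof.
rewrite (_ : eball d s = setT `&`
  (fun t : d.-tuple RR => enorm (row_of_tuple t)) @^-1` [set x | x <= s]).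
  by apply: measurable_enorm => //; rewrite -set_itvNyc; exact: measurable_itv.
by rewrite setTI.
Qed.

Lemma eball_scale d c s : 0 < c ->
  tscale c @^-1` eball d (c * s) = eball d s.
Proof.
move=> c0; have c0' := ltW c0.
by apply/seteqP; split => t; rewrite /eball /= row_of_tscale enormZ// ler_pM2l.
Qed.

Definition tbox d (c : R) : set (d.-tuple RR) :=
  [set t | forall i, `|tnth t i| <= c].

Arguments tbox d c : clear implicits.

Lemma measurable_tbox d c : measurable (tbox d c).
Proof.
rewrite (_ : tbox d c = \bigcap_(i in [set: 'I_d])
    ((fun t : d.-tuple RR => tnth t i) @^-1` [set` `[- c, c]])).
  apply: fin_bigcap_measurable; first exact: finite_finset.
  move=> i _; rewrite -[X in measurable X]setTI.
  by apply: measurable_tnth => //; exact: measurable_itv.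
apply/seteqP; split => t /= H i; first by move=> _; rewrite /= in_itv/= -ler_norml.
by have := H i I; rewrite /= in_itv/= -ler_norml.
Qed.

Lemma leb_tbox d c : 0 < c -> leb d (tbox d c) = ((2 * c) ^+ d)%:E.
Proof.
move=> c0; elim: d => [|d IH].
  by rewrite expr0 /= diracE mem_set// => -[].
rewrite /= /leb_step /pushforward.
rewrite (_ : _ @^-1` _ = [set` `[- c, c]] `*` tbox d c).
  rewrite product_measure1E//; last first.
    exact: measurable_tbox.
  have lam : lambda `[- c, c]%classic = (2 * c)%:E.
    rewrite lebesgue_measure_itv/= lte_fin ifT; last by lra.
    by rewrite -EFinB; congr (_%:E); ring.
  rewrite IH; transitivity ((2 * c)%:E * ((2 * c) ^+ d)%:E)%E.
    by congr (_ * _)%E; exact: lam.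
  by rewrite -EFinM exprS.
apply/seteqP; split => -[x t] /=; rewrite in_itv/= -ler_norml.
  move=> H; split; first by have := H ord0; rewrite (tnth_nth 0).
  by move=> i; have := H (lift ord0 i); rewrite !(tnth_nth 0).
move=> [xc H] i; rewrite (tnth_nth 0) /=.
case: i => -[|i] //= id; have := H (Ordinal (id : (i < d)%N)).
by rewrite (tnth_nth 0).
Qed.

Definition ball_volume d : R := fine (leb d (eball d 1)).

(** Comparison with two cubes yields that the unit ball has positive and finite volume. *)
Lemma tbox_sub_eball d : (0 < d)%N ->
  tbox d d%:R^-1 `<=` eball d 1 /\ eball d 1 `<=` tbox d 1.
Proof.
move=> d0; have d0R : (0 : R) < d%:R by rewrite ltr0n.
have row0 (t : d.-tuple RR) : row_of_tuple t = \row_i tnth t i by [].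
split => t /= H.
  rewrite /eball/= /enorm -sqrtr1 ler_sqrt//.
  apply: (@le_trans _ _ (\sum_(i < d) d%:R^-1)).
    apply: ler_sum => i _; rewrite mxE -real_normK ?num_real// expr2.
    have d1 : (d%:R^-1 : R) <= 1 by rewrite invf_le1// ler1n.
    by rewrite -[leRHS]mulr1; apply: ler_pM => //; exact: le_trans d1.
  by rewrite sumr_const card_ord -[leLHS]mulr_natr mulVf ?gt_eqF.
move=> i; move: H; rewrite /eball/= /enorm -{1}sqrtr1 ler_sqrt// => H.
rewrite -(@ler_pXn2r _ 2)// ?nnegrE// expr1n real_normK ?num_real//.
apply: le_trans H; rewrite (bigD1 i)//= mxE lerDl.
by apply: sumr_ge0 => j _; exact: sqr_ge0.
Qed.

Lemma leb_eball1_lty d : (0 < d)%N -> (leb d (eball d (1 : R)) < +oo)%E.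
Proof.
move=> d0; have [_ sub] := tbox_sub_eball d0.
apply: (@le_lt_trans _ _ (leb d (tbox d 1))); last first.
  by rewrite leb_tbox// ltry.
by apply: le_measure sub; rewrite inE; [exact: measurable_eball|exact: measurable_tbox].
Qed.

Lemma ball_volumeE d : (0 < d)%N -> leb d (eball d (1 : R)) = (ball_volume d)%:E.
Proof.
by move=> d0; rewrite /ball_volume fineK// ge0_fin_numE// leb_eball1_lty.
Qed.

Lemma ball_volume_gt0 d : (0 < d)%N -> 0 < ball_volume d.
Proof.
move=> d0; rewrite -lte_fin -ball_volumeE//; have [sub _] := tbox_sub_eball d0.
apply: (@lt_le_trans _ _ (leb d (tbox d d%:R^-1))).
  by rewrite leb_tbox ?invr_gt0 ?ltr0n// lte_fin exprn_gt0// mulr_gt0// invr_gt0 ltr0n.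
by apply: le_measure sub; rewrite inE; [exact: measurable_tbox|exact: measurable_eball].
Qed.

Lemma leb_eball d s : (0 < d)%N -> 0 < s ->
  leb d (eball d s) = (s ^+ d * ball_volume d)%:E.
Proof.
move=> d0 s0; have si0 : 0 < s^-1 by rewrite invr_gt0.
have := leb_scale si0 (@measurable_eball d 1).
have sn0 : s != 0 by rewrite gt_eqF.
rewrite -{1}(mulVf sn0) eball_scale// invrK => ->.
by rewrite ball_volumeE.
Qed.

Lemma Rintegral_eball_scale d c s (f : d.-tuple RR -> R) :
  0 < c -> measurable_fun [set: d.-tuple RR] f ->
  (leb d).-integrable (eball d s) (EFin \o (f \o tscale c)) ->
  (leb d).-integrable (eball d (c * s)) (EFin \o f) ->
  \int[leb d]_(t in eball d s) f (tscale c t) =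
  c^-1 ^+ d * \int[leb d]_(t in eball d (c * s)) f t.
Proof.
move=> c0 mf intf intf2; have ci0 : 0 <= c^-1 ^+ d by rewrite exprn_ge0// invr_ge0 ltW.
pose k : {nonneg R} := NngNum ci0.
have mf' : measurable_fun [set: d.-tuple RR] (EFin \o f) by apply/measurable_EFinP.
have H := integral_pushforward (measurable_tscale (d := d) c) mf' (mu := leb d)
  (D := eball d (c * s)).
rewrite eball_scale// in H; have {}H := H intf (@measurable_eball _ _).
rewrite /Rintegral -[in LHS]/(fine (\int[leb d]_(t in eball d s) ((EFin \o f) \o tscale c) t)%E) -H.
have -> : (\int[pushforward (leb d) (tscale c)]_(y in eball d (c * s)) (EFin \o f) y =
   \int[mscale k (leb d)]_(y in eball d (c * s)) (EFin \o f) y)%E.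
  apply: (@eq_measure_integral _ _ _ _ (mscale k (leb d))
    (pushforward_measure (leb d) (measurable_tscale c))) => B mB _.
  by rewrite /mscale /= /pushforward leb_scale.
rewrite [X in fine X]integralE [X in _ * fine X]integralE.
have mfD : measurable_fun (eball d (c * s)) (EFin \o f).
  exact: measurable_funTS.
rewrite !ge0_integral_mscale//; [|exact: measurable_eball|exact: measurable_funeneg|
  exact: measurable_eball|exact: measurable_funepos].
have fp := integrable_pos_fin_num (@measurable_eball _ _) intf2.
have fn := integrable_neg_fin_num (@measurable_eball _ _) intf2.
by rewrite -(fineK fp) -(fineK fn) -!EFinM -!EFinB /= mulrBr.
Qed.

End leb_scaling.

(** * Layer-cake estimate on a set of finite measure *)

Section bounded_integrals.
Context d (T : measurableType d) (R : realType).
Variable mu : {measure set T -> \bar R}.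
Variable D : set T.
Hypothesis mD : measurable D.
Hypothesis muD : (mu D < +oo)%E.
Implicit Types f W psi : T -> R.

Lemma integrable_bounded f B : measurable_fun D f ->
  (forall x, D x -> `|f x| <= B) -> mu.-integrable D (EFin \o f).
Proof.
move=> mf fB; apply: measurable_bounded_integrable => //.
exists B; split; first exact: num_real.
by move=> M BM x Dx; apply: le_trans (fB x Dx) (ltW BM).
Qed.

Lemma Rintegral_le_bound f B : measurable_fun D f ->
  (forall x, D x -> `|f x| <= B) ->
  `|\int[mu]_(x in D) f x| <= B * fine (mu D).
Proof.
move=> mf fB; have fi := integrable_bounded mf fB.
apply: le_trans (le_normr_Rintegral mD fi) _.
rewrite -Rintegral_cst//; apply: le_Rintegral => //.
  exact: (integrable_abse fi).
apply: (@integrable_bounded (fun=> B) `|B|) => // x _.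
Qed.

Lemma Rintegral_sum (I : Type) (r : seq I) (F : I -> T -> R) :
  (forall i, mu.-integrable D (EFin \o F i)) ->
  \int[mu]_(x in D) (\sum_(i <- r) F i x) = \sum_(i <- r) \int[mu]_(x in D) F i x.
Proof.
move=> iF; have isum s : mu.-integrable D (EFin \o (fun x => \sum_(i <- s) F i x)).
  elim: s => [|i s IH].
    rewrite (_ : _ \o _ = fun=> 0%E); first exact: integrable0.
    by apply/funext => x /=; rewrite big_nil.
  rewrite (_ : _ \o _ = ((EFin \o F i) \+ (EFin \o (fun x => \sum_(i <- s) F i x)%R))%E).
    exact: integrableD.
  by apply/funext => x /=; rewrite big_cons EFinD.
elim: r => [|i r IH].
  rewrite big_nil; transitivity (\int[mu]_(x in D) (0 : R)).
    by apply: eq_Rintegral => x _; rewrite big_nil.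
  by rewrite Rintegral_cst// mul0r.
rewrite big_cons -IH -RintegralD//.
by apply: eq_Rintegral => x _; rewrite big_cons.
Qed.

Lemma count_levels (x : R) N : 0 <= x -> x <= N%:R ->
  \sum_(i < N) (if (i.+1%:R <= x) then 1 else 0) = (Num.truncn x)%:R :> R.
Proof.
move=> x0 xN; have tN : (Num.truncn x <= N)%N.
  by rewrite -(ler_nat R); apply: le_trans xN; rewrite truncn_le.
transitivity (\sum_(0 <= i < N) (if (i < Num.truncn x)%N then 1 else 0) : R).
  rewrite big_mkord; apply: eq_bigr => i _; congr (if _ then _ else _).
  apply/idP/idP => [ix|ix].
    by have := le_truncn ix; rewrite natrK.
  by apply: (@le_trans _ _ (Num.truncn x)%:R); rewrite ?ler_nat// truncn_le.
rewrite (@big_cat_nat _ _ _ (Num.truncn x))//= big_nat_cond (eq_bigr (fun=> 1)); last first.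
  by move=> i /andP[/andP[_ ->]].
rewrite -big_nat_cond [X in _ + X]big_nat_cond [X in _ + X]big1 ?addr0.
  by rewrite big_const_nat subn0 iter_addr_0.
by move=> i /andP[/andP[ti _] _]; rewrite ltnNge ti.
Qed.

(** [W] is replaced by a staircase with N + 1 steps of height [h], for which the estimate is a
    finite sum of bounds on superlevel sets. The replacement costs at most [h * B] pointwise, and N
    is arbitrary. *)
Lemma layer_cake W psi (L e B : R) : 0 < L -> 0 <= B ->
  measurable_fun D W -> measurable_fun D psi ->
  (forall x, D x -> 0 <= W x <= L) -> (forall x, D x -> `|psi x| <= B) ->
  (forall y, 0 < y -> `|\int[mu]_(x in D `&` [set x | y <= W x]) psi x| <= e) ->
  `|\int[mu]_(x in D) (W x * psi x)| <= L * e.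
Proof.
move=> L0 B0 mW mpsi WL psiB He.
have mlev y : measurable (D `&` [set x | y <= W x]).
  rewrite (_ : [set x | y <= W x] = W @^-1` [set t | y <= t])//.
  by apply: mW => //; rewrite -set_itvcy; exact: measurable_itv.
suff H N : `|\int[mu]_(x in D) (W x * psi x)| <=
    L * e + L * B * fine (mu D) / N.+1%:R.
  apply/ler_addgt0Pr => t t0; set A := L * B * fine (mu D).
  have A0 : 0 <= A by rewrite /A !mulr_ge0// ?(ltW L0)// fine_ge0.
  apply: le_trans (H (Num.truncn (A / t))) _; rewrite lerD2l -/A.
  rewrite ler_pdivrMr// mulrC -ler_pdivrMr//.
  have : 0 <= A / t by rewrite divr_ge0// ltW.
  by move=> /truncn_itv /andP[_ /ltW].
pose h : R := L / N.+1%:R; have h0 : 0 < h by rewrite divr_gt0.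
pose lev i x : R := if i.+1%:R * h <= W x then 1 else 0.
pose WN x := h * \sum_(i < N.+1) lev i x.
have WNE x : D x -> WN x = h * (Num.truncn (W x / h))%:R.
  move=> Dx; have /andP[W0 W1] := WL x Dx; rewrite /WN; congr (_ * _).
  rewrite -(@count_levels _ N.+1).
  - by apply: eq_bigr => i _; rewrite /lev ler_pdivlMr.
  - by rewrite divr_ge0// ltW.
  - by rewrite ler_pdivrMr// /h mulrCA divff ?mulr1.
have WNle x : D x -> `|W x - WN x| <= h.
  move=> Dx; have /andP[W0 W1] := WL x Dx; rewrite WNE//.
  have /truncn_itv/andP[] : 0 <= W x / h by rewrite divr_ge0// ltW.
  rewrite ler_pdivlMr// ltr_pdivrMr// -natr1 mulrDl mul1r => t1 t2.
  by rewrite ger0_norm; lra.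
have levE i : [set x | i.+1%:R * h <= W x] = W @^-1` [set t | i.+1%:R * h <= t] by [].
have mlevf i : measurable_fun D (lev i).
  apply: (@measurable_fun_if _ _ _ _ _ _ _ _ (fun x => i.+1%:R * h <= W x)) => //.
  by apply: measurable_fun_ler.
have mterm i : measurable_fun D (fun x => lev i x * psi x) by exact: measurable_funM.
have lev1 i x : `|lev i x| <= 1 by rewrite /lev; case: ifP; rewrite ?normr1 ?normr0.
have iterm i : mu.-integrable D (EFin \o (fun x => lev i x * psi x)).
  apply: (integrable_bounded (B := B)) => // x Dx.
  by rewrite normrM -[leRHS]mul1r ler_pM// psiB.
have termE i : \int[mu]_(x in D) (lev i x * psi x) =
    \int[mu]_(x in D `&` [set x | i.+1%:R * h <= W x]) psi x.
  rewrite Rintegral_mkcondr; apply: eq_Rintegral => x _.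
  rewrite /lev patchE; case: ifPn => [H|H]; last by rewrite mul0r memNset//; exact/negP.
  by rewrite mul1r mem_set.
have mWN : measurable_fun D WN.
  by apply: measurable_funM => //; apply: measurable_sum => i; exact: mlevf.
have mrest : measurable_fun D (fun x => (W x - WN x) * psi x).
  by apply: measurable_funM => //; exact: measurable_funB.
have restB x : D x -> `|(W x - WN x) * psi x| <= h * B.
  by move=> Dx; rewrite normrM ler_pM ?WNle ?psiB.
have irest := integrable_bounded mrest restB.
have isum : mu.-integrable D (EFin \o (fun x => WN x * psi x)).
  apply: (integrable_bounded (B := h * N.+1%:R * B)); first exact: measurable_funM.
  move=> x Dx; rewrite normrM ler_pM ?psiB// normrM (gtr0_norm h0) ler_wpM2l ?(ltW h0)//.
  apply: le_trans (ler_norm_sum _ _ _) _.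
  apply: (@le_trans _ _ (\sum_(i < N.+1) 1)); first exact: ler_sum.
  by rewrite sumr_const card_ord.
have -> : \int[mu]_(x in D) (W x * psi x) =
  \int[mu]_(x in D) (WN x * psi x) + \int[mu]_(x in D) ((W x - WN x) * psi x).
  rewrite -RintegralD//; apply: eq_Rintegral => x _; ring.
have -> : \int[mu]_(x in D) (WN x * psi x) =
    h * \sum_(i < N.+1) \int[mu]_(x in D `&` [set x | i.+1%:R * h <= W x]) psi x.
  under [in RHS]eq_bigr do rewrite -termE.
  rewrite -Rintegral_sum// -RintegralZl//.
    apply: eq_Rintegral => x _; rewrite /WN -mulrA mulr_suml //.
  apply: (integrable_bounded (B := N.+1%:R * B)).
    by apply: measurable_sum => i; exact: mterm.
  move=> x Dx; apply: le_trans (ler_norm_sum _ _ _) _.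
  apply: (@le_trans _ _ (\sum_(i < N.+1) B)).
    by apply: ler_sum => i _; rewrite normrM -[leRHS]mul1r ler_pM// psiB.
  by rewrite sumr_const card_ord mulr_natl.
apply: le_trans (ler_normD _ _) _; apply: lerD.
  rewrite normrM (gtr0_norm h0); apply: (@le_trans _ _ (h * \sum_(i < N.+1) e)).
    rewrite ler_wpM2l ?(ltW h0)//; apply: le_trans (ler_norm_sum _ _ _) _.
    by apply: ler_sum => i _; apply: He; rewrite mulr_gt0.
  by rewrite sumr_const card_ord -[e *+ _]mulr_natl mulrA /h divfK ?pnatr_eq0.
apply: le_trans (Rintegral_le_bound mrest restB) _.
by rewrite [leRHS](_ : _ = h * B * fine (mu D))// /h; ring.
Qed.

End bounded_integrals.

(** * Rescaled integrals over the superlevel sets of 1 - |v|^2 *)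

Section radial_weights.
Context {R : realType} (d : nat).
Hypothesis d_gt0 : (0 < d)%N.
Local Notation T := (d.-tuple (measurableTypeR R)).
Local Notation D := (eball d (1 : R)).
Local Notation V := (@ball_volume R d).

Definition defect (t : T) : R := 1 - enorm (row_of_tuple t) ^+ 2.

Let mD : measurable D := @measurable_eball R d 1.
Let Dfin : (leb d D < +oo)%E := @leb_eball1_lty R d d_gt0.

Lemma measurable_defect : measurable_fun [set: T] defect.
Proof.
apply: measurable_funB; first exact: measurable_cst.
by apply: measurable_funX; exact: measurable_enorm.
Qed.

Lemma defect_ge0 (t : T) : D t -> 0 <= defect t.
Proof.
rewrite /eball /defect /= => t1; rewrite subr_ge0 expr_le1//; exact: enorm_ge0.
Qed.

Lemma defect_le1 (t : T) : defect t <= 1.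
Proof. by rewrite /defect gerBl sqr_ge0. Qed.

Lemma defect_level c : 0 <= c -> c <= 1 ->
  D `&` [set t | c <= defect t] = eball d (Num.sqrt (1 - c)).
Proof.
move=> c0 c1; apply/seteqP; rewrite /eball /defect; split => t /=.
  move=> [_ ct]; rewrite -[leLHS]ger0_norm ?enorm_ge0// -sqrtr_sqr.
  by rewrite ler_wsqrtr//; lra.
move=> tc; have e0 := enorm_ge0 (row_of_tuple t).
have e2 : enorm (row_of_tuple t) ^+ 2 <= 1 - c.
  rewrite -[leRHS]sqr_sqrtr ?subr_ge0// lerXn2r// nnegrE//; exact: sqrtr_ge0.
split; last by lra.
by rewrite -(@ler_pXn2r _ 2)// ?nnegrE// expr1n; lra.
Qed.

Lemma leb_eball_lty s : (leb d (eball d (s : R)) < +oo)%E.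
Proof.
have m0 : 0 < Num.max 1 s by rewrite lt_max ltr01.
apply: (@le_lt_trans _ _ (leb d (eball d (Num.max 1 s)))).
  apply: le_measure; rewrite ?inE; [exact: measurable_eball..|].
  by move=> t; rewrite /eball /= => /le_trans; apply; rewrite le_max lexx orbT.
by rewrite leb_eball// ltry.
Qed.

Section scaled.
Variables (phi : T -> R) (B C R0 g : R).
Hypothesis mphi : measurable_fun [set: T] phi.
Hypothesis phiB : forall t, `|phi t| <= B.
Hypothesis C0 : 0 <= C.
Hypothesis R01 : 1 <= R0.
Hypothesis g1 : g <= 1.
Hypothesis phi_mean : forall rad, R0 < rad ->
  `|\int[leb d]_(t in eball d rad) phi t| <= C * rad ^+ d * rad `^ (- g).

Let B0 : 0 <= B.
Proof. exact: le_trans (phiB (nseq_tuple d 0)). Qed.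

Let R00 : 0 < R0.
Proof. exact: lt_le_trans ltr01 R01. Qed.

Let mphis c : measurable_fun [set: T] (phi \o tscale c).
Proof. by apply: measurableT_comp => //; exact: measurable_tscale. Qed.

(** If [rad * s] exceeds [R0], rescaling the hypothesis gives C s^(d - g) rad^(-g), and s^(d - g) <=
    1 because g <= 1 <= d. Otherwise s <= R0 / rad, and the volume of the ball is at most V R0 /
    rad, which is within V R0 rad^(-g), again because g <= 1. *)
Lemma scaled_ball_bound rad s : R0 < rad -> 0 <= s -> s <= 1 ->
  `|\int[leb d]_(t in eball d s) phi (tscale rad t)| <=
    (C + B * V * R0) * rad `^ (- g).
Proof.
move=> Rr s0 s1; have r1 : 1 < rad by exact: le_lt_trans Rr.
have R0p := R00.
have r0 : 0 < rad by lra.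
have V0 : 0 < V by exact: ball_volume_gt0.
have rg0 : 0 <= rad `^ (- g) by exact: powR_ge0.
rewrite mulrDl; have [small|big] := leP (rad * s) R0.
  apply: le_trans (Rintegral_le_bound (@measurable_eball R d s) (leb_eball_lty s)
    (measurable_funTS (mphis rad)) (fun t _ => phiB _)) _.
  apply: ler_wpDl; first by rewrite mulr_ge0.
  rewrite -!mulrA ler_wpM2l//.
  have q0 : 0 < R0 / rad by rewrite divr_gt0//; lra.
  have sq : s <= R0 / rad by rewrite ler_pdivlMr// mulrC.
  have q1 : R0 / rad <= 1 by rewrite ler_pdivrMr// mul1r ltW.
  apply: (@le_trans _ _ ((R0 / rad) ^+ d * V)).
    rewrite -lee_fin -leb_eball// fineK ?ge0_fin_numE ?leb_eball_lty//.
    apply: le_measure; rewrite ?inE; [exact: measurable_eball..|].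
    by move=> t; rewrite /eball /= => /le_trans; apply.
  rewrite mulrC ler_wpM2l ?(ltW V0)//.
  apply: (@le_trans _ _ (R0 / rad)).
    by rewrite -[leRHS]expr1; apply: ler_wiXn2l; rewrite ?(ltW q0).
  rewrite ler_wpM2l//; first by lra.
  by rewrite -powR_inv1 ?(ltW r0)// ler_powR ?(ltW r1)// lerN2.
have sp : 0 < s.
  rewrite lt_neqAle s0 andbT; apply/negP => /eqP s00.
  by move: big; rewrite -s00 mulr0; lra.
rewrite (@Rintegral_eball_scale _ d rad s phi)//; last 2 first.
- apply: (@integrable_bounded _ _ _ (leb d) _ (@measurable_eball R d s) (leb_eball_lty s) _ B) => //.
    by apply: measurable_funTS; exact: mphis.
  by move=> t _; exact: phiB.
- by apply: (@integrable_bounded _ _ _ (leb d) _ (@measurable_eball R d _) (leb_eball_lty _) _ B) => //;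
    exact: measurable_funTS.
rewrite normrM ger0_norm ?exprn_ge0 ?invr_ge0 ?(ltW r0)//.
apply: (@le_trans _ _ (rad^-1 ^+ d * (C * (rad * s) ^+ d * (rad * s) `^ (- g)))).
  by rewrite ler_wpM2l ?phi_mean// exprn_ge0// invr_ge0 ltW.
apply: (@le_trans _ _ (C * rad `^ (- g))); last first.
  by rewrite lerDl mulr_ge0// !mulr_ge0// ?(ltW V0)//; lra.
rewrite powRM ?(ltW r0)// exprMn exprVn.
have rd : rad ^+ d != 0 by rewrite expf_neq0// gt_eqF.
rewrite [leLHS](_ : _ = C * rad `^ (- g) * (s ^+ d * s `^ (- g))); last first.
  by move: rd; set a := rad ^+ d => a0; field.
rewrite -[leRHS]mulr1 ler_wpM2l ?mulr_ge0// powRN ler_pdivrMr ?powR_gt0// mul1r.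
apply: (@le_trans _ _ s).
  by rewrite -[leRHS]expr1; apply: ler_wiXn2l.
by rewrite -{1}(powRr1 s0) ger_powR// sp.
Qed.

(** Allowing every real [c] includes the empty set and the whole ball, which occur below as the
    levels 2 and 0. *)
Lemma scaled_level_bound rad c : R0 < rad ->
  `|\int[leb d]_(t in D `&` [set t | c <= defect t]) phi (tscale rad t)| <=
    (C + B * V * R0) * rad `^ (- g).
Proof.
move=> Rr; have R0p := R00; have [c1|c1] := ltP 1 c.
  rewrite (_ : D `&` _ = set0).
    rewrite Rintegral_set0 normr0 mulr_ge0 ?powR_ge0// addr_ge0// !mulr_ge0//.
      by rewrite ltW// ball_volume_gt0.
    by lra.
  apply/seteqP; split => t //= [_ ct].
  by have := defect_le1 t; lra.
have [c0|c0] := leP 0 c.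
  rewrite defect_level//; apply: scaled_ball_bound => //.
  by rewrite -[leRHS]sqrtr1 ler_wsqrtr//; lra.
rewrite (_ : D `&` _ = D); first exact: scaled_ball_bound.
apply/seteqP; split => t; first by case.
by move=> Dt; split => //=; have := defect_ge0 Dt; lra.
Qed.

End scaled.
End radial_weights.

(** * Bochner-Riesz weights *)

Section bochner_riesz_weights.
Context {R : realType} (d : nat).
Hypothesis d_gt0 : (0 < d)%N.
Local Notation T := (d.-tuple (measurableTypeR R)).
Local Notation D := (eball d (1 : R)).
Local Notation V := (@ball_volume R d).
Local Notation weight := (@bochner_riesz_weight R d).
Local Notation defect := (@defect R d).

Let mD : measurable D := @measurable_eball R d 1.
Let Dfin : (leb d D < +oo)%E := @leb_eball1_lty R d d_gt0.
Let V0 : 0 < V := @ball_volume_gt0 R d d_gt0.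

Lemma weightE alpha (t : T) : D t -> weight alpha t = defect t `^ alpha.
Proof. by move=> Dt; rewrite /bochner_riesz_weight max_r//; exact: defect_ge0. Qed.

Lemma weight_ge0 alpha (t : T) : 0 <= weight alpha t.
Proof. exact: powR_ge0. Qed.

Lemma measurable_weight alpha : measurable_fun [set: T] (weight alpha).
Proof.
apply: (@measurableT_comp _ _ _ _ _ _ (@powR R ^~ alpha)); first exact: measurable_powR.
apply: measurable_maxr; first exact: measurable_cst.
exact: measurable_defect.
Qed.

Lemma measurable_shell c : measurable (D `&` [set t | defect t < c]).
Proof.
rewrite (_ : [set t | _] = defect @^-1` [set x | x < c])//.
apply: measurableI => //; rewrite -[X in measurable X]setTI.
by apply: measurable_defect => //; rewrite -set_itvNyo; exact: measurable_itv.
Qed.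

Lemma measurable_level c : measurable (D `&` [set t | c <= defect t]).
Proof.
rewrite (_ : [set t | _] = defect @^-1` [set x | c <= x])//.
apply: measurableI => //; rewrite -[X in measurable X]setTI.
by apply: measurable_defect => //; rewrite -set_itvcy; exact: measurable_itv.
Qed.

Lemma bernoulli_inequality (x : R) k : 0 <= x -> x <= 1 -> 1 - k%:R * x <= (1 - x) ^+ k.
Proof.
move=> x0 x1; elim: k => [|k IH]; first by rewrite mul0r subr0 expr0.
rewrite exprS -natr1; have k0 : 0 <= k%:R :> R by [].
have : (1 - x) * (1 - k%:R * x) <= (1 - x) * (1 - x) ^+ k.
  by rewrite ler_wpM2l// subr_ge0.
apply: le_trans; nra.
Qed.

(** The complement is a ball of radius sqrt(1 - c) >= 1 - c, whose volume is at least V (1 - d c) by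
    the Bernoulli inequality. *)
Lemma leb_shell_le c : 0 < c -> c < 1 ->
  (leb d (D `&` [set t | (defect t < c)%R]) <= (V * d%:R * c)%:E)%E.
Proof.
move=> c0 c1; have s0 : 0 < Num.sqrt (1 - c) by rewrite sqrtr_gt0; lra.
have mS := @measurable_eball R d (Num.sqrt (1 - c)).
have E : D = eball d (Num.sqrt (1 - c)) `|` (D `&` [set t | (defect t < c)%R]).
  rewrite -defect_level ?(ltW c0) ?(ltW c1)// -setIUr.
  rewrite (_ : _ `|` _ = setT) ?setIT//; apply/seteqP; split => // t _ /=.
  by case: (leP c (defect t)); [left|right].
have : leb d D = (leb d (eball d (Num.sqrt (1 - c))) +
    leb d (D `&` [set t | (defect t < c)%R]))%E.
  rewrite {1}E measureU//; first exact: measurable_shell.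
  rewrite -defect_level ?(ltW c0) ?(ltW c1)//; apply/seteqP; split => // t /= [[_ h1] [_ h2]].
  by move: h1; rewrite leNgt h2.
rewrite ball_volumeE// leb_eball//.
have fs : (leb d (D `&` [set t | (defect t < c)%R]) \is a fin_num)%E.
  rewrite ge0_fin_numE//; apply: le_lt_trans Dfin; apply: le_measure; rewrite ?inE//.
  exact: measurable_shell.
rewrite -(fineK fs) -EFinD lee_fin => -[VE].
have /= sq : 1 - c <= Num.sqrt (1 - c).
  rewrite -[leLHS]sqr_sqrtr; last by lra.
  rewrite expr2 ler_piMl ?sqrtr_ge0//.
  by rewrite -[leRHS]sqrtr1 ler_wsqrtr//; lra.
have := bernoulli_inequality d (ltW c0) (ltW c1).
have : (1 - c) ^+ d <= Num.sqrt (1 - c) ^+ d by rewrite lerXn2r// nnegrE; lra.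
by set y := _ ^+ d; set z := _ ^+ d in VE *; have := V0; nra.
Qed.

Lemma powR_neg_anti (x y b : R) : b < 0 -> 0 < x -> x <= y -> y `^ b <= x `^ b.
Proof.
move=> b0 x0 xy; have y0 : 0 < y by exact: lt_le_trans xy.
rewrite -[b]opprK !(powRN _ (- b)) lef_pV2 ?posrE ?powR_gt0//.
by rewrite ge0_ler_powR ?nnegrE ?(ltW x0) ?(ltW y0)//; lra.
Qed.

Lemma powRVK (x b : R) : b != 0 -> 0 <= x -> (x `^ b) `^ b^-1 = x.
Proof. by move=> b0 x0; rewrite -powRrM mulfV// powRr1. Qed.

Lemma powRKV (x b : R) : b != 0 -> 0 <= x -> (x `^ b^-1) `^ b = x.
Proof. by move=> b0 x0; rewrite -powRrM mulVf// powRr1. Qed.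

(** Where [defect] is about c 2^-k, the weight is O((c 2^-k)^alpha) on a set of volume O(c 2^-k).
    The contributions decrease geometrically with ratio 2^(-alpha) / 2, which is below 1 exactly
    because alpha > -1. *)
Lemma weight_tail_le alpha : -1 < alpha -> alpha < 0 -> exists2 K : R, 0 <= K &
  forall c, 0 < c -> c < 1 ->
  (\int[leb d]_(t in D `&` [set t | (defect t < c)%R]) (weight alpha t)%:E <=
    (K * c `^ (1 + alpha))%:E)%E.
Proof.
move=> a1 a0; pose b : R := 2 `^ (- alpha).
have b0 : 0 < b by rewrite powR_gt0.
have b2 : b < 2.
  rewrite /b /powR gt_eqF// -[ltRHS](@lnK R 2) ?posrE// ltr_expR.
  by rewrite gtr_pMl ?ln_gt0 ?ltr1n//; lra.
pose r := b / 2.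
exists (V * d%:R * b / (1 - r)).
  by rewrite divr_ge0// ?subr_ge0 /r; [rewrite !mulr_ge0// ltW|lra].
move=> c c0 c1.
rewrite [X in (_ <= X%:E)%E](_ : _ = V * d%:R * b * c `^ (1 + alpha) / (1 - r)); last first.
  by rewrite mulrAC.
have half0 k : (0 : R) < 2^-1 ^+ k by rewrite exprn_gt0.
have half1 k : (2^-1 : R) ^+ k <= 1 by rewrite exprn_ile1// invf_le1 ?ler1n.
have ck0 k : 0 < c * 2^-1 ^+ k by rewrite mulr_gt0.
have ck1 k : c * 2^-1 ^+ k < 1.
  by apply: le_lt_trans c1; rewrite ler_piMr// ltW.
have bk k : (2^-1 ^+ k) `^ alpha = b ^+ k :> R.
  elim: k => [|k IH]; first by rewrite !expr0 powR1.
  rewrite !exprS powRM ?(ltW (half0 _))// IH; congr (_ * _).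
  by rewrite /b -powR_inv1// -powRrM mulN1r.
apply: (@integral_le_geometric _ _ _ (leb d) _ (weight alpha)
  (fun k => D `&` [set t | defect t < c * 2^-1 ^+ k])
  (fun k => (c * 2^-1 ^+ k.+1) `^ alpha)).
- exact: measurable_shell.
- apply: measurable_funTS; exact: measurable_weight.
- by move=> t _; exact: weight_ge0.
- by move=> k; exact: measurable_shell.
- by move=> k; exact: powR_ge0.
- move=> t [Dt tc]; have q0 := defect_ge0 Dt; rewrite weightE//.
  (* On the unit sphere the weight takes the value 0, since [powR] sends 0 to 0 for a nonzero
     exponent, even a negative one. *)
  have [q00|qn0] := eqVneq (defect t) 0.
    exists 0%N; first by split => //=; rewrite expr0 mulr1.
    by rewrite q00 powR0 ?powR_ge0// lt_eqF.
  have qp : 0 < defect t by rewrite lt_neqAle eq_sym qn0.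
  have [k [k1 k2]] : exists k, 2 ^+ (0 + k) <= c / defect t /\ c / defect t <= 2 ^+ (0 + k).+1.
    by apply: dyadic_interval; rewrite expr0 ler_pdivlMr// mul1r ltW.
  rewrite add0n in k1 k2.
  have h2 j : (2^-1 ^+ j : R) = (2 ^+ j)^-1 by rewrite exprVn.
  have p2 j : (0 : R) < 2 ^+ j by rewrite exprn_gt0.
  have lower : c * 2^-1 ^+ k.+1 <= defect t.
    by rewrite h2 ler_pdivrMr// mulrC -ler_pdivrMr.
  have upper : defect t <= c * 2^-1 ^+ k.
    by rewrite h2 ler_pdivlMr// mulrC -ler_pdivlMr.
  (* The shells are given by strict inequalities, so a point with [defect t] equal to c 2^-k is
     assigned to the preceding shell; k = 0 is excluded by [tc]. *)
  move: upper; rewrite le_eqVlt => /predU1P[qE|lt].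
    case: k k1 k2 lower qE => [|k] k1 k2 lower qE.
      by move: tc => /=; rewrite qE expr0 mulr1 ltxx.
    exists k; last by rewrite qE.
    split => //=; rewrite qE exprS mulrCA gtr_pMl//; lra.
  by exists k; [split|apply: powR_neg_anti].
- move=> k; apply: (@le_trans _ _
    (((c * 2^-1 ^+ k.+1) `^ alpha)%:E * (V * d%:R * (c * 2^-1 ^+ k))%:E)%E).
    by rewrite lee_wpmul2l ?lee_fin ?powR_ge0// leb_shell_le.
  rewrite -EFinM lee_fin powRM ?(ltW c0) ?(ltW (half0 _))// bk.
  rewrite powRD; last by rewrite (gt_eqF c0) implybT.
  rewrite powRr1 ?(ltW c0)// /r expr_div_n exprVn exprS le_eqVlt.
  by apply/orP; left; apply/eqP; set x := 2 ^+ k; ring.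
- by rewrite !mulr_ge0 ?powR_ge0// ltW.
- by rewrite /r divr_ge0// ltW.
- by rewrite /r; lra.
Qed.

Lemma splitD c : D = (D `&` [set t | c <= defect t]) `|` (D `&` [set t | defect t < c]).
Proof.
rewrite -setIUr (_ : _ `|` _ = setT) ?setIT//; apply/seteqP; split => // t _ /=.
by case: (leP c (defect t)); [left|right].
Qed.

Lemma weight_le_neg alpha c (t : T) : alpha < 0 -> 0 < c ->
  (D `&` [set t | c <= defect t]) t -> weight alpha t <= c `^ alpha.
Proof. by move=> a0 c0 [Dt ct]; rewrite weightE//; exact: powR_neg_anti. Qed.

Lemma weight_le1 alpha (t : T) : 0 <= alpha -> D t -> weight alpha t <= 1.
Proof.
move=> a0 Dt; rewrite weightE//.
rewrite -[leRHS](_ : (1 : R) `^ alpha = 1); last by rewrite powR1.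
by rewrite ge0_ler_powR ?nnegrE ?defect_ge0 ?defect_le1.
Qed.

Lemma integrable_weight alpha : -1 < alpha ->
  (leb d).-integrable D (EFin \o weight alpha).
Proof.
move=> a1; have [a0|a0] := leP 0 alpha.
  apply: (@integrable_bounded _ _ _ (leb d) _ mD Dfin _ 1).
    apply: measurable_funTS; exact: measurable_weight.
  by move=> t Dt; rewrite ger0_norm ?weight_ge0// weight_le1.
have [K K0 HK] := weight_tail_le a1 a0.
have h0 : (0 : R) < 2^-1 by rewrite invr_gt0.
have h1 : (2^-1 : R) < 1 by lra.
have mw : measurable_fun D (EFin \o weight alpha).
  apply/measurable_EFinP; apply: measurable_funTS; exact: measurable_weight.
apply/integrableP; split => //.
under eq_integral do rewrite gee0_abs ?lee_fin ?weight_ge0//.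
rewrite (splitD 2^-1) ge0_integral_setU//; last 5 first.
- exact: measurable_level.
- exact: measurable_shell.
- by rewrite -splitD.
- by move=> t _; rewrite lee_fin weight_ge0.
- by apply/disj_setPS => t [[_ l1] [_ l2]]; move: l1; rewrite /= leNgt l2.
rewrite lte_add_pinfty//; last first.
  by apply: le_lt_trans (HK _ h0 h1) _; exact: ltry.
apply: (@le_lt_trans _ _ (\int[leb d]_(t in D `&` [set t | (2^-1 <= defect t)%R]) (2^-1 `^ alpha)%R%:E)%E).
  apply: ge0_le_integral => //.
  - exact: measurable_level.
  - by move=> t _; rewrite lee_fin weight_ge0.
  - by apply: measurable_funS mw => // t [].
  - by move=> t Ht; rewrite lee_fin weight_le_neg.
rewrite integral_cst; last exact: measurable_level.
rewrite -ge0_fin_numE; last by rewrite mule_ge0// lee_fin powR_ge0.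
rewrite fin_numM// ge0_fin_numE//; apply: le_lt_trans Dfin.
by apply: le_measure; rewrite ?inE//; exact: measurable_level.
Qed.

Lemma weight_integral_gt0 alpha : -1 < alpha ->
  0 < \int[leb d]_(t in D) weight alpha t.
Proof.
move=> a1; have iw := integrable_weight a1.
pose S := eball d (2^-1 : R).
have mS : measurable S := @measurable_eball R d 2^-1.
have SD : S `<=` D by move=> t; rewrite /S /eball /= => /le_trans; apply; lra.
(* On the ball of radius 1/2 the defect lies between 3/4 and 1, and the minimum covers both signs of
   [alpha]. *)
pose m : R := Num.min ((3 / 4) `^ alpha) 1.
have m0 : 0 < m by rewrite lt_min powR_gt0//; lra.
have wS t : S t -> m <= weight alpha t.
  move=> St; have Dt := SD _ St; rewrite weightE//.
  have qS : 3 / 4 <= defect t.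
    move: St; rewrite /S /eball /= /defect => e2; have := enorm_ge0 (row_of_tuple t); nra.
  have q1 := defect_le1 t.
  have [a0|a0] := leP 0 alpha.
    by rewrite ge_min ge0_ler_powR ?nnegrE ?defect_ge0//; lra.
  rewrite ge_min; apply/orP; right.
  rewrite -[leLHS](_ : (1 : R) `^ alpha = 1); last by rewrite powR1.
  by apply: powR_neg_anti => //; lra.
have V1 : 0 < m * fine (leb d S).
  by rewrite leb_eball ?invr_gt0//= !mulr_gt0// exprn_gt0// invr_gt0.
apply: (lt_le_trans V1); rewrite -Rintegral_cst//.
have iS : (leb d).-integrable S (EFin \o weight alpha) by exact: integrableS iw.
apply: (@le_trans _ _ (\int[leb d]_(t in S) weight alpha t)).
  apply: le_Rintegral => //.
  by apply: (@integrable_bounded _ _ _ (leb d) _ mS (leb_eball_lty d_gt0 _) _ `|m|).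
rewrite /Rintegral fine_le//; [exact: integrable_fin_num..|].
apply: ge0_subset_integral => //.
  by apply/measurable_EFinP; apply: measurable_funTS; exact: measurable_weight.
by move=> t _; rewrite lee_fin weight_ge0.
Qed.

End bochner_riesz_weights.

(** * From balls to Bochner-Riesz weights *)

Section decay.
Context {R : realType} (d : nat).
Hypothesis d_gt0 : (0 < d)%N.
Local Notation T := (d.-tuple (measurableTypeR R)).
Local Notation D := (eball d (1 : R)).
Local Notation V := (@ball_volume R d).
Local Notation weight := (@bochner_riesz_weight R d).
Local Notation defect := (@defect R d).

Let mD : measurable D := @measurable_eball R d 1.
Let Dfin : (leb d D < +oo)%E := @leb_eball1_lty R d d_gt0.

Section fixed.
Variables (psi : T -> R) (B e : R).
Hypothesis mpsi : measurable_fun [set: T] psi.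
Hypothesis B0 : 0 <= B.
Hypothesis psiB : forall t, `|psi t| <= B.
Hypothesis level_bound : forall c : R,
  `|\int[leb d]_(t in D `&` [set t | c <= defect t]) psi t| <= e.

Let mpsiD : measurable_fun D psi := measurable_funTS mpsi.

Lemma weight_mean_nonneg alpha : 0 <= alpha ->
  `|\int[leb d]_(t in D) (weight alpha t * psi t)| <= e.
Proof.
move=> a0; rewrite -[e]mul1r; apply: (layer_cake mD Dfin (B := B)) => //.
- by apply: measurable_funTS; exact: measurable_weight.
- by move=> t Dt; rewrite weight_ge0 weight_le1.
move=> y y0; have [az|an] := eqVneq alpha 0.
  have w1 t : D t -> weight alpha t = 1 by move=> Dt; rewrite weightE// az powRr0.
  have [y1|y1] := leP y 1.
    rewrite (_ : _ `&` _ = D `&` [set t | 0 <= defect t])//.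
    apply/seteqP; split => t [Dt _]; split => //=; first exact: defect_ge0.
    by rewrite w1.
  rewrite (_ : _ `&` _ = D `&` [set t | 2 <= defect t])//.
  apply/seteqP; split => t [Dt /= H]; split => //=.
    by move: H; rewrite w1//; lra.
  by have := defect_le1 t; lra.
have ap : 0 < alpha by rewrite lt_neqAle eq_sym an.
have av : 0 <= alpha^-1 by rewrite invr_ge0.
rewrite (_ : _ `&` _ = D `&` [set t | y `^ alpha^-1 <= defect t])//.
apply/seteqP; split => t [Dt /= H]; split => //=; have q0 := defect_ge0 Dt.
  move: H; rewrite weightE// => H.
  rewrite -[leRHS](powRVK an q0) ge0_ler_powR// nnegrE ?powR_ge0//; exact: ltW.
rewrite weightE// -(powRKV an (ltW y0)).
by rewrite ge0_ler_powR// nnegrE powR_ge0.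
Qed.

(** The factor 2 counts two contributions of at most L e with L = c^alpha: L times the integral of
    [psi] over a ball, and the layer-cake bound for L minus the weight. *)
Lemma weight_mean_level alpha c : alpha < 0 -> 0 < c ->
  `|\int[leb d]_(t in D `&` [set t | c <= defect t]) (weight alpha t * psi t)| <=
     2 * c `^ alpha * e.
Proof.
move=> a0 c0; pose L := c `^ alpha; have L0 : 0 < L by exact: powR_gt0.
pose A := D `&` [set t | c <= defect t].
have mA : measurable A by exact: measurable_level.
have Afin : (leb d A < +oo)%E.
  by apply: le_lt_trans Dfin; apply: le_measure; rewrite ?inE// => t [].
(* [L - weight] truncated to [A] has range in [0, L] and is monotone in [defect], so
   its superlevel sets are again balls. *)
pose W t : R := if c <= defect t then L - weight alpha t else 0.
have WA t : D t -> 0 <= W t <= L.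
  move=> Dt; rewrite /W; case: ifPn => [ct|_].
    have := weight_le_neg a0 c0 (conj Dt ct); have := weight_ge0 alpha t.
    by rewrite -/L => w0 wL; apply/andP; split; lra.
  by rewrite lexx ltW.
have mW : measurable_fun D W.
  apply: measurable_fun_if => //.
  - by apply: measurable_fun_ler => //; apply: measurable_funTS; exact: measurable_defect.
  - apply: measurable_funTS; apply: measurable_funB; first exact: measurable_cst.
    exact: measurable_weight.
have H1 : `|\int[leb d]_(t in D) (W t * psi t)| <= L * e.
  apply: (layer_cake mD Dfin (B := B)) => // y y0.
  (* The weight is positive where [defect t >= c], so [W] stays below [L] and such a superlevel set
     is empty. *)
  have [Ly|yL] := leP L y.
    rewrite (_ : _ `&` _ = D `&` [set t | 2 <= defect t])//.
    apply/seteqP; split => t [Dt /= H]; split => //=.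
      move: H; rewrite /W; case: ifPn => [ct|_] /= H; last by lra.
      have : 0 < weight alpha t by rewrite weightE// powR_gt0//; exact: lt_le_trans ct.
      lra.
    by have := defect_le1 t; lra.
  (* The condition W >= y means weight <= v, that is, defect >= v^(1/alpha) since alpha < 0. As v <
     L, this bound is at least [c], so the truncation adds no condition. *)
  pose v := L - y; have v0 : 0 < v by rewrite subr_gt0.
  have an : alpha != 0 by rewrite lt_eqF.
  have av : alpha^-1 < 0 by rewrite invr_lt0.
  rewrite (_ : _ `&` _ = D `&` [set t | v `^ alpha^-1 <= defect t])//.
  apply/seteqP; split => t [Dt /= H]; split => //=.
    move: H; rewrite /W; case: ifPn => [ct|_] /= H; last by lra.
    have q0 : 0 < defect t by exact: lt_le_trans ct.
    have wv : defect t `^ alpha <= v by move: H; rewrite weightE// /v; lra.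
    rewrite -[leRHS](powRVK an (ltW q0)); apply: powR_neg_anti => //.
    exact: powR_gt0.
  have cv : c <= v `^ alpha^-1.
    rewrite -[leLHS](powRVK an (ltW c0)); apply: powR_neg_anti => //.
    by rewrite /v -/L; lra.
  have ct : c <= defect t by exact: le_trans H.
  rewrite /W ifT// weightE//.
  have : defect t `^ alpha <= v.
    rewrite -[leRHS](powRKV an (ltW v0)); apply: powR_neg_anti => //.
    by exact: lt_le_trans cv.
  by rewrite /v; lra.
have ipsi : (leb d).-integrable A (EFin \o psi).
  apply: (@integrable_bounded _ _ _ (leb d) _ mA Afin _ B) => //.
  exact: measurable_funTS.
have iw : (leb d).-integrable A (EFin \o (fun t => weight alpha t * psi t)).
  apply: (@integrable_bounded _ _ _ (leb d) _ mA Afin _ (L * B)).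
    by apply: measurable_funTS; apply: measurable_funM => //; exact: measurable_weight.
  move=> t At; rewrite normrM ler_pM//.
  by rewrite ger0_norm ?weight_ge0// weight_le_neg.
have E : \int[leb d]_(t in D) (W t * psi t) =
    L * \int[leb d]_(t in A) psi t - \int[leb d]_(t in A) (weight alpha t * psi t).
  rewrite -RintegralZl// -RintegralB//; last first.
    exact: (integrableZl mA L ipsi).
  rewrite Rintegral_mkcondr; apply: eq_Rintegral => t _.
  rewrite /W patchE; case: (boolP (c <= defect t)) => ct.
    by rewrite mem_set// mulrBl.
  by rewrite memNset ?mul0r//; exact/negP.
have -> : \int[leb d]_(t in A) (weight alpha t * psi t) =
   L * \int[leb d]_(t in A) psi t - \int[leb d]_(t in D) (W t * psi t).
  by rewrite E; ring.
apply: le_trans (ler_normB _ _) _; rewrite (_ : 2 * _ * e = L * e + L * e); last by rewrite -/L; ring.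
by apply: lerD => //; rewrite normrM (gtr0_norm L0) ler_wpM2l ?(ltW L0)//; exact: level_bound.
Qed.

Lemma weight_mean_neg alpha c K : -1 < alpha -> alpha < 0 -> 0 < c ->
  (\int[leb d]_(t in D `&` [set t | (defect t < c)%R]) (weight alpha t)%:E <= K%:E)%E ->
  `|\int[leb d]_(t in D) (weight alpha t * psi t)| <= 2 * c `^ alpha * e + B * K.
Proof.
move=> a1 a0 c0 HK.
have mA : measurable (D `&` [set t | c <= defect t]) by exact: measurable_level.
have mS : measurable (D `&` [set t | defect t < c]) by exact: measurable_shell.
have mw : measurable_fun [set: T] (fun t => weight alpha t * psi t).
  by apply: measurable_funM => //; exact: measurable_weight.
have iwp : (leb d).-integrable D (EFin \o (fun t => weight alpha t * psi t)).
  have := integrableZl mD B (integrable_weight d_gt0 a1).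
  apply: le_integrable => //; first by apply/measurable_EFinP; exact: measurable_funTS.
  move=> t Dt /=; rewrite lee_fin !normrM mulrC ler_wpM2r//.
  by rewrite (ger0_norm B0).
rewrite (splitD d c) Rintegral_setU//; last 2 first.
- by rewrite -(splitD d c).
- by apply/disj_setPS => t [[_ l1] [_ l2]]; move: l1; rewrite /= leNgt l2.
apply: le_trans (ler_normD _ _) _; apply: lerD; first exact: weight_mean_level.
have iS : (leb d).-integrable (D `&` [set t | defect t < c]) (EFin \o weight alpha).
  by apply: integrableS (integrable_weight d_gt0 a1).
have iwS : (leb d).-integrable (D `&` [set t | defect t < c])
    (EFin \o (fun t => weight alpha t * psi t)) by apply: integrableS iwp.
apply: le_trans (le_normr_Rintegral mS iwS) _.
apply: (@le_trans _ _ (\int[leb d]_(t in D `&` [set t | defect t < c]) (B * weight alpha t))).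
  apply: le_Rintegral => //.
  - exact: (integrable_abse iwS).
  - exact: (integrableZl mS B iS).
  - by move=> t _; rewrite normrM mulrC (ger0_norm (weight_ge0 _ _)) ler_wpM2r// weight_ge0.
rewrite RintegralZl// ler_wpM2l//.
by rewrite -lee_fin fineK//; exact: integrable_fin_num.
Qed.

End fixed.

(** The exponent is fixed before [phi] and its constants, so that it depends on [alpha] and [g] (and
    the dimension) only. *)
Lemma bochner_riesz_decay (alpha g : R) : -1 < alpha -> 0 < g -> g <= 1 ->
  exists2 g' : R, 0 < g' & forall (phi : T -> R) (B C R0 : R),
    measurable_fun [set: T] phi -> (forall t, `|phi t| <= B) -> 0 <= C -> 1 <= R0 ->
    (forall rad, R0 < rad ->
      `|\int[leb d]_(t in eball d rad) phi t| <= C * rad ^+ d * rad `^ (- g)) ->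
    exists C', forall rad, R0 < rad ->
      `|\int[leb d]_(t in D) (weight alpha t * phi (tscale rad t))| <=
        C' * rad `^ (- g').
Proof.
move=> a1 g0 g1; have [a0|a0] := leP 0 alpha.
  exists g => // phi B C R0 mphi phiB C0 R01 H; exists (C + B * V * R0) => rad Rr.
  have B0 : 0 <= B by exact: le_trans (phiB (nseq_tuple d 0)).
  apply: (@weight_mean_nonneg (phi \o tscale rad) B) => //.
  - by apply: measurableT_comp => //; exact: measurable_tscale.
  - by move=> t; exact: phiB.
  - by move=> c; exact: (scaled_level_bound d_gt0 mphi phiB C0 R01 g1 H).
have [K K0 HK] := weight_tail_le d_gt0 a1 a0.
exists (g * (1 + alpha) / 2) => [|phi B C R0 mphi phiB C0 R01 H].
  by rewrite divr_gt0// mulr_gt0//; lra.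
have B0 : 0 <= B by exact: le_trans (phiB (nseq_tuple d 0)).
pose N := C + B * V * R0; exists (2 * N + B * K) => rad Rr.
have V0 : 0 < V by exact: ball_volume_gt0.
have N0 : 0 <= N by rewrite addr_ge0// !mulr_ge0// ?(ltW V0)//; lra.
have r1 : 1 < rad by exact: le_lt_trans Rr.
have r0 : 0 < rad by lra.
(* The inner part is then of order rad^(-g - g alpha / 2) and the shell of order rad^(-g (1 + alpha)
   / 2); the second is the larger one and gives the exponent. *)
pose c := rad `^ (- (g / 2)).
have c0 : 0 < c by exact: powR_gt0.
have c1 : c < 1.
  rewrite /c powRN invf_lt1 ?powR_gt0// /powR gt_eqF// expR_gt1.
  by rewrite mulr_gt0 ?ln_gt0//; lra.
have := @weight_mean_neg (phi \o tscale rad) B (N * rad `^ (- g)) _ B0 _ _ alpha c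
  (K * c `^ (1 + alpha)) a1 a0 c0 (HK c c0 c1).
move=> /(_ _ _ _)/le_trans; apply.
- by apply: measurableT_comp => //; exact: measurable_tscale.
- by move=> t; exact: phiB.
- by move=> y; exact: (scaled_level_bound d_gt0 mphi phiB C0 R01 g1 H).
rewrite [leRHS]mulrDl; apply: lerD.
  rewrite -mulrA -[leRHS]mulrA ler_wpM2l// mulrCA ler_wpM2l//.
  rewrite /c -powRrM -powRD; last by rewrite (gt_eqF r0) implybT.
  by rewrite ler_powR ?(ltW r1)//; nra.
rewrite mulrA ler_wpM2l ?mulr_ge0// /c -powRrM.
rewrite (_ : - (g / 2) * (1 + alpha) = - (g * (1 + alpha) / 2))//; ring.
Qed.

End decay.

(** * Truncation and equidistribution of balls *)

Section measurability.
Context {R : realType}.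
Local Notation RR := (measurableTypeR R).

Lemma quo_continuous_measurable (n : nat) (G Gam : mxgroup R n) (f : quo G Gam -> R) :
  continuous f -> measurable_fun [set: quo G Gam] f.
Proof.
move=> /continuousP cf; apply: (measurability _ (RGenOInfty.measurableE R)).
move=> /= _ [_ [a ->]] <-; rewrite setTI; apply: sub_gen_smallest.
by apply: cf; exact: interval_open.
Qed.

Definition grid_point d (k : nat) (z : 'rV[int]_d) : 'rV[R]_d :=
  \row_i ((z 0 i)%:~R / k.+1%:R).

Definition grid_index d (k : nat) (t : d.-tuple RR) : 'rV[int]_d :=
  \row_i Num.floor (k.+1%:R * tnth t i).

Lemma measurable_grid d k (F : 'rV[int]_d -> R) :
  measurable_fun [set: d.-tuple RR] (F \o grid_index k).
Proof.
move=> _ A mA; rewrite setTI.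
pose cell (z : 'rV[int]_d) : set (d.-tuple RR) := [set t | grid_index k t = z].
have mcell z : measurable (cell z).
  rewrite (_ : cell z = \bigcap_(i in [set: 'I_d])
      ((fun t : d.-tuple RR => k.+1%:R * tnth t i) @^-1`
        `[(z 0 i)%:~R, (z 0 i + 1)%:~R[%classic)).
    apply: fin_bigcap_measurable; first exact: finite_finset.
    move=> i _; rewrite -[X in measurable X]setTI.
    have : measurable_fun [set: d.-tuple RR] (fun t => k.+1%:R * tnth t i).
      by apply: measurable_funM => //; exact: measurable_tnth.
    by apply => //; exact: measurable_itv.
  apply/seteqP; split => t.
    move=> <- i _; rewrite /= in_itv/= mxE; exact: floor_itv.
  move=> H; apply/rowP => i; rewrite mxE; apply: floor_def.
  by have := H i I; rewrite /= in_itv.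
rewrite (_ : _ @^-1` A = \bigcup_(z in [set z | A (F z)]) cell z).
  rewrite bigcup_mkcond; apply: countable_bigcupT_measurable => [|z].
    exact: countableP.
  by case: ifP.
apply/seteqP; split => t /=; first by move=> At; exists (grid_index k t).
by move=> [z Az ->].
Qed.

Lemma grid_cvg d (t : d.-tuple RR) :
  grid_point k (grid_index k t) @[k --> \oo] --> row_of_tuple t.
Proof.
apply/cvgrPdist_le => e e0; exists (Num.truncn e^-1) => // k /= ek.
have ek1 : k.+1%:R^-1 <= e.
  rewrite invf_ple ?posrE//; have ei0 : 0 <= e^-1 by rewrite invr_ge0 ltW.
  have /andP[_ /ltW/le_trans] := truncn_itv ei0; apply.
  by rewrite ler_nat ltnS.
rewrite /Num.Def.normr/= mx_normrE; apply/bigmax_leP; split; first exact: ltW.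
move=> [i j] _ /=; rewrite !mxE; apply: le_trans ek1.
have /andP[f1 f2] := floor_itv (k.+1%:R * tnth t j).
have k0 : (0 : R) < k.+1%:R by [].
rewrite intrD in f2.
rewrite -(ler_pM2l k0) divff ?gt_eqF// -{1}(gtr0_norm k0) -normrM mulrBr mulrCA divff ?gt_eqF// mulr1.
by rewrite ler_norml; apply/andP; split; lra.
Qed.

(** Continuity refers to the topology of row vectors, measurability to the product sigma-algebra of
    tuples. The link is that [F] is a pointwise limit of functions constant on the countably many
    measurable cells of a grid of mesh 1 / (k + 1). *)
Lemma measurable_continuous_row d (F : 'rV[R]_d -> R) : continuous F ->
  measurable_fun [set: d.-tuple RR] (F \o row_of_tuple).
Proof.
move=> cF; apply: (@measurable_fun_cvg _ _ _ _
  (fun k => F \o @grid_point d k \o @grid_index d k)).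
  by move=> k; exact: measurable_grid.
by move=> t _; exact: (cvg_comp _ _ (@grid_cvg d t) (cF (row_of_tuple t))).
Qed.

Lemma bounded_convergence dT (T : measurableType dT) (mu : {measure set T -> \bar R})
    (D : set T) (f_ : nat -> T -> R) (f : T -> R) B :
  measurable D -> (mu D < +oo)%E -> (forall j, measurable_fun D (f_ j)) ->
  measurable_fun D f -> (forall x, D x -> f_ j x @[j --> \oo] --> f x) ->
  (forall j x, D x -> `|f_ j x| <= B) ->
  \int[mu]_(x in D) f_ j x @[j --> \oo] --> \int[mu]_(x in D) f x.
Proof.
move=> mD Dfin mf_ mf cvf fB.
have fB' x : D x -> `|f x| <= B.
  move=> Dx; have cn : `|f_ j x| @[j --> \oo] --> `|f x|.
    by apply: cvg_norm; exact: cvf.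
  rewrite -(cvg_lim _ cn)//; apply: limr_le; first by apply/cvg_ex; eexists; exact: cn.
  by apply: nearW => j; exact: fB.
apply: fine_cvg; rewrite fineK; last first.
  by apply: integrable_fin_num => //; exact: (integrable_bounded mD Dfin mf fB').
have ae1 : {ae mu, forall x, D x -> (f_ j x)%:E @[j --> \oo] --> (f x)%:E}.
  by apply: aeW => x Dx; apply: cvg_EFin; [exact: nearW|exact: cvf].
have iB : mu.-integrable D (fun=> B%:E).
  exact: (@integrable_bounded _ _ _ mu D mD Dfin (fun=> B) `|B|).
have ae2 : {ae mu, forall x j, D x -> (`|(f_ j x)%:E| <= B%:E)%E}.
  by apply: aeW => x j Dx; rewrite lee_fin fB.
have mE j : measurable_fun D (EFin \o f_ j) by exact/measurable_EFinP.
have mE' : measurable_fun D (EFin \o f) by exact/measurable_EFinP.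
by have [] := dominated_convergence mD mE mE' ae1 iB ae2.
Qed.

End measurability.

Section real_and_imaginary_parts.
Context {R : realType} {n : nat} {G Gam : mxgroup R n}.
Local Notation M := 'M[R]_n.+1.
Local Notation X := (quo G Gam).
Implicit Types (f : X -> R[i]) (g : X -> R) (s : seq M).

Lemma Re_foldr_lie_deriv f s :
  (fun x => complex.Re (foldr lie_deriv f s x)) =
  foldr rderiv (fun x => complex.Re (f x)) s.
Proof. by elim: s => // A s /= <-. Qed.

Lemma Im_foldr_lie_deriv f s :
  (fun x => complex.Im (foldr lie_deriv f s x)) =
  foldr rderiv (fun x => complex.Im (f x)) s.
Proof. by elim: s => // A s /= <-. Qed.

Lemma rsmooth_Re f : smooth f -> rsmooth (fun x => complex.Re (f x)).
Proof.
move=> sf s ls; rewrite -Re_foldr_lie_deriv.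
have [[cR _] dR] := sf s ls; split => // A lA x.
by have [] := dR A lA x.
Qed.

Lemma rsmooth_Im f : smooth f -> rsmooth (fun x => complex.Im (f x)).
Proof.
move=> sf s ls; rewrite -Im_foldr_lie_deriv.
have [[_ cI] dI] := sf s ls; split => // A lA x.
by have [] := dI A lA x.
Qed.

Lemma foldr_lie_deriv_real g s :
  foldr lie_deriv (fun x => (g x)%:C%C) s = fun x => (foldr rderiv g s x)%:C%C.
Proof.
elim: s => // A s /= ->; apply/funext => x; rewrite /lie_deriv /=.
congr (Complex _ _); exact: (derive1_cst (0 : R)).
Qed.

Lemma smooth_real g : rsmooth g -> smooth (fun x => (g x)%:C%C).
Proof.
move=> sg s ls /=; rewrite foldr_lie_deriv_real; have [cg dg] := sg s ls.
split; first by split => //=; exact: continuous_cst.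
move=> A lA x; split; first exact: dg.
exact: derivable_cst.
Qed.

Lemma normc_real (a : R) : Normc.normc (a%:C%C) = `|a|.
Proof. by rewrite /= expr0n addr0 sqrtr_sqr. Qed.

Lemma Re_le_normc (z : R[i]) : `|complex.Re z| <= Normc.normc z.
Proof. by case: z => a b /=; rewrite -sqrtr_sqr ler_wsqrtr// lerDl sqr_ge0. Qed.

Lemma Im_le_normc (z : R[i]) : `|complex.Im z| <= Normc.normc z.
Proof. by case: z => a b /=; rewrite -sqrtr_sqr ler_wsqrtr// lerDr sqr_ge0. Qed.

Lemma normc_le_ReIm (z : R[i]) : Normc.normc z <= `|complex.Re z| + `|complex.Im z|.
Proof.
case: z => a b /=; rewrite -[leRHS]ger0_norm ?addr_ge0// -sqrtr_sqr ler_wsqrtr//.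
rewrite sqrrD !real_normK ?num_real// -addrA lerD2l addrC lerDl mulrn_wge0//.
Qed.

End real_and_imaginary_parts.

(** * Square integrable functions and finite Sobolev norms *)

Section square_integrable.
Context d (T : measurableType d) (R : realType).
Variable m : {measure set T -> \bar R}.
Implicit Types h : T -> R.

Definition square_integrable h :=
  measurable_fun [set: T] h /\ (\int[m]_x (h x ^+ 2)%:E < +oo)%E.

Let mX h : measurable_fun [set: T] h -> measurable_fun [set: T] (fun x => (h x ^+ 2)%:E : \bar R).
Proof. by move=> mh; apply/measurable_EFinP; exact: measurable_funX. Qed.

Lemma square_integrable_le h h' : measurable_fun [set: T] h' ->
  (forall x, `|h' x| <= `|h x|) -> square_integrable h -> square_integrable h'.
Proof.
move=> mh' hh [mh ih]; split => //; apply: le_lt_trans ih.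
apply: ge0_le_integral => //.
- by move=> x _; rewrite lee_fin sqr_ge0.
- exact: mX.
- exact: mX.
- move=> x _; rewrite lee_fin -real_normK ?num_real// -[leRHS]real_normK ?num_real//.
  by rewrite lerXn2r.
Qed.

Lemma square_integrableD h h' : square_integrable h -> square_integrable h' ->
  square_integrable (fun x => h x + h' x).
Proof.
move=> [mh ih] [mh' ih']; split; first exact: measurable_funD.
have m2 (k : T -> R) : measurable_fun [set: T] k ->
    measurable_fun [set: T] (fun x => 2%:E * (k x ^+ 2)%:E : \bar R)%E.
  by move=> mk; apply: emeasurable_funM; [exact: measurable_cst|exact: mX].
apply: (@le_lt_trans _ _
    (\int[m]_x (2%:E * (h x ^+ 2)%:E + 2%:E * (h' x ^+ 2)%:E))%E).
  apply: ge0_le_integral => //.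
  - by move=> x _; rewrite lee_fin sqr_ge0.
  - by apply: mX; exact: measurable_funD.
  - by apply: emeasurable_funD; exact: m2.
  - move=> x _; rewrite -!EFinM -EFinD lee_fin.
    by have := sqr_ge0 (h x - h' x); nra.
rewrite ge0_integralD//; [|by move=> x _; rewrite mule_ge0// lee_fin ?sqr_ge0|exact: m2|
  by move=> x _; rewrite mule_ge0// lee_fin ?sqr_ge0|exact: m2].
rewrite !ge0_integralZl//; [|exact: mX|by move=> x _; rewrite lee_fin sqr_ge0|exact: mX|
   by move=> x _; rewrite lee_fin sqr_ge0].
by rewrite lte_add_pinfty// lte_mul_pinfty// ?lee_fin.
Qed.

Lemma square_integrable_sum (I : Type) (s : seq I) (h : I -> T -> R) :
  (forall i, square_integrable (h i)) ->
  square_integrable (fun x => \sum_(i <- s) h i x).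
Proof.
move=> H; elim: s => [|i s IH].
  under eq_fun do rewrite big_nil; split; first exact: measurable_cst.
  rewrite (eq_integral (cst 0%E)); last by move=> x _; rewrite expr0n.
  by rewrite integral_cst// mul0e.
by under eq_fun do rewrite big_cons; exact: square_integrableD.
Qed.

Lemma square_integrableZ c h : square_integrable h ->
  square_integrable (fun x => c * h x).
Proof.
move=> [mh ih]; split; first by apply: measurable_funM => //; exact: measurable_cst.
under eq_integral do rewrite exprMn EFinM.
rewrite ge0_integralZl//; [|exact: mX|by move=> x _; rewrite lee_fin sqr_ge0|
  by rewrite lee_fin sqr_ge0].
by rewrite lte_mul_pinfty// ?lee_fin ?sqr_ge0.
Qed.

Lemma square_integrable_abs h : square_integrable h ->
  square_integrable (fun x => `|h x|).
Proof.
move=> hh; apply: square_integrable_le (hh); last by move=> x; rewrite normr_id.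
by have [mh _] := hh; exact: (measurableT_comp (@normr_measurable R setT) mh).
Qed.

Lemma square_integrable_cst c : (m setT < +oo)%E -> square_integrable (fun=> c).
Proof.
move=> mfin; split; first exact: measurable_cst.
rewrite (eq_integral (cst (c ^+ 2)%:E))// integral_cst//.
by rewrite lte_mul_pinfty// lee_fin sqr_ge0.
Qed.

Lemma Lnorm2E h : Lnorm m 2%:E (fun x => `|h x|%:E) =
  ((\int[m]_x (h x ^+ 2)%:E) `^ 2^-1)%E.
Proof.
rewrite unlock; congr (_ `^ _)%E; apply: eq_integral => x _.
by rewrite /= normr_id powR_mulrn// real_normK ?num_real.
Qed.

Lemma Lnorm2_lty h : (Lnorm m 2%:E (fun x => `|h x|%:E) < +oo)%E =
  (\int[m]_x (h x ^+ 2)%:E < +oo)%E.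
Proof.
rewrite Lnorm2E; have : (0 <= \int[m]_x (h x ^+ 2)%:E)%E.
  by apply: integral_ge0 => x _; rewrite lee_fin sqr_ge0.
case: (\int[m]_x _)%E => [a| |]//.
  by rewrite poweR_EFin !ltry.
by rewrite poweRyr // invr_eq0 pnatr_eq0.
Qed.

End square_integrable.

Lemma bounded_ereal_sum (R : realType) (J I : Type) (s : seq I)
    (a : I -> J -> \bar R) :
  (forall i, exists M : R, forall j, (a i j <= M%:E)%E) ->
  exists M : R, forall j, (\sum_(i <- s) a i j <= M%:E)%E.
Proof.
move=> H; elim: s => [|i s [M HM]]; first by exists 0 => j; rewrite big_nil.
have [M' HM'] := H i; exists (M' + M) => j.
by rewrite big_cons EFinD leeD.
Qed.

Section ball_means.
Context {R : realType} {n : nat} {G Gam : mxgroup R n}.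
Local Notation M := 'M[R]_n.+1.
Local Notation X := (quo G Gam).
Hypothesis G_closed : closed_in_GL G.
Hypothesis Gam_sub : mxgroup_set Gam `<=` mxgroup_set G.
Hypothesis Gam_discrete : \forall g \near (1 : M), mxgroup_set Gam g -> g = 1.
Variables (m : probability X R) (r : nat) (b : r.-tuple M) (K : nat).
Hypothesis b_lie : forall i, lie G (tnth b i).

Definition basis_word (w : seq 'I_r) : seq M := [seq tnth b i | i <- w].

Lemma basis_word_lie w A : A \in basis_word w -> lie G A.
Proof. by move=> /mapP[i _ ->]. Qed.

(** The subwords produced by the Leibniz rule are again words in the basis and no longer than the
    original, so the Sobolev norm of order [K] controls them. *)
Lemma subseq_basis_word s w : subseq s (basis_word w) ->
  exists2 w', s = basis_word w' & (size w' <= size w)%N.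
Proof.
move=> /subseqP[k sk ->]; exists (mask k w); first by rewrite /basis_word map_mask.
exact/size_subseq/mask_subseq.
Qed.

Definition finite_sobolev (g : X -> R) := forall w, (size w <= K)%N ->
  square_integrable m (foldr rderiv g (basis_word w)).

Let mfin : (m setT < +oo)%E.
Proof. by rewrite probability_setT ltry. Qed.

Lemma sobolev_lty_word (f : X -> R[i]) : (sobolev m b K f < +oo)%E ->
  forall w, (size w <= K)%N ->
  (Lnorm m 2%:E (fun x => (Normc.normc (foldr lie_deriv f (basis_word w) x))%:E) < +oo)%E.
Proof.
move=> sf w wK; apply: le_lt_trans sf; rewrite /sobolev.
have wk : (size w < K.+1)%N by [].
rewrite (bigD1 (Ordinal wk))//= (bigD1 (in_tuple w))//=.
rewrite -addeA leeDl//; apply: adde_ge0; first by apply: sume_ge0 => i _; exact: Lnorm_ge0.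
by apply: sume_ge0 => i _; apply: sume_ge0 => j _; exact: Lnorm_ge0.
Qed.

(** Stated for an abstract [part] in order to be used for the real and for the imaginary part. *)
Lemma finite_sobolev_part (f : X -> R[i]) (g : X -> R) (part : R[i] -> R) :
  (forall z, `|part z| <= Normc.normc z) ->
  (forall s, (fun x => part (foldr lie_deriv f s x)) = foldr rderiv g s) ->
  smooth f -> rsmooth g -> (sobolev m b K f < +oo)%E -> finite_sobolev g.
Proof.
move=> partB partE sf sg fin w wK; set s := basis_word w.
have ls : forall A, A \in s -> lie G A by move=> A; exact: basis_word_lie.
have := sobolev_lty_word fin wK; rewrite -/s => L.
pose h x := Normc.normc (foldr lie_deriv f s x).
have h0 x : 0 <= h x by rewrite /h; case: (foldr _ _ _ _) => a c; exact: sqrtr_ge0.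
have [[cR cI] _] := sf s ls.
have mh : measurable_fun [set: X] h.
  rewrite (_ : h = fun x => Num.sqrt (complex.Re (foldr lie_deriv f s x) ^+ 2 +
      complex.Im (foldr lie_deriv f s x) ^+ 2)); last first.
    by apply/funext => x; rewrite /h; case: (foldr _ _ _ _).
  apply: (@measurableT_comp _ _ _ _ _ _ (@Num.sqrt R)).
    by apply: continuous_measurable_fun; exact: sqrt_continuous.
  by apply: measurable_funD; apply: measurable_funX;
    apply: quo_continuous_measurable.
have hs : square_integrable m h.
  split => //; rewrite -Lnorm2_lty; move: L; rewrite (_ : (fun x => `|h x|%:E) = fun x => (h x)%:E)//.
  by apply/funext => x; rewrite ger0_norm.
apply: square_integrable_le hs.
  by apply: quo_continuous_measurable; exact: rsmooth_sub.
by move=> x; rewrite -partE (ger0_norm (h0 x)); exact: partB.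
Qed.

Section real_function.
Variables (g : X -> R) (B : R).
Hypothesis g_smooth : rsmooth g.
Hypothesis gB : forall x, `|g x| <= B.
Hypothesis g_fin : finite_sobolev g.

Let chi : nat -> X -> R := @cutoff R n G Gam.

Let chi_continuous j : continuous (chi j).
Proof. by apply: cutoff_continuous => //; exact: cutoffP. Qed.

Let g_continuous : continuous g.
Proof. by have [] := g_smooth (s := [::]) (fun A => ltac:(done)). Qed.

Let mchi j : measurable_fun [set: X] (chi j).
Proof. exact: quo_continuous_measurable. Qed.

Let mg : measurable_fun [set: X] g.
Proof. exact: quo_continuous_measurable. Qed.

Let B0 : 0 <= B.
Proof. exact: le_trans (gB point). Qed.

Let chi_le1 j x : `|chi j x| <= 1.
Proof. by rewrite ger0_norm ?cutoff_ge0 ?cutoff_le1. Qed.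

(** The constant c_j of the overview. It is 0 by convention if the cutoff has integral 0, which
    cannot happen for large [j], by [chi_integral_cvg]. *)
Definition cutoff_mean j : R :=
  (\int[m]_x (g x * chi j x)) / (\int[m]_x chi j x).

Definition truncated j (x : X) : R := (g x - cutoff_mean j) * chi j x.

Let mgchi j : measurable_fun [set: X] (fun x => g x * chi j x).
Proof. exact: measurable_funM. Qed.

Let gchiB j x : `|g x * chi j x| <= B.
Proof. by rewrite normrM -[leRHS]mulr1 ler_pM. Qed.

Let ichi j : m.-integrable setT (EFin \o chi j).
Proof. exact: (@integrable_bounded _ _ _ m setT measurableT mfin _ 1). Qed.

Let igchi j : m.-integrable setT (EFin \o (fun x => g x * chi j x)).
Proof. exact: (@integrable_bounded _ _ _ m setT measurableT mfin _ B). Qed.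

Lemma norm_cutoff_mean_le j : `|cutoff_mean j| <= B.
Proof.
rewrite /cutoff_mean; set I := \int[m]_x chi j x.
have I0 : 0 <= I by apply: Rintegral_ge0 => x _; exact: cutoff_ge0.
have [Iz|In] := eqVneq I 0; first by rewrite Iz invr0 mulr0 normr0.
have Ip : 0 < I by rewrite lt_neqAle eq_sym In.
rewrite normrM normfV (gtr0_norm Ip) ler_pdivrMr//.
apply: le_trans (le_normr_Rintegral measurableT (igchi j)) _.
rewrite -RintegralZl//; apply: le_Rintegral => //.
- exact: (integrable_abse (igchi j)).
- exact: (integrableZl measurableT B (ichi j)).
- by move=> x _; rewrite normrM [`|chi j x|]ger0_norm ?cutoff_ge0// ler_wpM2r ?cutoff_ge0.
Qed.

Lemma chi_integral_cvg : \int[m]_x chi j x @[j --> \oo] --> (1 : R).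
Proof.
have E : \int[m]_x (1 : R) = 1.
  by rewrite Rintegral_cst// mul1r; exact: (congr1 fine (@probability_setT _ _ _ m)).
rewrite -[X in _ --> X]E; apply: (@bounded_convergence _ _ _ m setT chi _ 1) => //.
by move=> x _; apply: cutoff_cvg.
Qed.

Lemma cutoff_mean_cvg : cutoff_mean j @[j --> \oo] --> \int[m]_x g x.
Proof.
rewrite -[X in _ --> X]mulr1 -[X in _ * X]invr1; apply: cvgM.
  apply: (@bounded_convergence _ _ _ m setT (fun j x => g x * chi j x) g B) => //.
  move=> x _; rewrite -[X in _ --> X]mulr1; apply: cvgM; first exact: cvg_cst.
  exact: cutoff_cvg.
by apply: cvgV; [exact: oner_neq0|exact: chi_integral_cvg].
Qed.

Lemma truncated_integral0 j : \int[m]_x chi j x != 0 ->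
  \int[m]_x truncated j x = 0.
Proof.
move=> I0; rewrite /truncated.
under eq_Rintegral do rewrite mulrBl.
rewrite RintegralB//; last exact: (integrableZl measurableT (cutoff_mean j) (ichi j)).
by rewrite RintegralZl// /cutoff_mean divfK// subrr.
Qed.

Lemma truncated_smooth j : rsmooth (truncated j).
Proof. by apply: rsmoothM_cutoff; [exact: Gam_discrete|exact: cutoffP|exact: rsmooth_subc]. Qed.

Lemma truncated_compact j : compactly_supported (fun x => (truncated j x)%:C%C).
Proof.
apply: subclosed_compact (@cutoff_support _ _ _ _ G_closed Gam_sub Gam_discrete j) _.
  exact: closed_closure.
apply: closure_subset => x /=; apply: contra_neq => c0.
by rewrite /truncated /chi c0 mulr0.
Qed.

(** By the Leibniz rule every derivative is dominated by one square integrable function independent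
    of [j]. The summand [B] in it accounts for c_j, which survives only in the empty word, and is
    square integrable because the measure is finite. *)
Lemma truncated_sobolev : exists N : R, forall j,
  (sobolev m b K (fun x => (truncated j x)%:C%C) <= N%:E)%E.
Proof.
apply: bounded_ereal_sum => k; apply: bounded_ereal_sum => w.
set s := [seq tnth b i | i <- w].
have ls : forall A, A \in s -> lie G A by move=> A; exact: basis_word_lie.
have [L cL HL] := foldr_leibniz Gam_discrete (@cutoffP _ _ _ _) ls.
have [W [C [C0 sW HW]]] := leibniz_bound Gam_discrete cL.
(* All words of [W] pass the test; it is there because [square_integrable_sum] asks for square
   integrability at every index, not only at those in the list. *)
pose h x := C * \sum_(v <- W) (if subseq v s then `|foldr rderiv g v x| + B else 0).
have hs : square_integrable m h.
  apply: square_integrableZ; apply: square_integrable_sum => v.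
  case: (boolP (subseq v s)) => [vs|_]; last exact: square_integrable_cst.
  have [w' -> sw'] := subseq_basis_word vs.
  apply: square_integrableD; last exact: square_integrable_cst.
  apply/square_integrable_abs/g_fin/(leq_trans sw').
  by rewrite size_tuple -ltnS.
have DF j x : `|foldr rderiv (truncated j) s x| <= `|h x|.
  rewrite (HL _ j (rsmooth_subc (cutoff_mean j) g_smooth)).
  apply: le_trans (HW _ j x) _; rewrite [leRHS]ger0_norm; last first.
    rewrite mulr_ge0// sumr_ge0// => v _; case: ifP => // _.
    by rewrite addr_ge0.
  rewrite ler_wpM2l// big_seq [leRHS]big_seq; apply: ler_sum => v /sW vs.
  rewrite vs foldr_rderiv_subc; case: v {vs} => [|A v] /=; last by rewrite lerDl.
  by apply: le_trans (ler_normB _ _) _; rewrite lerD2l norm_cutoff_mean_le.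
have Lh : (Lnorm m 2%:E (fun x => `|h x|%:E) < +oo)%E.
  by rewrite Lnorm2_lty; case: hs.
exists (fine (Lnorm m 2%:E (fun x => `|h x|%:E))) => j.
rewrite fineK ?ge0_fin_numE ?Lnorm_ge0//.
have -> : (fun x : X => (Normc.normc (foldr lie_deriv (fun x0 : X => (truncated j x0)%:C%C) s x))%:E) =
    (fun x => `|foldr rderiv (truncated j) s x|%:E).
  apply/funext => x; congr (_%:E); rewrite -normc_real; congr (Normc.normc _).
  exact: (congr1 (fun q => q x) (foldr_lie_deriv_real (truncated j) s)).
rewrite !Lnorm2E gt0_ler_poweR//.
- by rewrite in_itv/= leey andbT integral_ge0// => x _; rewrite lee_fin sqr_ge0.
- by rewrite in_itv/= leey andbT integral_ge0// => x _; rewrite lee_fin sqr_ge0.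
have mD : measurable_fun [set: X] (foldr rderiv (truncated j) s).
  by apply: quo_continuous_measurable; apply: rsmooth_sub => //; exact: truncated_smooth.
have [mh _] := hs.
apply: ge0_le_integral => //.
- by move=> x _; rewrite lee_fin sqr_ge0.
- by apply/measurable_EFinP; exact: measurable_funX.
- by apply/measurable_EFinP; exact: measurable_funX.
- move=> x _; rewrite lee_fin -real_normK ?num_real// -[leRHS]real_normK ?num_real//.
  by rewrite lerXn2r// nnegrE.
Qed.

End real_function.
End ball_means.

Section orbits_of_balls.
Context {R : realType} {n : nat} {G Gam : mxgroup R n}.
Local Notation M := 'M[R]_n.+1.
Local Notation X := (quo G Gam).
Hypothesis G_closed : closed_in_GL G.
Hypothesis Gam_sub : mxgroup_set Gam `<=` mxgroup_set G.
Hypothesis Gam_discrete : \forall g \near (1 : M), mxgroup_set Gam g -> g = 1.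
Variables (m : probability X R) (r : nat) (b : r.-tuple M) (K : nat).
Hypothesis b_lie : forall i, lie G (tnth b i).
Variables (d : nat) (u : 'rV[R]_d -> M) (x : X).
Hypothesis d_gt0 : (0 < d)%N.
Hypothesis u_continuous : continuous u.
Hypothesis u_G : forall v, mxgroup_set G (u v).

Definition orbit_point (t : d.-tuple (measurableTypeR R)) : X :=
  act (u (row_of_tuple t)) x.

Lemma measurable_orbit (h : X -> R) : continuous h ->
  measurable_fun setT (h \o orbit_point).
Proof.
move=> ch; apply: (@measurable_continuous_row R d (fun v => h (act (u v) x))).
have co := act_continuous (x := x) u_continuous u_G.
by move=> v; apply: continuous_comp; [exact: co|exact: ch].
Qed.

Variables (gamma : R).
Hypothesis x_equi : effective_equidistribution u m b K gamma x.

Section real_function.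
Variables (g : X -> R) (B : R).
Hypothesis g_smooth : rsmooth g.
Hypothesis gB : forall y, `|g y| <= B.
Hypothesis g_fin : finite_sobolev m b K g.

Let g_continuous : continuous g.
Proof. by have [] := g_smooth (s := [::]) (fun A => ltac:(done)). Qed.

Let B0 : 0 <= B.
Proof. exact: le_trans (gB point). Qed.

Let mean := \int[m]_y g y.
Let trunc := @truncated R n G Gam m g.

(** For a fixed radius the truncated functions converge pointwise on the orbit and are bounded by 2
    B, so the estimate, uniform in [j], passes to the limit by dominated convergence. *)
Lemma ball_mean_decay : exists R0 C : R, [/\ 0 < R0, 0 <= C & forall rad, R0 < rad ->
  `|\int[leb d]_(t in eball d rad) (g (orbit_point t) - mean)| <=
    C * rad ^+ d * rad `^ (- gamma)].
Proof.
have [R0 [C [R00 C0 H]]] := x_equi.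
have [N HN] := truncated_sobolev Gam_discrete b_lie g_smooth gB g_fin.
exists R0, (@ball_volume R d * (C * `|N|)).
have V0 : 0 < @ball_volume R d by exact: ball_volume_gt0.
split => //; first by rewrite mulr_ge0 ?(ltW V0)// mulr_ge0// ltW.
move=> rad Rr; have r0 : 0 < rad by exact: lt_trans Rr.
have Vr : fine (leb d (eball d rad)) = rad ^+ d * @ball_volume R d.
  by rewrite leb_eball.
have Vr0 : 0 < rad ^+ d * @ball_volume R d by rewrite mulr_gt0// exprn_gt0.
pose J j := \int[leb d]_(t in eball d rad) trunc j (orbit_point t).
(* Only for large [j]: the truncated function has mean zero once the integral of the cutoff is
   nonzero. *)
have Jle : \forall j \near \oo, `|J j| <= rad ^+ d * @ball_volume R d * (C * `|N| * rad `^ (- gamma)).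
  have nz : \forall j \near \oo, \int[m]_y cutoff j y != 0.
    have /cvgrPdist_lt := @chi_integral_cvg R n G Gam Gam_discrete m.
    move=> /(_ 1 ltr01); apply: filterS => j; apply: contraTneq => ->.
    by rewrite subr0 normr1 ltxx.
  apply: filterS nz => j nz.
  have Cint0 : Cintegral m setT (fun y => (trunc j y)%:C%C) = 0.
    rewrite /Cintegral /=; congr (Complex _ _); last by rewrite Rintegral_cst// mul0r.
    exact: (truncated_integral0 Gam_discrete g_smooth gB nz).
  have := H _ (smooth_real (truncated_smooth Gam_discrete m g_smooth j))
    (@truncated_compact R n G Gam G_closed Gam_sub Gam_discrete m g j) Cint0 rad Rr.
  have rg : 0 <= rad `^ (- gamma) by exact: powR_ge0.
  have bnd : (C%:E * sobolev m b K (fun y => (trunc j y)%:C%C) * (rad `^ (- gamma))%:E <=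
      (C * `|N| * rad `^ (- gamma))%:E)%E.
    rewrite !EFinM; apply: lee_wpmul2r; first by rewrite lee_fin.
    apply: lee_wpmul2l; first by rewrite lee_fin ltW.
    by apply: le_trans (HN j) _; rewrite lee_fin ler_norm.
  move=> /le_trans /(_ bnd); rewrite lee_fin => /(le_trans (Re_le_normc _)).
  rewrite /ball_mean /Cintegral /= mul0r subr0 Vr normrM gtr0_norm ?invr_gt0//.
  by rewrite ler_pdivrMl.
have Jcvg : J j @[j --> \oo] --> \int[leb d]_(t in eball d rad) (g (orbit_point t) - mean).
  apply: (@bounded_convergence _ _ _ (leb d) (eball d rad)
    (fun j => trunc j \o orbit_point) _ ((B + B) * 1)).
  - exact: measurable_eball.
  - exact: leb_eball_lty.
  - move=> j; apply: measurable_funTS; apply: measurable_orbit.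
    by have [] := truncated_smooth Gam_discrete m g_smooth j (s := [::]) (fun A => ltac:(done)).
  - apply: measurable_funTS; apply: measurable_funB; first exact: measurable_orbit.
    exact: measurable_cst.
  - move=> t _; rewrite -[X in _ --> X]mulr1; apply: cvgM; last exact: cutoff_cvg.
    apply: cvgB; first exact: cvg_cst.
    exact: (cutoff_mean_cvg Gam_discrete g_smooth gB).
  - move=> j t _; rewrite /= /trunc /truncated normrM; apply: ler_pM => //.
      apply: le_trans (ler_normB _ _) _; rewrite lerD//.
      exact: (norm_cutoff_mean_le Gam_discrete m g_smooth gB).
    by rewrite ger0_norm ?cutoff_ge0 ?cutoff_le1.
have nJ : `|J j| @[j --> \oo] --> `|\int[leb d]_(t in eball d rad) (g (orbit_point t) - mean)|.
  by apply: cvg_norm; exact: Jcvg.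
rewrite -(cvg_lim _ nJ)//.
rewrite (_ : _ * rad ^+ d * _ = rad ^+ d * @ball_volume R d * (C * `|N| * rad `^ (- gamma))); last by ring.
by apply: limr_le => //; apply/cvg_ex; eexists; exact: nJ.
Qed.

End real_function.
End orbits_of_balls.

(** * Decay of Bochner-Riesz means *)

Lemma real_bochner_riesz_decay (R : realType) (d : nat) (alpha gamma : R) :
  (0 < d)%N -> -1 < alpha -> 0 < gamma ->
  exists2 g' : R, 0 < g' &
    forall (n : nat) (G Gam : mxgroup R n), closed_in_GL G ->
    mxgroup_set Gam `<=` mxgroup_set G ->
    (\forall h \near (1 : 'M[R]_n.+1), mxgroup_set Gam h -> h = 1) ->
    forall (m : probability (quo G Gam) R) (r : nat) (b : r.-tuple 'M[R]_n.+1) (K : nat),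
    (forall i, lie G (tnth b i)) ->
    forall (u : 'rV[R]_d -> 'M[R]_n.+1) (x : quo G Gam), continuous u ->
    (forall v, mxgroup_set G (u v)) ->
    effective_equidistribution u m b K gamma x ->
    forall (g : quo G Gam -> R) (B : R), rsmooth g -> (forall y, `|g y| <= B) ->
    finite_sobolev m b K g ->
    exists C R1 : R, forall rad, R1 < rad ->
      `|(\int[leb d]_(t in eball d 1) bochner_riesz_weight alpha t)^-1 *
         (\int[leb d]_(t in eball d 1) (bochner_riesz_weight alpha t *
            g (act (u (rad *: row_of_tuple t)) x))) - \int[m]_y g y| <=
      C * rad `^ (- g').
Proof.
(* Capping the rate at 1 makes the trivial bound on small balls sufficient in
   [scaled_ball_bound]. *)
move=> d0 a1 gamma0; pose g0 := Num.min gamma 1.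
have g00 : 0 < g0 by rewrite lt_min gamma0 ltr01.
have g01 : g0 <= 1 by rewrite ge_min lexx orbT.
have g0g : g0 <= gamma by rewrite ge_min lexx.
have [g' g'0 decay] := @bochner_riesz_decay R d d0 alpha g0 a1 g00 g01.
exists g' => // n G Gam Gcl Gsub Gdisc m r b K b_lie u x cu uG equi g B sg gB fing.
have cg : continuous g by have [] := sg [::] (fun A => ltac:(done)).
have B0 : 0 <= B by exact: le_trans (gB point).
have [R0 [C [R00 C0 ball]]] :=
  ball_mean_decay Gcl Gsub Gdisc b_lie d0 cu uG equi sg gB fing.
set mean := \int[m]_y g y in ball *.
pose phi t := g (orbit_point u x t) - mean.
have mphi : measurable_fun setT phi.
  by apply: measurable_funB; [exact: measurable_orbit|exact: measurable_cst].
have phiB t : `|phi t| <= B + `|mean|.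
  by apply: le_trans (ler_normB _ _) _; rewrite lerD.
(* Radii above 1 make powers increasing in the exponent, so the decay may be weakened from [gamma]
   to [g0]. *)
have R1 : 1 <= Num.max R0 1 by rewrite le_max lexx orbT.
have ball' rad : Num.max R0 1 < rad ->
    `|\int[leb d]_(t in eball d rad) phi t| <= C * rad ^+ d * rad `^ (- g0).
  rewrite gt_max => /andP[Rr r1]; apply: le_trans (ball rad Rr) _.
  have r0 : 0 < rad by lra.
  rewrite ler_wpM2l ?mulr_ge0 ?exprn_ge0 ?(ltW r0)//.
  by rewrite ler_powR ?(ltW r1)// lerN2.
have [C' H] := decay phi _ C _ mphi phiB C0 R1 ball'.
set Iw := \int[leb d]_(t in _) _.
have Iw0 : 0 < Iw by exact: weight_integral_gt0.
exists (Iw^-1 * C'), (Num.max R0 1) => rad Rr.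
have mD : measurable (eball d (1 : R)) by exact: measurable_eball.
have iw := integrable_weight d0 a1.
pose w := @bochner_riesz_weight R d alpha.
pose h t := g (act (u (rad *: row_of_tuple t)) x).
have phiE t : phi (tscale rad t) = h t - mean.
  by rewrite /phi /orbit_point row_of_tscale.
have mh : measurable_fun setT h.
  rewrite (_ : h = (g \o orbit_point u x) \o tscale rad).
    apply: measurableT_comp; last exact: measurable_tscale.
    exact: measurable_orbit.
  by apply/funext => t; rewrite /h /= /orbit_point row_of_tscale.
have iwh : (leb d).-integrable (eball d 1) (fun t => (w t * h t)%:E).
  apply: (@le_integrable _ _ _ _ _ mD _ (fun t => (B * w t)%:E)).
  - apply/measurable_EFinP; apply: measurable_funTS; apply: measurable_funM => //.
    exact: measurable_weight.
  - move=> t _ /=; rewrite lee_fin !normrM [`|w t|]ger0_norm ?weight_ge0//.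
    by rewrite mulrC ler_wpM2r ?weight_ge0// (le_trans (gB _))// ler_norm.
  - exact: (integrableZl mD _ iw).
have iwm : (leb d).-integrable (eball d 1) (fun t => (mean * w t)%:E).
  exact: (integrableZl mD _ iw).
(* The normalised weight has integral 1, so the mean can be moved inside, where it turns [h] into
   the rescaled [phi]. *)
have -> : Iw^-1 * (\int[leb d]_(t in eball d 1) (w t * h t)) - mean =
    Iw^-1 * \int[leb d]_(t in eball d 1) (w t * phi (tscale rad t)).
  under [in RHS]eq_Rintegral do rewrite phiE mulrBr [_ * mean]mulrC.
  rewrite RintegralB// RintegralZl//.
  by rewrite mulrBr [_ * (mean * _)]mulrCA mulVf ?gt_eqF// mulr1.
rewrite normrM gtr0_norm ?invr_gt0// -mulrA ler_wpM2l ?invr_ge0 ?(ltW Iw0)//.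
exact: H.
Qed.

Theorem theorem3p8 (R : realType) (n : nat) (G Gam : mxgroup R n)
  (G_closed : closed_in_GL G) (G_semisimple : semisimple G)
  (Gam_lattice : is_lattice G Gam)
  (m : probability (quo G Gam) R) (m_invariant : translation_invariant m)
  (a : 'M[R]_n.+1) (aG : mxgroup_set G a) (a_diag : diagonalizable a)
  (d : nat) (d_ge2 : (2 <= d)%N)
  (u : 'rV[R]_d -> 'M[R]_n.+1)
  (u_iso : vector_group_iso u (horospherical G a))
  (r : nat) (b : r.-tuple 'M[R]_n.+1) (b_basis : lie_basis G b)
  (x : quo G Gam)
  (x_dense : closure [set act h x | h in horospherical G a] = setT)
  (K : nat) (gamma : R) (gamma_gt0 : 0 < gamma)
  (x_equi : effective_equidistribution u m b K gamma x)
  (alpha : R) (alpha_gtN1 : -1 < alpha) :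
  exists2 gamma' : R, 0 < gamma' &
    forall f : quo G Gam -> R[i],
      smooth f -> bounded_fct f -> (sobolev m b K f < +oo)%E ->
      exists C R1 : R, forall rad : R, R1 < rad ->
        Normc.normc (bochner_riesz u alpha rad f x - Cintegral m setT f)
          <= C * rad `^ (- gamma').
Proof.
have d0 : (0 < d)%N by exact: ltnW.
have [g' g'0 decay] := real_bochner_riesz_decay d0 alpha_gtN1 gamma_gt0.
exists g' => // f sf [B fB] finf.
have [Gsub Gdisc _] := Gam_lattice.
have [u_range _ cu _] := u_iso.
have uG v : mxgroup_set G (u v).
  have : horospherical G a (u v) by rewrite -u_range; exists v.
  by case.
have b_lie i : lie G (tnth b i).
  by apply/b_basis.2; apply/memv_span/mem_tnth.
have [C1 [R1 H1]] := decay _ _ _ G_closed Gsub Gdisc m _ _ K b_lie u x cu uG x_equi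
  (fun y => complex.Re (f y)) B (rsmooth_Re sf)
  (fun y => le_trans (Re_le_normc _) (fB y))
  (finite_sobolev_part b_lie (@Re_le_normc R) (Re_foldr_lie_deriv f) sf (rsmooth_Re sf) finf).
have [C2 [R2 H2]] := decay _ _ _ G_closed Gsub Gdisc m _ _ K b_lie u x cu uG x_equi
  (fun y => complex.Im (f y)) B (rsmooth_Im sf)
  (fun y => le_trans (Im_le_normc _) (fB y))
  (finite_sobolev_part b_lie (@Im_le_normc R) (Im_foldr_lie_deriv f) sf (rsmooth_Im sf) finf).
(* The exponent [g'] was obtained before [f], so the real and imaginary parts share it and only
   their constants add up. *)
exists (C1 + C2), (Num.max R1 R2) => rad; rewrite gt_max => /andP[r1 r2].
apply: le_trans (normc_le_ReIm _) _; rewrite mulrDl; apply: lerD.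
  apply: le_trans (H1 _ r1); rewrite /bochner_riesz /Cintegral /= mul0r subr0.
  rewrite (_ : \int[leb d]_(t in _) complex.Re _ = \int[leb d]_(t in eball d 1)
    (bochner_riesz_weight alpha t * complex.Re (f (act (u (rad *: row_of_tuple t)) x))))//.
  by apply: eq_Rintegral => t _; case: (f _) => p q /=; rewrite mul0r subr0.
apply: le_trans (H2 _ r2); rewrite /bochner_riesz /Cintegral /= mul0r addr0.
rewrite (_ : \int[leb d]_(t in _) complex.Im _ = \int[leb d]_(t in eball d 1)
  (bochner_riesz_weight alpha t * complex.Im (f (act (u (rad *: row_of_tuple t)) x))))//.
by apply: eq_Rintegral => t _; case: (f _) => p q /=; rewrite mul0r addr0.
Qed.
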